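(* Let $\tau\in S_d$, let $r_1=1$, let $R\in\mathbb N_+$ satisfy $\min\{n_{\tau(1)},n_{\tau(d)}\}\ge R$ and $\min_{2\le j\le d-1} n_{\tau(j)}\ge R^2>\max_{2\le j\le d} r_j\ge\min_{2\le j\le d} r_j\ge R$, and let $\vec{\mathbf u}\in\mathcal U^d_{\vec r,\vec n,\tau}$. Suppose there is a constant $\sigma>0$ such that for any $i_1,i_2,i_3\in\{1,\dots,d\}$ for which $(i_1,i_2,i_3)$ is of the correct order with respect to $\tau$ and any $y_i\in\{1,\dots,n_i\}$, $i\in\{1,\dots,d\}\setminus\{i_1,i_2,i_3\}$, the matrix $M_{i_2,(i_1,i_3)}\in\mathbb R^{n_{i_2}\times(n_{i_1}n_{i_3})}$ formed from $\varphi(\vec{\mathbf u},\tau)$ satisfies $\sigma_{R^2}(M_{i_2,(i_1,i_3)})\ge\sigma$. Suppose that each observation of an entry of $\mathbf T=\varphi(\vec{\mathbf u},\tau)$ is contaminated by additive noise distributed as $\mathcal N(0,\sigma_e^2)$, $\sigma_e>0$, independently across observations. Let $n_{\max}=\max_{1\le i\le d} n_i$. Then for any $T<\frac{\sigma}{\sigma_e}$, any three distinct indices $i_1,i_2,i_3\in\{1,\dots,d\}$, and any $y_i\in\{1,\dots,n_i\}$, $i\in\{1,\dots,d\}\setminus\{i_1,i_2,i_3\}$, the probability that the Three-Index Algorithm, run with the integer $R$, these $y_i$ and the noisy observations, returns an incorrect ordering of $i_1,i_2,i_3$ (one not of the correct order with respect to $\tau$) is at most $$6\exp\left(-\tfr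ac18\max\{T-2n_{\max}-2\sqrt{n_{\max}},0\}^2\right).$$
   Context: **Tensor train format.** $d$ is a positive integer, $S_d$ is the group of permutations of $\{1,\dots,d\}$, and $\vec n=(n_1,\dots,n_d)$, $\vec r=(r_1,\dots,r_d)$ are vectors of positive integers with $r_1=1$; subscripts of $r$ are read modulo $d$ (so $r_{d+1}=r_1=1$). For $\tau\in S_d$ let $\mathcal U^d_{\vec r,\vec n,\tau}=\bigoplus_{i=1}^d\mathbb R^{r_{\tau^{-1}(i)}\times n_i\times r_{\tau^{-1}(i)+1}}$. For $\vec{\mathbf u}=(\mathbf u^{[1]},\dots,\mathbf u^{[d]})$ in it, write $\mathbf u^{[i]}(x)=\mathbf u^{[i]}(:,x,:)\in\mathbb R^{r_{\tau^{-1}(i)}\times r_{\tau^{-1}(i)+1}}$. The tensor $\varphi(\vec{\mathbf u},\tau)\in\mathbb R^{n_1\times\cdots\times n_d}$ has entries (the $1\times1$ matrix product) $$\varphi(\vec{\mathbf u},\tau)(x_1,\dots,x_d)=\mathbf u^{[\tau(1)]}(x_{\tau(1)})\,\mathbf u^{[\tau(2)]}(x_{\tau(2)})\cdots\mathbf u^{[\tau(d)]}(x_{\tau(d)}).$$ **Correct order.** For distinct $i_1,i_2,i_3\in\{1,\dots,d\}$, $(i_1,i_2,i_3)$ is of the correct order with respect to $\tau$ if $\tau^{-1}(i_1)<\tau^{-1}(i_2)<\tau^{-1}(i_3)$ or $\tau^{-1}(i_3)<\tau^{-1}(i_2)<\tau^{-1}(i_1)$. **Matricizations.** Given distinct $i_1,i_2,i_3$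 and fixed $y_i\in\{1,\dots,n_i\}$ for $i\notin\{i_1,i_2,i_3\}$, let $A(x_{i_1},x_{i_2},x_{i_3})$ be the entry of the tensor whose $i_s$-th coordinate is $x_{i_s}$ ($1\le s\le3$) and whose $i$-th coordinate is $y_i$ for all other $i$. Define $M_{i_1,(i_2,i_3)}\in\mathbb R^{n_{i_1}\times(n_{i_2}n_{i_3})}$, $M_{i_2,(i_3,i_1)}\in\mathbb R^{n_{i_2}\times(n_{i_3}n_{i_1})}$, $M_{i_3,(i_1,i_2)}\in\mathbb R^{n_{i_3}\times(n_{i_1}n_{i_2})}$ by $M_{i_1,(i_2,i_3)}(x_{i_1},(x_{i_2},x_{i_3}))=M_{i_2,(i_3,i_1)}(x_{i_2},(x_{i_3},x_{i_1}))=M_{i_3,(i_1,i_2)}(x_{i_3},(x_{i_1},x_{i_2}))=A(x_{i_1},x_{i_2},x_{i_3})$. Likewise $M_{i_2,(i_1,i_3)}(x_{i_2},(x_{i_1},x_{i_3}))=A(x_{i_1},x_{i_2},x_{i_3})$, which is $M_{i_2,(i_3,i_1)}$ up to a reordering of columns. $\sigma_k(M)$ denotes the $k$-th largest singular value of $M$, with $\sigma_k(M)=0$ if $k$ exceeds the smaller dimension of $M$. **Three-Index Algorithm.** Input: $i_1,i_2,i_3$, an integer $R\in\mathbb N_+$, and an oracle for the entries of $\mathbf T$. Choose $y_i\in\{1,\dots,n_i\}$ for $i\notin\{i_1,i_2,i_3\}$; form the three matrices $M_{i_1,(i_2,i_3)},M_{i_2,(i_3,i_1)},M_{i_3,(i_1,i_2)}$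 from the (here noisy) observed entries of $\mathbf T$. Compare $a=\sigma_{R^2}(M_{i_1,(i_2,i_3)})$, $b=\sigma_{R^2}(M_{i_2,(i_3,i_1)})$, $c=\sigma_{R^2}(M_{i_3,(i_1,i_2)})$. If $a>\max\{b,c\}$ return $(i_2,i_1,i_3)$; if $b>\max\{a,c\}$ return $(i_1,i_2,i_3)$; if $c>\max\{a,b\}$ return $(i_2,i_3,i_1)$. (If there is a tie and no case applies, this is counted as an incorrect output.) *)

(* Defs.v *)
From HB Require Import structures.
From mathcomp Require Import all_boot all_order all_algebra all_fingroup.
From mathcomp Require Import spectral.
From mathcomp Require Import all_classical all_reals all_analysis.
From mathcomp Require Import complex.

Set Implicit Arguments.
Unset Strict Implicit.
Unset Printing Implicit Defensive.

Import Order.TTheory GRing.Theory Num.Theory.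

Local Open Scope ring_scope.

(* The order of the tensor is d.+1, and all indices start at 0: the mode or
   position called j (1 <= j <= d.+1) in the usual convention is j.-1 here. *)

Section TensorTrain.
Variables (R : realType) (d : nat) (n r : 'I_d.+1 -> nat).

Definition entry_index := {dffun forall i : 'I_d.+1, 'I_(n i)}.

Definition tensor := entry_index -> R.

(* [ordS] is the cyclic successor, so that the subscripts of r are read
   modulo d.+1. *)
Definition tt_param (tau : 'S_d.+1) :=
  forall i : 'I_d.+1,
    'I_(n i) -> 'M[R]_(r ((tau^-1)%g i), r (ordS ((tau^-1)%g i))).

Lemma tt_row_eq (tau : 'S_d.+1) (k : nat) :
  r ((tau^-1)%g (tau (inZp k))) = r (inZp k).
Proof. by rewrite permK. Qed.

Lemma tt_col_eq (tau : 'S_d.+1) (k : nat) :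
  r (ordS ((tau^-1)%g (tau (inZp k)))) = r (inZp k.+1).
Proof.
by rewrite permK; congr r; apply: val_inj => /=; rewrite -addn1 modnDml addn1.
Qed.

(* The k-th factor u^[tau(k)](x_{tau(k)}) of the matrix product; the cast
   identifies tau^-1 (tau k) with k in the dimensions. *)
Definition tt_factor (tau : 'S_d.+1) (u : tt_param tau) (x : entry_index) (k : nat) :
    'M[R]_(r (inZp k), r (inZp k.+1)) :=
  castmx (tt_row_eq tau k, tt_col_eq tau k)
    (u (tau (inZp k)) (x (tau (inZp k)))).

Fixpoint tt_prod (tau : 'S_d.+1) (u : tt_param tau) (x : entry_index) (k : nat) :
    'M[R]_(r (inZp 0), r (inZp k)) :=
  if k is k'.+1 then tt_prod u x k' *m tt_factor u x k' else 1%:M.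

Lemma r_inZp0 : r ord0 = 1%N -> r (inZp 0) = 1%N.
Proof. by move=> <-; congr r; apply: val_inj; rewrite /= mod0n. Qed.

Lemma r_inZpd : r ord0 = 1%N -> r (inZp d.+1) = 1%N.
Proof. by move=> <-; congr r; apply: val_inj; rewrite /= modnn. Qed.

Definition tt_tensor (r1 : r ord0 = 1%N) (tau : 'S_d.+1) (u : tt_param tau) :
    tensor :=
  fun x => castmx (r_inZp0 r1, r_inZpd r1) (tt_prod u x d.+1) 0 0.

Definition correct_order (tau : 'S_d.+1) (i1 i2 i3 : 'I_d.+1) : bool :=
  let p i : nat := (tau^-1)%g i in
  ((p i1 < p i2) && (p i2 < p i3) || (p i3 < p i2) && (p i2 < p i1))%N.

(* The coordinates of y at i1, i2, i3 are overwritten, so that only its other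
   coordinates matter. *)
Definition slice (i1 i2 i3 : 'I_d.+1) (y : entry_index) (T : tensor)
    (x1 : 'I_(n i1)) (x2 : 'I_(n i2)) (x3 : 'I_(n i3)) : R :=
  let upd := @dfwith 'I_d.+1 (fun i => 'I_(n i)) in
  T (finfun (upd (upd (upd y i1 x1) i2 x2) i3 x3)).

End TensorTrain.

Arguments slice {R d n} i1 i2 i3 y T x1 x2 x3.

(* The entry in row x and column [mxvec_index y z] is A x y z. *)
Definition matricize (R : realType) (n1 n2 n3 : nat)
    (A : 'I_n1 -> 'I_n2 -> 'I_n3 -> R) : 'M[R]_(n1, n2 * n3) :=
  \matrix_(x < n1) mxvec (\matrix_(y < n2, z < n3) A x y z).

(* [spectral_diag] lists the eigenvalues, with multiplicity, of a normal matrix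
   over an algebraically closed field; those of M *m M^T are nonnegative reals.
   There are n1 of them, and the ones beyond minn n1 n2 vanish. *)
Definition singular_values (R : realType) (n1 n2 : nat) (M : 'M[R]_(n1, n2)) :
    seq R :=
  let ev := spectral_diag (map_mx (real_complex R) (M *m M^T)) in
  sort (fun a b => b <= a) [seq Num.sqrt (complex.Re (ev 0 i)) | i : 'I_n1].

(* The k-th largest singular value, for k >= 1. *)
Definition singular_value (R : realType) (k n1 n2 : nat) (M : 'M[R]_(n1, n2)) : R :=
  nth 0 (singular_values M) k.-1.

Section Algorithm.
Variables (R : realType) (d : nat) (n : 'I_d.+1 -> nat).

(* [oracle x k] is the k-th observation of the entry x. The three matrices may
   be filled with the same observations or with different ones: the s-th matrix
   uses the observation number [q s x] of the entry x (m = 1 is the case where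
   every entry is observed once and shared by the three matrices; m = 3 and
   q s x = s the case where every matrix is observed afresh).
   [None] stands for a tie. *)
Definition three_index (i1 i2 i3 : 'I_d.+1) (R0 m : nat)
    (oracle : entry_index n -> 'I_m -> R) (q : 'I_3 -> entry_index n -> 'I_m)
    (y : entry_index n) : option ('I_d.+1 * 'I_d.+1 * 'I_d.+1) :=
  let A s := slice i1 i2 i3 y (fun x => oracle x (q s x)) in
  let M1 := matricize (fun x1 x2 x3 => A (inord 0) x1 x2 x3) in
  let M2 := matricize (fun x2 x3 x1 => A (inord 1) x1 x2 x3) in
  let M3 := matricize (fun x3 x1 x2 => A (inord 2) x1 x2 x3) in
  let a := singular_value (R0 ^ 2) M1 in
  let b := singular_value (R0 ^ 2) M2 in
  let c := singular_value (R0 ^ 2) M3 in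
  if Num.max b c < a then Some (i2, i1, i3)
  else if Num.max a c < b then Some (i1, i2, i3)
  else if Num.max a b < c then Some (i2, i3, i1)
  else None.

Definition correct_output (tau : 'S_d.+1)
    (o : option ('I_d.+1 * 'I_d.+1 * 'I_d.+1)) : bool :=
  if o is Some (j1, j2, j3) then correct_order tau j1 j2 j3 else false.

End Algorithm.

Local Open Scope classical_set_scope.

Definition mutually_independent (dO : measure_display)
    (Omega : measurableType dO) (R : realType) (P : probability Omega R)
    (I : finType) (X : I -> {RV P >-> R}) : Prop :=
  forall (J : {set I}) (B : I -> set R),
    (forall i, measurable (B i)) ->
    P (\bigcap_(i in [set i | i \in J]) (X i @^-1` B i)) =
    (\prod_(i in J) P (X i @^-1` B i))%E.

Definition normally_distributed (dO : measure_display)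
    (Omega : measurableType dO) (R : realType) (P : probability Omega R)
    (X : {RV P >-> R}) (mean sd : R) : Prop :=
  forall B : set R, measurable B -> distribution P X B = normal_prob mean sd B.

(* Main.v *)
Require Import Defs.
From mathcomp Require Import all_boot all_order all_algebra all_fingroup.
From mathcomp Require Import all_classical all_reals all_analysis.
From mathcomp Require Import spectral measurable_realfun complex.
From mathcomp Require Import ring lra zify.

Set Implicit Arguments.
Unset Strict Implicit.
Unset Printing Implicit Defensive.

Import Order.TTheory GRing.Theory Num.Theory.
Import numFieldNormedType.Exports.

Local Open Scope classical_set_scope.
Local Open Scope ring_scope.

(** If i1 is not the middle one of the three indices in the train, then cutting
    the train next to i1 factors its matricization through R^{r_j} with
    r_j < R0^2, so its R0^2-th singular value vanishes, while that of the middle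
    index is at least sigma. By Weyl's inequality an incorrect answer requires
    one of the three noise matrices to have operator norm above sigma_e T / 2;
    each has at most N rows and N^2 columns, where N = n_max.

    The bound P(|E| > s (sqrt m + sqrt n + t)) <= exp(-t^2/2) for an m x n
    Gaussian matrix E of standard deviation s is Chevet's argument in
    exponential form: for unit vectors u_k, v_k, the soft maximum
    Phi(L) = (sum_k exp(beta L_k))^th of u_k^T E v_k + s g has a smaller
    expectation than that of s (u_k . g' + v_k . g''). Letting th -> 0 with
    th * beta = l fixed gives E exp(l max_k u_k^T E v_k) <=
    exp(l s (sqrt m + sqrt n) + l^2 s^2 / 2). No Gaussian vector is needed:
    every normal variable is replaced by a sum of N small random signs, which is
    an iterated shift average, and the comparison is made for a single sign, up
    to an error O(h^3) for signs of size h. The noise itself, of which only the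
    marginal laws and the product rule are known, is first cut into small
    cells. *)

(** * Bounds on the exponential *)

Section ExpBounds.
Variable R : realType.
Implicit Types x y t : R.

(** The comparison constants C and h0 depend on [beta] and [th], so the parameters are fixed in this
    order: [th], then the sign size h, then the fineness M of the cells. A variable of standard
    deviation s is replaced by s^2 / h^2 signs, hence errors O(h^3) add up to O(h); it suffices to
    match second-order terms. The bound obtained does not depend on the number of vectors u_k, v_k,
    and so passes to an increasing union of finite sets of rational directions: the operator norm is
    reached without the loss of a net argument. Independence, given as a product rule for events,
    computes the probability of a box but not directly the expectation of a function of all the
    variables; this is what the cells are for. With t = T / 2 - sqrt n_max - n_max, the threshold
    sigma_e (sqrt n_max + n_max + t) equals sigma_e T / 2, and t^2 / 2 is one eighth of the square
    in the statement. The three matrices together cost 3 exp(- t^2 / 2), half of the stated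
    bound. *)

Lemma le_of_derive_ge0 (f df : R -> R) (x : R) :
  (forall t : R, is_derive t (1 : R) f (df t)) -> (forall t, 0 <= t -> 0 <= df t) ->
  0 <= x -> f 0 <= f x.
Proof.
move=> fdf df0 x0; apply: (@ger0_derive1_ndecry _ f 0) => //.
- move=> t; rewrite in_itv/= andbT => t0.
  by rewrite derive1E (@derive_val _ _ _ _ _ _ _ (fdf t)) df0 ?ltW.
- apply: continuous_subspaceT => t; apply: differentiable_continuous.
  by apply/derivable1_diffP; case: (fdf t).
Qed.

(** From exp x <= 1 / (1 - x); the coefficient 2 is what x <= 1 / 2 allows. *)
Lemma expR_le_quad x : 0 <= x <= 1 / 2 -> expR x <= 1 + x + 2 * x ^+ 2.
Proof.
move=> /andP[x0 x1]; have := expR_ge1Dx (- x); rewrite expRN => h.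
have e0 := expR_gt0 x.
have : (1 - x) * expR x <= 1.
  by rewrite -(@ler_pM2r _ (expR x)^-1) ?invr_gt0// mulfK ?gt_eqF// mul1r.
nra.
Qed.

Lemma expRN_le_quad x : 0 <= x -> expR (- x) <= 1 - x + x ^+ 2.
Proof.
move=> x0; have := expR_ge1Dx x; have e0 := expR_gt0 (- x).
have := expRxMexpNx_1 x; have := expR_gt0 x; nra.
Qed.

Lemma expR_ge_quad x : 0 <= x -> 1 + x + x ^+ 2 / 2 <= expR x.
Proof.
move=> x0; pose f t : R := expR t - t - t ^+ 2 / 2.
pose df t : R := expR t - 1 - t.
have fdf (t : R) : is_derive t (1 : R) f (df t).
  by rewrite /f /df; apply: is_derive_eq; rewrite /GRing.scale/=; lra.
have := @le_of_derive_ge0 f df x fdf _ x0; rewrite /f expR0 expr0n /= => h.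
suff: 1 - 0 - 0 / 2 <= expR x - x - x ^+ 2 / 2 by lra.
by apply: h => t t0; rewrite /df; have := expR_ge1Dx t; lra.
Qed.

Lemma expRN_ge_cubic x : 0 <= x -> 1 - x + x ^+ 2 / 2 - x ^+ 3 <= expR (- x).
Proof.
move=> x0; pose f t : R := expR (- t) + t - t ^+ 2 / 2 + t ^+ 3.
pose df t : R := - expR (- t) + 1 - t + 3 * t ^+ 2.
have fdf (t : R) : is_derive t (1 : R) f (df t).
  by rewrite /f /df; apply: is_derive_eq; rewrite /GRing.scale/=; field.
have := @le_of_derive_ge0 f df x fdf _ x0; rewrite /f oppr0 expR0 !expr0n /= => h.
suff: 1 + 0 - 0 / 2 + 0 <= expR (- x) + x - x ^+ 2 / 2 + x ^+ 3 by lra.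
by apply: h => t t0; rewrite /df; have := expRN_le_quad t0; nra.
Qed.

Lemma expR_ge_cubic x : 1 + x + x ^+ 2 / 2 - `|x| ^+ 3 <= expR x.
Proof.
have [x0|x0] := leP 0 x.
  by rewrite ger0_norm//; have := expR_ge_quad x0; have := exprn_ge0 3 x0; lra.
rewrite ltr0_norm//; have /expRN_ge_cubic: 0 <= - x by lra.
by rewrite opprK; nra.
Qed.

(** The quotient of cosh x by exp (x^2 / 2) decreases on x >= 0, and the sign of its derivative is
    the inequality [lin]. This bounds the moment generating function of a fair sign by that of a
    Gaussian of the same variance. *)
Lemma cosh_le_expR x : (expR x + expR (- x)) / 2 <= expR (x ^+ 2 / 2).
Proof.
wlog x0 : x / 0 <= x.
  move=> H; have [/H//|x0] := leP 0 x.
  by have := H (- x); rewrite opprK sqrrN addrC; apply; lra.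
have lin t : 0 <= t -> (1 - t) * expR (2 * t) <= 1 + t.
  move=> t0; pose f t : R := t - (1 - t) * expR (2 * t).
  pose df t : R := 1 - (1 - 2 * t) * expR (2 * t).
  have fdf (s : R) : is_derive s (1 : R) f (df s).
    by rewrite /f /df; apply: is_derive_eq; rewrite /GRing.scale/=; field.
  have := @le_of_derive_ge0 f df t fdf _ t0.
  rewrite /f mulr0 expR0 => h; suff : 0 - (1 - 0) * 1 <= t - (1 - t) * expR (2 * t).
    lra.
  apply: h => s s0; rewrite /df.
  have := expR_ge1Dx (- (2 * s)); have := expRxMexpNx_1 (2 * s).
  have := expR_gt0 (2 * s); nra.
pose f t : R := - (expR (t - t ^+ 2 / 2) + expR (- t - t ^+ 2 / 2)).
pose df t : R := - ((1 - t) * expR (t - t ^+ 2 / 2)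
                    - (1 + t) * expR (- t - t ^+ 2 / 2)).
have fdf (t : R) : is_derive t (1 : R) f (df t).
  by rewrite /f /df; apply: is_derive_eq; rewrite /GRing.scale/=; field.
have := @le_of_derive_ge0 f df x fdf _ x0; rewrite /f !(expr0n, mul0r, subr0, oppr0) expR0.
move=> h; have {h} := h _; rewrite !expRD expRN; have := expR_gt0 (x ^+ 2 / 2).
set E := expR (x ^+ 2 / 2) => E0; rewrite -mulrDl lerN2 => h.
suff : (expR x + expR (- x)) / E <= 1 + 1 by rewrite ler_pdivrMr//; lra.
apply: h => t t0; rewrite /df.
have -> : t - t ^+ 2 / 2 = 2 * t + (- t - t ^+ 2 / 2) by ring.
rewrite expRD mulrA -mulrBl -mulNr mulr_ge0 ?expR_ge0//.
by have := lin t t0; lra.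
Qed.

End ExpBounds.

(** * Averages over symmetric shifts *)

Section ShiftAverages.
Variables (R : realType) (V : zmodType).
Implicit Types (f g : V -> R) (x z : V) (s t : seq V).

Definition avg z f : V -> R := fun x => (f (x + z) + f (x - z)) / 2.

(** The expectation of f (x + sum of eps_z z) over independent fair signs eps_z, z in s: a list of
    shifts stands for the probability space. *)
Definition avgs s f : V -> R := foldr avg f s.

Lemma avgs_cat s t f : avgs (s ++ t) f = avgs s (avgs t f).
Proof. exact: foldr_cat. Qed.

Lemma avgs_le s f g : (forall x, f x <= g x) -> forall x, avgs s f x <= avgs s g x.
Proof.
move=> fg; elim: s => //= z s IH x.
by rewrite /avg ler_pM2r ?invr_gt0// lerD.
Qed.

Lemma avgsZ s c f x : avgs s (fun y => c * f y) x = c * avgs s f x.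
Proof.
by elim: s x => //= z s IH x; rewrite /avg !IH -mulrDr mulrA.
Qed.

Lemma avgsD s f g x : avgs s (fun y => f y + g y) x = avgs s f x + avgs s g x.
Proof.
by elim: s x => //= z s IH x; rewrite /avg !IH addrACA mulrDl.
Qed.

Lemma avgs_sum (I : finType) s (f : I -> V -> R) x :
  avgs s (fun y => \sum_i f i y) x = \sum_i avgs s (f i) x.
Proof.
elim: s x => //= z s IH x; rewrite /avg !IH -big_split mulr_suml.
by apply: eq_bigr.
Qed.

Lemma avgs_shift s f x : avgs s f x = avgs s (fun y => f (x + y)) 0.
Proof.
have -> : (fun y => f (x + y)) = f \o +%R x by [].
suff h y : avgs s f (x + y) = avgs s (f \o +%R x) y by rewrite -h addr0.
by elim: s y => //= z s IH y; rewrite /avg -!addrA !IH.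
Qed.

Lemma avgs_swap s z f : avgs s (avg z f) = avg z (avgs s f).
Proof.
elim: s => //= z' s ->; apply/funext => x; rewrite /avg.
rewrite -!(addrA x) [z' + z]addrC [z' - z]addrC [- z' + z]addrC [- z' - z]addrC.
by rewrite -!mulrDl addrACA.
Qed.

Lemma avgsC s t f : avgs s (avgs t f) = avgs t (avgs s f).
Proof. by elim: t => //= z t IH; rewrite avgs_swap IH. Qed.

Lemma avgs_perm s t f : perm_eq s t -> avgs s f = avgs t f.
Proof.
move=> /(@catCA_perm_ind _ (fun s' => avgs s f = avgs s' f)); apply=> // a b c ->.
by rewrite !avgs_cat avgsC.
Qed.

Lemma avgs_ge0 s f x : (forall x, 0 <= f x) -> 0 <= avgs s f x.
Proof.
by move=> f0; elim: s x => //= z s IH x; rewrite /avg divr_ge0// addr_ge0.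
Qed.

(** Averages commute, so copies of s can be exchanged for copies of t one at a time. The one-step
    inequality must hold at every x because the remaining averages move the base point. *)
Lemma avgs_iter s t f a b K : 0 <= a -> 0 <= b ->
  (forall x, a * avgs s f x <= b * avgs t f x) ->
  forall x, a ^+ K * avgs (flatten (nseq K s)) f x <=
            b ^+ K * avgs (flatten (nseq K t)) f x.
Proof.
move=> a0 b0 st; elim: K => [|K IH] x /=; first by rewrite !expr0.
rewrite !avgs_cat !exprS -!mulrA.
rewrite -(avgsZ s) (le_trans (ler_wpM2l a0 (avgs_le s IH x)))//.
rewrite avgsZ -avgsC [leLHS]mulrCA -(avgsZ (flatten _)) [leRHS]mulrCA.
rewrite ler_wpM2l ?exprn_ge0// avgsC -(avgsZ (flatten _) b).
exact: avgs_le.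
Qed.

(* The parallelogram law makes the average exact on quadratic functions. *)
Lemma avgs_quadratic s (Q D : V -> R) :
  (forall x z, Q (x + z) + Q (x - z) = 2 * Q x + 2 * D z) ->
  forall x, avgs s Q x = Q x + \sum_(z <- s) D z.
Proof.
move=> QD; elim: s => [|z s IH] x /=; first by rewrite big_nil addr0.
by rewrite /avg !IH addrACA QD big_cons; field.
Qed.

Lemma avgs_expR s (l : V -> R) x : zmod_morphism l ->
  avgs s (fun y => expR (l y)) x <= expR (l x + (\sum_(z <- s) l z ^+ 2) / 2).
Proof.
move=> lB; have lD y z : l (y + z) = l y + l z.
  have lN u : l (- u) = - l u by rewrite -sub0r lB -{1}(subrr u) lB subrr sub0r.
  by rewrite -[z in LHS]opprK lB lN opprK.
elim: s x => [|z s IH] x /=; first by rewrite big_nil mul0r addr0.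
rewrite /avg big_cons; set S := \sum_(_ <- _) _.
apply: (@le_trans _ _ ((expR (l (x + z) + S / 2) + expR (l (x - z) + S / 2)) / 2)).
  by rewrite ler_pM2r ?invr_gt0// lerD// IH.
rewrite lD lB.
have -> : l x + (l z ^+ 2 + S) / 2 = l x + S / 2 + l z ^+ 2 / 2 by ring.
rewrite (expRD _ (l z ^+ 2 / 2)).
have -> : l x + l z + S / 2 = l x + S / 2 + l z by ring.
have -> : l x - l z + S / 2 = l x + S / 2 - l z by ring.
by rewrite !(expRD (l x + S / 2)) -mulrDr -mulrA ler_pM2l ?expR_gt0// cosh_le_expR.
Qed.

End ShiftAverages.

Lemma avgs_map (R : realType) (V W : zmodType) (pi : W -> V)
    (s : seq W) (f : V -> R) (w : W) : zmod_morphism pi ->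
  avgs (map pi s) f (pi w) = avgs s (f \o pi) w.
Proof.
move=> piB; have piD x z : pi (x + z) = pi x + pi z.
  have piN u : pi (- u) = - pi u by rewrite -sub0r piB -{1}(subrr u) piB subrr sub0r.
  by rewrite -[z in LHS]opprK piB piN opprK.
by elim: s w => //= z s IH w; rewrite /avg -piD -piB !IH.
Qed.

(** The partial sums of the shifts never leave the box of radius [size s * b], so a pointwise bound
    is only asked for there. This is needed for [pmean_ge], which holds for small arguments only. *)
Lemma avgs_ge_near (R : realType) (K : finType) (s : seq {ffun K -> R}) (b : R)
    (f g : {ffun K -> R} -> R) (x : {ffun K -> R}) :
  (forall z, z \in s -> forall k, `|z k| <= b) ->
  (forall y : {ffun K -> R},
     (forall k, `|y k| <= (size s)%:R * b) -> g y <= f (x + y)) ->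
  avgs s g 0 <= avgs s f x.
Proof.
move=> sb gf; rewrite -[x]addr0.
(* The origin of the box is generalised, so that the induction can follow the partial sums. *)
have {gf} : forall y : {ffun K -> R},
    (forall k, `|y k - (0 : {ffun K -> R}) k| <= (size s)%:R * b) -> g y <= f (x + y).
  by move=> y yb; apply: gf => k; have := yb k; rewrite ffunE subr0.
move: (0 : {ffun K -> R}) => x0.
elim: s sb x0 => [|z s IH] sb x0 gf /=; first by apply: gf => k; rewrite subrr normr0 mul0r.
rewrite /avg ler_pM2r ?invr_gt0//.
have zb := sb z (mem_head _ _).
rewrite -!addrA; apply: lerD; apply: IH => [u us|y yb]; first by apply: sb; rewrite inE us orbT.
- apply: gf => k; have -> : y k - x0 k = (y k - (x0 + z) k) + z k by rewrite ffunE; ring.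
  by rewrite (le_trans (ler_normD _ _))//= -addn1 natrD mulrDl mul1r lerD.
- by apply: sb; rewrite inE us orbT.
apply: gf => k; have -> : y k - x0 k = (y k - (x0 - z) k) - z k by rewrite !ffunE; ring.
by rewrite (le_trans (ler_normB _ _))//= -addn1 natrD mulrDl mul1r lerD.
Qed.

(** * Power means of exponentials, to second order *)

Section PowerMean.
Variables (R : realType) (K : finType) (p : K -> R) (th : R).
Hypotheses (p0 : forall k, 0 <= p k) (p1 : \sum_k p k = 1).
Hypotheses (th0 : 0 <= th) (th1 : th <= 1).
Implicit Types y : K -> R.

Definition mean y := \sum_k p k * y k.

Definition pmean y := expR (th * ln (mean (fun k => expR (y k)))).

Lemma meanD y y' : mean (fun k => y k + y' k) = mean y + mean y'.
Proof. by rewrite /mean -big_split; apply: eq_bigr => k _; rewrite mulrDr. Qed.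

Lemma meanZ c y : mean (fun k => c * y k) = c * mean y.
Proof. by rewrite /mean mulr_sumr; apply: eq_bigr => k _; rewrite mulrCA. Qed.

Lemma mean_cst c : mean (fun=> c) = c.
Proof. by rewrite /mean -mulr_suml p1 mul1r. Qed.

Lemma ler_mean y y' : (forall k, y k <= y' k) -> mean y <= mean y'.
Proof. by move=> yy; apply: ler_sum => k _; rewrite ler_wpM2l. Qed.

Lemma mean_bound y b : (forall k, `|y k| <= b) -> `|mean y| <= b.
Proof.
move=> yb; rewrite ler_norml -(mean_cst b) -(mulN1r (mean _)) -meanZ.
by rewrite !ler_mean// => k; have := yb k; rewrite ler_norml ?mulN1r => /andP[].
Qed.

Lemma mean_expR_gt0 y : 0 < mean (fun k => expR (y k)).
Proof.
pose b := \sum_k `|y k|.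
rewrite (@lt_le_trans _ _ (expR (- b))) ?expR_gt0// -[leLHS]mean_cst ler_mean// => k.
rewrite ler_expR; suff : `|y k| <= b by rewrite ler_norml => /andP[].
by rewrite /b (bigD1 k)//= lerDl sumr_ge0.
Qed.

(* Young's inequality, which is an equality to second order at [y = mean y]. *)
Lemma pmean_le y m : pmean y <= (1 - th) * expR (th * m)
  + th * mean (fun k => expR (y k + (th - 1) * m)).
Proof.
set W := mean (fun k => expR (y k)).
have W0 : 0 < W by exact: mean_expR_gt0.
have -> : mean (fun k => expR (y k + (th - 1) * m)) = expR (ln W + (th - 1) * m).
  rewrite expRD lnK ?posrE// [RHS]mulrC /W -meanZ; congr mean.
  by apply/funext => k; rewrite expRD mulrC.
rewrite /pmean -/W; set l := ln W.
have tangent a : expR (th * l) * (1 + (a - th * l)) <= expR a.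
  rewrite -{2}(subrK (th * l) a) expRD [leRHS]mulrC ler_pM2l ?expR_gt0//.
  exact: expR_ge1Dx.
have := tangent (th * m); have := tangent (l + (th - 1) * m).
set E := expR (th * l); set A := expR _; set B := expR _ => hA hB.
have : (1 - th) * (E * (1 + (th * m - th * l)))
    + th * (E * (1 + (l + (th - 1) * m - th * l))) <= (1 - th) * B + th * A.
  by rewrite lerD// ler_wpM2l// subr_ge0.
by congr (_ <= _); ring.
Qed.

(** From ln (1 + v) >= v / (1 + v), which exceeds v - 2 v^2 by v^2 (1 + 2 v) / (1 + v). *)
Lemma ln_ge_quad (v : R) : - (1 / 2) <= v -> v - 2 * v ^+ 2 <= ln (1 + v).
Proof.
move=> v0; have v1 : 0 < 1 + v by lra.
rewrite -ler_expR lnK ?posrE//.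
apply: (@le_trans _ _ (expR (v / (1 + v)))).
  rewrite ler_expR ler_pdivlMr//; nra.
rewrite -[leRHS]invrK -[leLHS]invrK -expRN lef_pV2 ?posrE ?invr_gt0 ?expR_gt0//.
by have := expR_ge1Dx (- (v / (1 + v))); congr (_ <= _); field; rewrite gt_eqF.
Qed.

(** The Taylor expansion of exp (th * ln (mean of exp y)): [th / 2] multiplies the variance of y
    under p. The constant 40 rounds up 16 + 6 + 16: the error in the bound [t] for the logarithm,
    its effect on t^2 / 2, and the cubic term of the outer exponential, since (5 / 2)^3 <= 16. *)
Lemma pmean_ge y (d : R) : 0 <= d <= 1 / 4 -> (forall k, `|y k| <= d) ->
  1 + th * mean y + th / 2 * (mean (fun k => y k ^+ 2) - mean y ^+ 2)
    + th ^+ 2 / 2 * mean y ^+ 2 - 40 * d ^+ 3 <= pmean y.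
Proof.
move=> /andP[d0 d1] yd; set m := mean y; set V := mean _ - _.
have md : `|m| <= d by exact: mean_bound.
have VE : V = mean (fun k => (y k - m) ^+ 2).
  transitivity (mean (fun k => y k ^+ 2 + ((- 2 * m) * y k + m ^+ 2))).
    by rewrite !meanD meanZ mean_cst /V -/m; ring.
  by congr mean; apply/funext => k; ring.
have V0 : 0 <= V by rewrite VE -(mean_cst 0) ler_mean// => k; exact: sqr_ge0.
have ymd k : `|y k - m| <= 2 * d.
  by rewrite (le_trans (ler_normB _ _))//; have := yd k; lra.
have sq k : `|(y k - m) ^+ 2| <= 4 * d ^+ 2.
  rewrite normrX (_ : 4 * d ^+ 2 = (2 * d) ^+ 2); last by ring.
  by rewrite lerXn2r// nnegrE; lra.
have V4 : V <= 4 * d ^+ 2.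
  by rewrite VE -(mean_cst (4 * _)) ler_mean// => k; have := sq k; rewrite ler_norml => /andP[].
set W := mean (fun k => expR (y k)).
(* A lower bound for the mean of exp (y - m), minus 1; its error is (2 d)^3 because y deviates from
   its mean by at most 2 d. *)
pose v := V / 2 - 8 * d ^+ 3.
have d2 : 0 <= d ^+ 2 by exact: sqr_ge0.
have d3 : 0 <= d ^+ 3 by exact: exprn_ge0.
have d32 : 4 * d ^+ 3 <= d ^+ 2 by nra.
have WE : expR m * (1 + v) <= W.
  have -> : W = expR m * mean (fun k => expR (y k - m)).
    rewrite -meanZ; congr mean; apply/funext => k.
    by rewrite -expRD; congr expR; ring.
  rewrite ler_pM2l ?expR_gt0//.
  have -> : 1 + v = mean (fun k => (1 - 8 * d ^+ 3) + (y k - m + 2^-1 * (y k - m) ^+ 2)).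
    rewrite meanD mean_cst meanD meanZ -VE.
    have -> : mean (fun k => y k - m) = 0 by rewrite meanD mean_cst subrr.
    by rewrite /v; field.
  apply: ler_mean => k; apply: le_trans (expR_ge_cubic (y k - m)).
  have : `|y k - m| ^+ 3 <= (2 * d) ^+ 3 by rewrite lerXn2r// nnegrE; lra.
  by rewrite (_ : (2 * d) ^+ 3 = 8 * d ^+ 3); [lra | ring].
have v2 : v ^+ 2 <= 4 * d ^+ 3.
  have : `|v| <= 4 * d ^+ 2 by rewrite ler_norml /v; lra.
  move=> /(lerXn2r 2); rewrite !nnegrE normr_ge0 => /(_ isT).
  rewrite real_normK ?num_real// => /(_ _); rewrite exprMn -exprM.
  have -> : d ^+ (2 * 2) = d * d ^+ 3 by rewrite -exprS.
  by move=> /(_ _); nra.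
have vh : - (1 / 2) <= v by rewrite /v; nra.
(* The error 16 d^3 is 8 d^3 from [v] and 2 v^2 <= 8 d^3 from [ln_ge_quad]. *)
pose t := m + V / 2 - 16 * d ^+ 3.
have tW : t <= ln W.
  rewrite -ler_expR lnK ?posrE ?mean_expR_gt0//; apply: le_trans WE.
  have -> : t = m + (t - m) by ring.
  rewrite expRD ler_pM2l ?expR_gt0//.
  have v1 : 0 < 1 + v by lra.
  rewrite -[leRHS]lnK ?posrE// ler_expR; apply: le_trans (ln_ge_quad vh).
  by rewrite /t /v in v2 *; lra.
rewrite /pmean -/W; apply: (@le_trans _ _ (expR (th * t))); last first.
  by rewrite ler_expR ler_wpM2l.
apply: le_trans (expR_ge_cubic (th * t)).
have e_bound : `|t - m| <= 6 * d ^+ 2 by rewrite ler_norml /t; lra.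
have t_bound : `|t| <= 5 / 2 * d.
  have -> : t = m + (t - m) by ring.
  by rewrite (le_trans (ler_normD _ _))//; nra.
have c1 : `|th * t| ^+ 3 <= 16 * d ^+ 3.
  apply: (@le_trans _ _ ((5 / 2 * d) ^+ 3)).
    rewrite lerXn2r ?nnegrE//; first by lra.
    by rewrite normrM (ger0_norm th0) (le_trans _ t_bound)// ler_piMl.
  by rewrite exprMn ler_wpM2r//; lra.
have c2 : m ^+ 2 - 12 * d ^+ 3 <= t ^+ 2.
  have : `|m * (t - m)| <= d * (6 * d ^+ 2) by rewrite normrM ler_pM.
  rewrite ler_norml (_ : d * (6 * d ^+ 2) = 6 * d ^+ 3); last by ring.
  by move=> /andP[h _]; have := sqr_ge0 (t - m); nra.
have th2 : th ^+ 2 <= 1 by rewrite expr_le1.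
have th20 : 0 <= th ^+ 2 by exact: sqr_ge0.
have c3 : th ^+ 2 * (m ^+ 2 - 12 * d ^+ 3) <= th ^+ 2 * t ^+ 2 by rewrite ler_wpM2l.
have c4 : th ^+ 2 * d ^+ 3 <= d ^+ 3 by rewrite ler_piMl.
have c5 : th * d ^+ 3 <= d ^+ 3 by rewrite ler_piMl.
rewrite exprMn /t in c1 c3 *; lra.
Qed.
End PowerMean.

(** * The soft maximum *)

Section SoftMax.
Variables (R : realType) (K : finType) (k0 : K) (beta th : R).
Hypotheses (beta0 : 0 <= beta) (th0 : 0 <= th) (th1 : th <= 1).
Implicit Types (L y z : {ffun K -> R}) (s : seq {ffun K -> R}).

(** Squeezed between exp (th * beta * max L) and #|K|^th times it; the surplus factor tends to 1 as
    th tends to 0 with th * beta fixed. *)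
Definition Phi L := expR (th * ln (\sum_k expR (beta * L k))).

Definition softmax L k := expR (beta * L k) / \sum_k expR (beta * L k).

Definition dil (h : R) z : {ffun K -> R} := [ffun k => h * z k].

Lemma sum_expR_gt0 L : 0 < \sum_k expR (beta * L k).
Proof.
rewrite (bigD1 k0)//= ltr_pwDl ?expR_gt0// sumr_ge0// => k _; exact: expR_ge0.
Qed.

Lemma softmax_ge0 L k : 0 <= softmax L k.
Proof. by rewrite divr_ge0 ?expR_ge0// ltW// sum_expR_gt0. Qed.

Lemma sum_softmax L : \sum_k softmax L k = 1.
Proof. by rewrite -mulr_suml divff// gt_eqF// sum_expR_gt0. Qed.

(** Under a shift, the soft maximum is multiplied by a power mean for the Gibbs weights at L, which
    reduces every estimate on [Phi] to one on [pmean]. *)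
Lemma PhiD L y : Phi (L + y) = Phi L * pmean (softmax L) th (fun k => beta * y k).
Proof.
rewrite /Phi /pmean -expRD -mulrDr -lnM ?posrE ?sum_expR_gt0//; last first.
  by apply: mean_expR_gt0; [exact: softmax_ge0|exact: sum_softmax].
congr (expR (_ * ln _)); rewrite /mean mulr_sumr; apply: eq_bigr => k _.
rewrite ffunE mulrDr expRD /softmax mulrA; congr (_ * _).
by rewrite mulrCA divff ?mulr1// gt_eqF// sum_expR_gt0.
Qed.

Lemma mean_zmod (p : K -> R) (c : R) : zmod_morphism (fun y => c * mean p y).
Proof.
move=> y z; rewrite -mulrBr; congr (_ * _).
rewrite -(mulN1r (mean p z)) -meanZ -meanD; congr mean.
by apply/funext => k; rewrite !ffunE mulN1r.
Qed.

(** In [pmean_le] the free parameter is taken to be the mean of beta * y. What remains is a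
    combination of exponentials of additive functions of y, which [avgs_expR] averages. *)
Lemma avgs_Phi_le s L (p := softmax L) :
  avgs s Phi L <= Phi L *
    ((1 - th) * expR ((\sum_(z <- s) (th * beta * mean p z) ^+ 2) / 2)
     + th * mean p (fun k =>
         expR ((\sum_(z <- s) (beta * (z k + (th - 1) * mean p z)) ^+ 2) / 2))).
Proof.
have p0 := softmax_ge0 L; have p1 := sum_softmax L.
rewrite avgs_shift.
pose f0 y := expR (th * beta * mean p y).
pose f k y := expR (beta * (y k + (th - 1) * mean p y)).
apply: (@le_trans _ _ (avgs s (fun y => Phi L *
    ((1 - th) * f0 y + th * \sum_k p k * f k y)) 0)).
  apply: avgs_le => y; rewrite PhiD ler_pM2l ?expR_gt0//.
  apply: le_trans (pmean_le p0 p1 th0 th1 _ (beta * mean p y)) _.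
  rewrite le_eqVlt; apply/orP; left; apply/eqP; rewrite /f0 mulrA; congr (_ + th * _).
  by apply: eq_bigr => k _; congr (_ * expR _); ring.
rewrite avgsZ ler_pM2l ?expR_gt0// avgsD !avgsZ avgs_sum.
have m0 : mean p (0 : {ffun K -> R}) = 0.
  by rewrite /mean big1// => k _; rewrite ffunE mulr0.
rewrite lerD ?ler_wpM2l ?subr_ge0//.
  by apply: le_trans (avgs_expR _ _ (mean_zmod _ _)) _; rewrite m0 mulr0 add0r.
apply: ler_sum => k _; rewrite avgsZ ler_wpM2l//.
have lz : zmod_morphism (fun y => beta * (y k + (th - 1) * mean p y)).
  by move=> y z; rewrite -mulrBr (mean_zmod p (th - 1) y z) !ffunE; ring.
by apply: le_trans (avgs_expR _ _ lz) _; rewrite m0 ffunE !(mulr0, addr0) add0r.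
Qed.

(** Within the reach of the shifts, [pmean_ge] bounds [Phi] below by a quadratic function, whose
    average is exact; the linear term vanishes at the origin. *)
Lemma avgs_Phi_ge s L (b : R) (p := softmax L) :
  (forall z, z \in s -> forall k, `|z k| <= b) ->
  0 <= (size s)%:R * b * beta <= 1 / 4 ->
  Phi L * (1 + th * beta ^+ 2 / 2 *
      (mean p (fun k => \sum_(z <- s) z k ^+ 2)
       - (1 - th) * \sum_(z <- s) mean p z ^+ 2)
    - 40 * ((size s)%:R * b * beta) ^+ 3) <= avgs s Phi L.
Proof.
move=> sb d14; have p0 := softmax_ge0 L; have p1 := sum_softmax L.
move: d14; set d := (size s)%:R * b * beta => d14.
(* [D] is both the quadratic part of the lower bound and, by the parallelogram law, the increment
   that each shift contributes to its average. *)
pose D y := th * beta ^+ 2 / 2 *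
  (mean p (fun k => y k ^+ 2) - (1 - th) * mean p y ^+ 2).
pose Q y := Phi L * (1 + th * beta * mean p y + D y - 40 * d ^+ 3).
apply: (@le_trans _ _ (avgs s Q 0)); last first.
  apply: (avgs_ge_near sb) => y yb; rewrite PhiD /Q ler_pM2l ?expR_gt0//.
  have yd k : `|beta * y k| <= d.
    by rewrite normrM ger0_norm// mulrC ler_wpM2r.
  apply: le_trans (pmean_ge p0 p1 th0 th1 d14 yd).
  rewrite meanZ /D.
  have -> : mean p (fun k => (beta * y k) ^+ 2) = beta ^+ 2 * mean p (fun k => y k ^+ 2).
    by rewrite -meanZ; congr mean; apply/funext => k; rewrite exprMn.
  rewrite le_eqVlt; apply/orP; left; apply/eqP.
  by rewrite -/p; change (mean p (fun k => y k)) with (mean p y); field.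
have mD y z : mean p (y + z) = mean p y + mean p z.
  by rewrite -meanD; congr mean; apply/funext => k; rewrite ffunE.
have mB y z : mean p (y - z) = mean p y - mean p z.
  have := mean_zmod p 1 y z; rewrite /=; lra.
rewrite /Q avgsZ ler_pM2l ?expR_gt0//.
have -> : (fun y => 1 + th * beta * mean p y + D y - 40 * d ^+ 3) =
   (fun y => (1 - 40 * d ^+ 3) + (th * beta * mean p y + D y)).
  by apply/funext => y; ring.
rewrite (@avgs_quadratic _ _ _ _ D); last first.
  move=> y z; rewrite /D mD mB.
  have -> : mean p (fun k => (y + z)%R k ^+ 2) =
     mean p (fun k => y k ^+ 2) + mean p (fun k => z k ^+ 2)
     + 2 * mean p (fun k => y k * z k).
    rewrite -meanZ -!meanD; congr mean; apply/funext => k; rewrite ffunE; ring.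
  have -> : mean p (fun k => (y - z)%R k ^+ 2) =
     mean p (fun k => y k ^+ 2) + mean p (fun k => z k ^+ 2)
     + (- 2) * mean p (fun k => y k * z k).
    rewrite -meanZ -!meanD; congr mean; apply/funext => k; rewrite !ffunE; ring.
  ring.
have -> : D 0 = 0.
  rewrite /D; have -> : mean p (0 : {ffun K -> R}) = 0.
    by rewrite /mean big1// => k _; rewrite ffunE mulr0.
  rewrite (_ : mean _ _ = 0); first by ring.
  by rewrite /mean big1// => k _; rewrite ffunE expr0n mulr0.
have -> : mean p (0 : {ffun K -> R}) = 0.
  by rewrite /mean big1// => k _; rewrite ffunE mulr0.
rewrite /D -mulr_sumr sumrB -mulr_sumr.
have -> : \sum_(z <- s) mean p (fun k => z k ^+ 2) =
          mean p (fun k => \sum_(z <- s) z k ^+ 2).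
  by rewrite /mean exchange_big; apply: eq_bigr => k _; rewrite mulr_sumr.
rewrite le_eqVlt; apply/orP; left; apply/eqP; ring.
Qed.

End SoftMax.

Lemma mean_sqr_le (R : realType) (K : finType) (p y : K -> R) :
  (forall k, 0 <= p k) -> \sum_k p k = 1 ->
  mean p y ^+ 2 <= mean p (fun k => y k ^+ 2).
Proof.
move=> p0 p1; set m := mean p y.
have : 0 <= mean p (fun k => (y k - m) ^+ 2).
  by rewrite -(mean_cst p1 0) ler_mean// => k; exact: sqr_ge0.
have -> : mean p (fun k => (y k - m) ^+ 2) =
    mean p (fun k => y k ^+ 2 + ((- 2 * m) * y k + m ^+ 2)).
  by congr mean; apply/funext => k; ring.
by rewrite !meanD meanZ mean_cst// -/m; nra.
Qed.

(** * Comparison of two sign processes *)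

Section Comparison.
Variables (R : realType) (K : finType) (k0 : K) (beta th : R).
Hypotheses (beta0 : 0 <= beta) (th0 : 0 <= th) (th1 : th <= 1).
Variables (za zb : seq {ffun K -> R}).
Hypotheses (za1 : forall z, z \in za -> forall k, `|z k| <= 1).
Hypotheses (zb1 : forall z, z \in zb -> forall k, `|z k| <= 1).
Hypotheses (va : forall k, \sum_(z <- za) z k ^+ 2 = 1).
Hypotheses (vb : forall k, \sum_(z <- zb) z k ^+ 2 = 2).
Hypothesis (cov : forall p : K -> R, (forall k, 0 <= p k) -> \sum_k p k = 1 ->
  \sum_(z <- zb) mean p z ^+ 2 <= 1 + \sum_(z <- za) mean p z ^+ 2).

(* An independent Gaussian added to the first process would equalize the
   variances; it only multiplies [Phi] by the factor on the left. *)
Lemma slepian_step : exists C h0 : R, [/\ 0 <= C, 0 < h0 &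
  forall h, 0 < h <= h0 -> forall L,
    (1 + (th * beta) ^+ 2 / 2 * h ^+ 2) * avgs (map (dil h) za) (Phi beta th) L
    <= (1 + C * h ^+ 3) * avgs (map (dil h) zb) (Phi beta th) L].
Proof.
have [t0 t1] := conj th0 th1.
pose na : R := (size za)%:R; pose nb : R := (size zb)%:R.
pose B := 2 * beta ^+ 2 * na; pose D := 40 * (nb * beta) ^+ 3.
pose l2 := (th * beta) ^+ 2.
pose E := l2 * beta ^+ 2 / 4 + (1 + l2 / 2) * (2 * B ^+ 2).
(* The single condition h * M <= 1 yields h <= 1, B h^2 <= 1 / 2, nb beta h <= 1 / 4 and D h^3 <= 1
   / 2. *)
pose M := 1 + 2 * B + 4 * (nb * beta) + 2 * D.
have na0 : 0 <= na by exact: ler0n.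
have nb0 : 0 <= nb by exact: ler0n.
have b2 : 0 <= beta ^+ 2 by exact: sqr_ge0.
have B0 : 0 <= B by rewrite !mulr_ge0.
have nbb : 0 <= nb * beta by exact: mulr_ge0.
have D0 : 0 <= D by rewrite mulr_ge0// exprn_ge0.
have l20 : 0 <= l2 by exact: sqr_ge0.
have E0 : 0 <= E by rewrite addr_ge0// !mulr_ge0 ?sqr_ge0//; lra.
have M0 : 1 <= M by rewrite /M; lra.
(* The factor 2 is paid because the lower bound 1 + Y - D h^3 that it multiplies may be as small as
   1 / 2. *)
exists (2 * (D + E)), M^-1; split; [lra|by rewrite invr_gt0; lra|].
move=> h /andP[h0 hM] L.
have {hM} hM : h * M <= 1 by rewrite -ler_pdivlMr ?mul1r//; lra.
have h1 : h <= 1 by nra.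
have hB : B * h ^+ 2 <= 1 / 2 by rewrite expr2 mulrA; rewrite /M in hM; nra.
have hb : nb * beta * h <= 1 / 4 by rewrite /M in hM; nra.
have h3 : 0 <= h ^+ 3 by rewrite exprn_ge0// ltW.
have h3h : h ^+ 3 <= h by rewrite exprS ler_piMr ?(ltW h0)// expr_le1// ltW.
have h43 : h ^+ 4 <= h ^+ 3 by rewrite (exprS _ 3) ler_piMl.
have hD : D * h ^+ 3 <= 1 / 2 by rewrite /M in hM; nra.
pose p := softmax beta L.
have p0 : forall k, 0 <= p k by exact: softmax_ge0.
have p1 : \sum_k p k = 1 by exact: sum_softmax.
set a := \sum_(z <- za) mean p z ^+ 2.
set b := \sum_(z <- zb) mean p z ^+ 2.
have mdil z : mean p (dil h z) = h * mean p z.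
  by rewrite -meanZ; congr mean; apply/funext => k; rewrite ffunE.
have mean_le1 z : z \in za -> `|mean p z| <= 1.
  by move=> zza; apply: mean_bound => //; exact: za1.
have a0 : 0 <= a by apply: sumr_ge0 => z _; exact: sqr_ge0.
have a1 : a <= 1.
  apply: (@le_trans _ _ (\sum_(z <- za) mean p (fun k => z k ^+ 2))).
    by apply: ler_sum => z _; exact: mean_sqr_le.
  rewrite /mean exchange_big/= -[leRHS]p1 ler_sum// => k _.
  by rewrite -mulr_sumr va mulr1.
have b_le2 : b <= 2.
  apply: (@le_trans _ _ (\sum_(z <- zb) mean p (fun k => z k ^+ 2))).
    by apply: ler_sum => z _; exact: mean_sqr_le.
  rewrite /mean exchange_big/= -[leRHS]mul1r -[X in _ <= X * _]p1 mulr_suml ler_sum// => k _.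
  by rewrite -mulr_sumr vb.
have ba : b <= 1 + a by exact: cov.
(* [X] and [Y] are the second-order terms of the upper bound for [za] and of the lower bound for
   [zb]. *)
pose X := h ^+ 2 * beta ^+ 2 / 2 * (th - th * (1 - th) * a).
pose Y := h ^+ 2 * beta ^+ 2 / 2 * (2 * th - th * (1 - th) * b).
have hb2 : 0 <= h ^+ 2 * beta ^+ 2 by rewrite mulr_ge0// sqr_ge0.
have tht : 0 <= th * (1 - th) by rewrite mulr_ge0// subr_ge0.
(* The difference of the two sides is h^2 beta^2 / 2 * th (1 - th) (1 + a - b): here the covariance
   hypothesis enters. *)
have XY : X + l2 / 2 * h ^+ 2 <= Y.
  have -> : X + l2 / 2 * h ^+ 2 = h ^+ 2 * beta ^+ 2 / 2 * (th - th * (1 - th) * a + th ^+ 2).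
    by rewrite /X /l2; field.
  by rewrite /Y ler_wpM2l ?divr_ge0//; nra.
have Y0 : 0 <= Y by rewrite /Y mulr_ge0 ?divr_ge0//; nra.
have X1 : X <= h ^+ 2 * beta ^+ 2 / 2.
  rewrite /X ler_piMr ?divr_ge0//; have := mulr_ge0 tht a0; lra.
have PhiL : 0 < Phi beta th L by exact: expR_gt0.
have lower : Phi beta th L * (1 + Y - D * h ^+ 3) <= avgs (map (dil h) zb) (Phi beta th) L.
  apply: le_trans (@avgs_Phi_ge _ _ k0 _ _ beta0 th0 th1 (map (dil h) zb) L h _ _); last 2 first.
  - move=> _ /mapP[z /zb1 zz ->] k; rewrite ffunE normrM (gtr0_norm h0).
    by rewrite ler_piMr ?(ltW h0).
  - by rewrite size_map -/nb; apply/andP; split; nra.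
  rewrite ler_pM2l// size_map -/nb -/p.
  have -> : mean p (fun k => \sum_(z <- map (dil h) zb) z k ^+ 2) = 2 * h ^+ 2.
    rewrite -[RHS](mean_cst p1); congr mean; apply/funext => k.
    rewrite big_map -(vb k) mulr_suml; apply: eq_bigr => z _.
    by rewrite ffunE exprMn mulrC.
  have -> : \sum_(z <- map (dil h) zb) mean p z ^+ 2 = h ^+ 2 * b.
    rewrite big_map mulr_sumr; apply: eq_bigr => z _.
    by rewrite mdil exprMn.
  by rewrite le_eqVlt; apply/orP; left; apply/eqP; rewrite /Y /D; field.
have upper : avgs (map (dil h) za) (Phi beta th) L <=
    Phi beta th L * (1 + X + 2 * (B * h ^+ 2) ^+ 2).
  apply: le_trans (@avgs_Phi_le _ _ k0 _ _ th0 th1 (map (dil h) za) L) _.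
  rewrite ler_pM2l// -/p.
  set x1 := (\sum_(z <- map (dil h) za) (th * beta * mean p z) ^+ 2) / 2.
  pose x2 k := (\sum_(z <- map (dil h) za)
     (beta * (z k + (th - 1) * mean p z)) ^+ 2) / 2.
  rewrite -/(x2 _).
  have x1E : x1 = h ^+ 2 * beta ^+ 2 / 2 * (th ^+ 2 * a).
    rewrite /x1 /a big_map mulr_sumr [RHS]mulr_sumr mulr_suml.
    by apply: eq_bigr => z _; rewrite mdil; field.
  have x10 : 0 <= x1 by rewrite x1E mulr_ge0 ?divr_ge0// mulr_ge0 ?sqr_ge0.
  have na_a : 1 <= na.
    rewrite /na ler1n lt0n size_eq0; apply/eqP => za_nil.
    by have := va k0; rewrite za_nil big_nil => /esym/eqP; rewrite oner_eq0.
  have x1B : x1 <= B * h ^+ 2.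
    rewrite x1E /B; have : th ^+ 2 * a <= na.
      by rewrite (le_trans _ na_a)// mulr_ile1 ?sqr_ge0 ?expr_le1.
    by nra.
  have x20 k : 0 <= x2 k by rewrite divr_ge0// sumr_ge0// => z _; exact: sqr_ge0.
  have x2B k : x2 k <= B * h ^+ 2.
    rewrite /x2 ler_pdivrMr// big_map.
    have -> : B * h ^+ 2 * 2 = \sum_(z <- za) (4 * (beta ^+ 2 * h ^+ 2)).
      by rewrite big_const_seq count_predT iter_addr_0 -[RHS]mulr_natr -/na /B; ring.
    rewrite big_seq [leRHS]big_seq; apply: ler_sum => z zza.
    rewrite mdil ffunE.
    have -> : (beta * (h * z k + (th - 1) * (h * mean p z))) ^+ 2 =
       (z k + (th - 1) * mean p z) ^+ 2 * (beta ^+ 2 * h ^+ 2) by ring.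
    apply: ler_wpM2r; first by rewrite mulr_ge0 ?(sqr_ge0 h).
    have : `|z k + (th - 1) * mean p z| <= 2.
      rewrite (le_trans (ler_normD _ _))// (_ : 2 = 1 + 1)// lerD ?za1//.
      by rewrite normrM mulr_ile1// ?mean_le1// ler_norml; lra.
    by rewrite ler_norml => /andP[]; nra.
  have x2E : th * mean p x2 = h ^+ 2 * beta ^+ 2 / 2 *
      (th * (1 + ((th - 1) ^+ 2 + 2 * (th - 1)) * a)).
    have x2kE (k : K) : x2 k = h ^+ 2 * beta ^+ 2 / 2 *
        (1 + (2 * (th - 1) * \sum_(z <- za) (z k * mean p z) + (th - 1) ^+ 2 * a)).
      have -> : 1 + (2 * (th - 1) * \sum_(z <- za) (z k * mean p z) + (th - 1) ^+ 2 * a) =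
          \sum_(z <- za) (z k ^+ 2 + (2 * (th - 1) * (z k * mean p z)
            + (th - 1) ^+ 2 * mean p z ^+ 2)).
        by rewrite !big_split/= va -!mulr_sumr.
      rewrite mulr_sumr /x2 big_map mulr_suml; apply: eq_bigr => z _.
      by rewrite mdil ffunE; field.
    have -> : mean p x2 = mean p (fun k => h ^+ 2 * beta ^+ 2 / 2 *
        (1 + (2 * (th - 1) * \sum_(z <- za) (z k * mean p z) + (th - 1) ^+ 2 * a))).
      by congr mean; apply/funext.
    rewrite meanZ meanD mean_cst// meanD mean_cst// meanZ.
    have -> : mean p (fun k => \sum_(z <- za) (z k * mean p z)) = a.
      rewrite /mean /a; under eq_bigr do rewrite mulr_sumr.
      rewrite exchange_big; apply: eq_bigr => z _.
      by rewrite expr2 {2}/mean mulr_suml; apply: eq_bigr => k _; rewrite mulrA.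
    by field.
  have e1 : expR x1 <= 1 + x1 + 2 * (B * h ^+ 2) ^+ 2.
    apply: le_trans (expR_le_quad _) _; first by rewrite x10 (le_trans x1B).
    by rewrite lerD2l ler_pM2l// lerXn2r// nnegrE (le_trans x10).
  have e2 : mean p (fun k => expR (x2 k)) <= 1 + mean p x2 + 2 * (B * h ^+ 2) ^+ 2.
    rewrite -[X in _ <= X + _ + _](mean_cst p1) -[X in _ <= _ + X](mean_cst p1) -!meanD.
    apply: ler_mean => // k.
    apply: le_trans (expR_le_quad _) _; first by rewrite x20 (le_trans (x2B k)).
    by rewrite lerD2l ler_pM2l// lerXn2r// nnegrE// (le_trans (x20 k)).
  have e1' : (1 - th) * expR x1 <= (1 - th) * (1 + x1 + 2 * (B * h ^+ 2) ^+ 2).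
    by rewrite ler_wpM2l// subr_ge0.
  have e2' := ler_wpM2l th0 e2.
  apply: le_trans (lerD e1' e2') _; rewrite [th * _]mulrDr [th * (1 + _)]mulrDr x2E x1E /X.
  by rewrite le_eqVlt; apply/orP; left; apply/eqP; field.
apply: (@le_trans _ _ (Phi beta th L *
    ((1 + 2 * (D + E) * h ^+ 3) * (1 + Y - D * h ^+ 3)))); last first.
  by rewrite mulrCA ler_wpM2l// addr_ge0// mulr_ge0//; lra.
have g0 : 0 <= 1 + l2 / 2 * h ^+ 2 by rewrite addr_ge0// mulr_ge0 ?sqr_ge0// divr_ge0.
apply: le_trans (ler_wpM2l g0 upper) _; rewrite mulrCA ler_pM2l//.
have h2 : 0 <= h ^+ 2 by exact: sqr_ge0.
have h21 : h ^+ 2 <= 1 by rewrite expr_le1// ltW.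
have c1 : l2 / 2 * h ^+ 2 * X <= l2 * beta ^+ 2 / 4 * h ^+ 3.
  apply: (@le_trans _ _ (l2 * beta ^+ 2 / 4 * h ^+ 4)).
    have -> : l2 * beta ^+ 2 / 4 * h ^+ 4 = l2 / 2 * h ^+ 2 * (h ^+ 2 * beta ^+ 2 / 2) by field.
    by rewrite ler_wpM2l// mulr_ge0// divr_ge0.
  by rewrite ler_wpM2l// divr_ge0// mulr_ge0.
have c2 : (1 + l2 / 2 * h ^+ 2) * (2 * (B * h ^+ 2) ^+ 2) <= (1 + l2 / 2) * (2 * B ^+ 2) * h ^+ 3.
  have -> : 2 * (B * h ^+ 2) ^+ 2 = 2 * B ^+ 2 * h ^+ 4 by ring.
  rewrite mulrA ler_pM ?mulr_ge0 ?sqr_ge0 ?exprn_ge0 ?(ltW h0)//.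
  by rewrite ler_wpM2r ?mulr_ge0 ?sqr_ge0// lerD2l ler_piMr// divr_ge0.
have c3 : 0 <= (D + E) * h ^+ 3 * (2 * (1 + Y - D * h ^+ 3) - 1).
  by apply: mulr_ge0; [rewrite mulr_ge0// addr_ge0//|lra].
rewrite /E in c3 *; nra.
Qed.

Lemma slepian_iter : exists C h0 : R, [/\ 0 <= C, 0 < h0 &
  forall h, 0 < h <= h0 -> forall n L,
    (1 + (th * beta) ^+ 2 / 2 * h ^+ 2) ^+ n
      * avgs (flatten (nseq n (map (dil h) za))) (Phi beta th) L
    <= (1 + C * h ^+ 3) ^+ n
      * avgs (flatten (nseq n (map (dil h) zb))) (Phi beta th) L].
Proof.
have [C [h0 [C0 h00 H]]] := slepian_step; exists C, h0; split=> // h hh n L.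
have [hp _] := andP hh.
apply: avgs_iter; last exact: H.
  by rewrite addr_ge0// mulr_ge0 ?sqr_ge0// divr_ge0 ?sqr_ge0.
by rewrite addr_ge0// mulr_ge0// exprn_ge0// ltW.
Qed.

End Comparison.

(** * Comparison of bilinear and linear forms *)

Section Supersolution.
Variables (R : realType) (D : finType) (h : R).
Implicit Types (v w : {ffun D -> R}) (d : D) (s : seq D).

Definition axis d : {ffun D -> R} := [ffun d' => h * (d' == d)%:R].

(** The product of v^(-1/2) exp (w^2 / (2 v)) over the coordinates. Averaging over a Gaussian shift
    of variance h^2 would turn it exactly into the same function with v - h^2; for signs of size h
    this becomes an upper bound. *)
Definition gauss v w := expR (\sum_d (w d ^+ 2 / (2 * v d) - ln (v d) / 2)).

(** Once cosh is bounded by an exponential, it is enough that ln (v - h^2) <= ln v - h^2 / v and 1 /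
    (v - h^2) >= 1 / v + h^2 / v^2. *)
Lemma heat_supersolution (x v : R) : 0 < v - h ^+ 2 ->
  (expR ((x + h) ^+ 2 / (2 * v)) + expR ((x - h) ^+ 2 / (2 * v))) / 2
    <= expR (x ^+ 2 / (2 * (v - h ^+ 2)) - ln (v - h ^+ 2) / 2 + ln v / 2).
Proof.
move=> vh; have h2 := sqr_ge0 h; have v0 : 0 < v by lra.
have -> : (x + h) ^+ 2 / (2 * v) = (x ^+ 2 + h ^+ 2) / (2 * v) + x * h / v.
  by field; rewrite gt_eqF.
have -> : (x - h) ^+ 2 / (2 * v) = (x ^+ 2 + h ^+ 2) / (2 * v) + - (x * h / v).
  by field; rewrite gt_eqF.
rewrite !expRD -mulrDr -mulrA.
apply: le_trans (ler_wpM2l (expR_ge0 _) (cosh_le_expR (x * h / v))) _.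
rewrite -!expRD ler_expR.
have lnv : ln (v - h ^+ 2) <= ln v - h ^+ 2 / v.
  rewrite -ler_expR lnK ?posrE// expRD lnK ?posrE//.
  have := expR_ge1Dx (- (h ^+ 2 / v)) => /(ler_wpM2l (ltW v0)).
  by congr (_ <= _); field; rewrite gt_eqF.
have : x ^+ 2 / (2 * v) + x ^+ 2 * h ^+ 2 / (2 * v ^+ 2) <= x ^+ 2 / (2 * (v - h ^+ 2)).
  rewrite -subr_ge0.
  have -> : x ^+ 2 / (2 * (v - h ^+ 2)) - (x ^+ 2 / (2 * v) + x ^+ 2 * h ^+ 2 / (2 * v ^+ 2))
     = (x * h ^+ 2) ^+ 2 / (2 * v ^+ 2 * (v - h ^+ 2)).
    by field; rewrite (gt_eqF v0) gt_eqF.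
  by rewrite divr_ge0 ?sqr_ge0// !mulr_ge0 ?sqr_ge0// ltW.
have -> : (x ^+ 2 + h ^+ 2) / (2 * v) + (x * h / v) ^+ 2 / 2 =
   x ^+ 2 / (2 * v) + x ^+ 2 * h ^+ 2 / (2 * v ^+ 2) + h ^+ 2 / v / 2.
  by field; rewrite gt_eqF.
lra.
Qed.

Lemma avg_gauss d v v' w :
  0 < v d - h ^+ 2 -> (forall d', v' d' = v d' - h ^+ 2 * (d' == d)%:R) ->
  avg (axis d) (gauss v) w <= gauss v' w.
Proof.
move=> vd v'E; rewrite /avg /gauss !(bigD1 (P := xpredT) d)//=.
have rest (z : {ffun D -> R}) : (forall d', d' != d -> z d' = w d') ->
    \sum_(i | i != d) (z i ^+ 2 / (2 * v i) - ln (v i) / 2) =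
    \sum_(i | i != d) (w i ^+ 2 / (2 * v' i) - ln (v' i) / 2).
  move=> zw; apply: eq_bigr => i id.
  by rewrite zw// v'E (negbTE id) mulr0 subr0.
rewrite !rest; last 2 first.
- by move=> i id; rewrite !ffunE (negbTE id) mulr0 subr0.
- by move=> i id; rewrite !ffunE (negbTE id) mulr0 addr0.
set S := \sum_(i | _) _; rewrite !(expRD _ S) -mulrDl mulrAC ler_pM2r ?expR_gt0//.
rewrite !ffunE eqxx mulr1 v'E eqxx mulr1.
rewrite !(expRD _ (- (ln (v d) / 2))) -mulrDl mulrAC.
rewrite expRN ler_pdivrMr ?expR_gt0// -expRD.
exact: heat_supersolution.
Qed.

(** Each shift along a coordinate spends h^2 of its variance; the hypothesis says that the budget
    lasts for the whole list. *)
Lemma avgs_gauss s v w :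
  (forall d, 0 < v d - h ^+ 2 * (count_mem d s)%:R) ->
  avgs (map axis s) (gauss v) w <=
    gauss [ffun d => v d - h ^+ 2 * (count_mem d s)%:R] w.
Proof.
elim: s w => [|d s IH] w vs /=.
  rewrite (_ : [ffun d => _] = v)//.
  by apply/ffunP => d; rewrite ffunE mulr0 subr0.
have sub d' : v d' - h ^+ 2 * (count_mem d' (d :: s))%:R =
    v d' - h ^+ 2 * (count_mem d' s)%:R - h ^+ 2 * (d' == d)%:R.
  by rewrite /= natrD (eq_sym d); ring.
have vs' d' : 0 < v d' - h ^+ 2 * (count_mem d' s)%:R.
  apply: lt_le_trans (vs d') _; rewrite sub lerBlDr lerDl.
  by rewrite mulr_ge0// sqr_ge0.
apply: (@le_trans _ _ (avg (axis d) (gauss [ffun d => v d - h ^+ 2 * (count_mem d s)%:R]) w)).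
  by rewrite /avg ler_pM2r ?invr_gt0// lerD// IH.
apply: avg_gauss => [|d']; rewrite !ffunE; last by rewrite -sub.
by have := vs d; rewrite sub eqxx mulr1.
Qed.

End Supersolution.

Section Chevet.
Variables (R : realType) (K : finType) (k0 : K) (m n : nat).
Variables (u : K -> 'I_m -> R) (v : K -> 'I_n -> R).
Hypotheses (m0 : (0 < m)%N) (n0 : (0 < n)%N).
Hypotheses (u1 : forall k, \sum_i u k i ^+ 2 = 1) (v1 : forall k, \sum_j v k j ^+ 2 = 1).

(** Moving the entry c of a matrix E by h moves the vector of all u_k^T E v_k by
    [dil h (bilin_dir c)]. *)
Definition bilin_dir (c : 'I_m * 'I_n) : {ffun K -> R} := [ffun k => u k c.1 * v k c.2].

Definition lin_dir (d : 'I_m + 'I_n) : {ffun K -> R} :=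
  [ffun k => match d with inl i => u k i | inr j => v k j end].

Lemma entry_le1 (I : finType) (y : I -> R) i : \sum_i y i ^+ 2 = 1 -> `|y i| <= 1.
Proof.
move=> y1; rewrite -(@expr_le1 _ 2)// real_normK ?num_real// -y1 (bigD1 i)//=.
by rewrite lerDl sumr_ge0// => j _; exact: sqr_ge0.
Qed.

Lemma sqr_mean_sum (I : finType) (p : K -> R) (y : K -> I -> R) :
  \sum_i mean p (fun k => y k i) ^+ 2 =
  \sum_k \sum_l p k * p l * \sum_i y k i * y l i.
Proof.
rewrite (eq_bigr (fun i => \sum_k \sum_l p k * p l * (y k i * y l i))); last first.
  move=> i _; rewrite expr2 /mean mulr_suml; apply: eq_bigr => k _.
  by rewrite mulr_sumr; apply: eq_bigr => l _; ring.
rewrite exchange_big; apply: eq_bigr => k _; rewrite exchange_big.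
by apply: eq_bigr => l _; rewrite mulr_sumr.
Qed.

Lemma dot_le1 (I : finType) (y : K -> I -> R) k l :
  (forall k, \sum_i y k i ^+ 2 = 1) -> \sum_i y k i * y l i <= 1.
Proof.
move=> y1; have : 0 <= \sum_i (y k i - y l i) ^+ 2.
  by apply: sumr_ge0 => i _; exact: sqr_ge0.
have -> : \sum_i (y k i - y l i) ^+ 2 =
   \sum_i (y k i ^+ 2 + y l i ^+ 2 + (- 2) * (y k i * y l i)).
  by apply: eq_bigr => i _; ring.
by rewrite !big_split/= -mulr_sumr !y1; lra.
Qed.

(** After expansion over pairs (k, l), with a = u_k . u_l and b = v_k . v_l, this is a + b <= 1 + a
    b, that is (1 - a) (1 - b) >= 0, weighted by p k p l. *)
Lemma chevet_cov (p : K -> R) : (forall k, 0 <= p k) -> \sum_k p k = 1 ->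
  \sum_(z <- map lin_dir (enum {: 'I_m + 'I_n})) mean p z ^+ 2 <=
  1 + \sum_(z <- map bilin_dir (enum {: 'I_m * 'I_n})) mean p z ^+ 2.
Proof.
move=> p0 p1; rewrite (big_map lin_dir) (big_map bilin_dir) !big_enum/= big_sumType/=.
have -> : \sum_i mean p (lin_dir (inl i)) ^+ 2 = \sum_i mean p (fun k => u k i) ^+ 2.
  by apply: eq_bigr => i _; congr (mean _ _ ^+ 2); apply/funext => k; rewrite ffunE.
have -> : \sum_i mean p (lin_dir (inr i)) ^+ 2 = \sum_i mean p (fun k => v k i) ^+ 2.
  by apply: eq_bigr => i _; congr (mean _ _ ^+ 2); apply/funext => k; rewrite ffunE.
have -> : \sum_c mean p (bilin_dir c) ^+ 2 =
    \sum_c mean p (fun k => u k c.1 * v k c.2) ^+ 2.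
  by apply: eq_bigr => i _; congr (mean _ _ ^+ 2); apply/funext => k; rewrite ffunE.
rewrite (sqr_mean_sum p u) (sqr_mean_sum p v).
rewrite (sqr_mean_sum p (fun k c => u k c.1 * v k c.2)).
have -> : 1 = \sum_k \sum_l p k * p l.
  by rewrite -[LHS]p1; apply: eq_bigr => k _; rewrite -mulr_sumr p1 mulr1.
rewrite -!big_split/=; apply: ler_sum => k _.
rewrite -!big_split/=; apply: ler_sum => l _.
have -> : \sum_c u k c.1 * v k c.2 * (u l c.1 * v l c.2) =
    (\sum_i u k i * u l i) * (\sum_j v k j * v l j).
  rewrite mulr_suml -(pair_bigA _ (fun i j => u k i * v k j * (u l i * v l j)))/=.
  apply: eq_bigr => i _.
  by rewrite mulr_sumr; apply: eq_bigr => j _; rewrite mulrACA.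
have hu := dot_le1 k l u1; have hv := dot_le1 k l v1.
have hp : 0 <= p k * p l by rewrite mulr_ge0.
set a := \sum_i _ in hu *; set b := \sum_j _ in hv *.
have : 0 <= (p k * p l) * ((1 - a) * (1 - b)) by rewrite mulr_ge0// mulr_ge0 ?subr_ge0.
nra.
Qed.

Lemma chevet_discrete (beta th : R) : 0 < beta -> 0 < th -> th <= 1 ->
  exists C h0 : R, [/\ 0 <= C, 0 < h0 & forall h, 0 < h <= h0 -> forall N L,
    (1 + (th * beta) ^+ 2 / 2 * h ^+ 2) ^+ N
      * avgs (flatten (nseq N (map (dil h) (map bilin_dir (enum {: 'I_m * 'I_n}))))) (Phi beta th) L
    <= (1 + C * h ^+ 3) ^+ N
      * avgs (flatten (nseq N (map (dil h) (map lin_dir (enum {: 'I_m + 'I_n}))))) (Phi beta th) L].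
Proof.
move=> beta0 th0 th1.
apply: slepian_iter => //; rewrite ?ltW//.
- move=> _ /mapP[c _ ->] k; rewrite ffunE normrM.
  by rewrite mulr_ile1//; [have := entry_le1 c.1 (u1 k)|have := entry_le1 c.2 (v1 k)].
- move=> _ /mapP[[i|j] _ ->] k; rewrite ffunE.
    by have := entry_le1 i (u1 k).
  by have := entry_le1 j (v1 k).
- move=> k; rewrite (big_map bilin_dir) big_enum/= -[RHS](u1 k).
  rewrite (eq_bigr (fun c => u k c.1 ^+ 2 * v k c.2 ^+ 2)); last first.
    by move=> c _; rewrite ffunE exprMn.
  rewrite -(pair_bigA _ (fun i j => u k i ^+ 2 * v k j ^+ 2))/=.
  by apply: eq_bigr => i _; rewrite -mulr_sumr v1 mulr1.
- move=> k; rewrite (big_map lin_dir) big_enum/= big_sumType/=.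
  under eq_bigr do rewrite ffunE.
  under [X in _ + X = _]eq_bigr do rewrite ffunE.
  by rewrite u1 v1.
- exact: chevet_cov.
Qed.

Lemma Phi_le_max (beta th b : R) (L : {ffun K -> R}) : 0 <= beta -> 0 <= th ->
  (forall k, L k <= b) -> Phi beta th L <= expR (th * ln #|K|%:R + th * beta * b).
Proof.
move=> beta0 th0 Lb; rewrite ler_expR -mulrA -mulrDr ler_wpM2l//.
have K0 : 0 < #|K|%:R :> R by rewrite ltr0n; apply/card_gt0P; exists k0.
rewrite -ler_expR lnK ?posrE ?sum_expR_gt0// expRD lnK ?posrE// mulrC.
rewrite mulr_natr -sumr_const; apply: ler_sum => k _.
by rewrite ler_expR ler_wpM2l.
Qed.

(** The maximum of u_k . w' + v_k . w'' is at most |w'| + |w''|. Each norm is replaced by a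
    quadratic function of w, so that the exponential becomes a multiple of [gauss], which can be
    averaged. The last term, (th beta s)^2, is halved later by the factor on the left of
    [chevet_discrete]. *)
Lemma avgs_lin_le (beta th h s : R) N : 0 < beta -> 0 < th -> 0 < s ->
  h ^+ 2 * N%:R = s ^+ 2 ->
  avgs (flatten (nseq N (map (dil h) (map lin_dir (enum {: 'I_m + 'I_n}))))) (Phi beta th) 0
  <= expR (th * ln #|K|%:R
        + th * beta * s * (Num.sqrt m%:R + Num.sqrt n%:R) + (th * beta * s) ^+ 2).
Proof.
move=> beta0 th0 s0 hN; set l := th * beta.
have l0 : 0 < l by exact: mulr_gt0.
pose pi (w : {ffun 'I_m + 'I_n -> R}) : {ffun K -> R} := [ffun k => \sum_d w d * lin_dir d k].
have piB : zmod_morphism pi.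
  move=> x y; apply/ffunP => k; rewrite !ffunE -sumrB; apply: eq_bigr => d _.
  by rewrite !ffunE mulrBl.
have pi0 : pi 0 = 0.
  by apply/ffunP => k; rewrite !ffunE big1// => d _; rewrite ffunE mul0r.
have pi_axis d : pi (axis h d) = dil h (lin_dir d).
  apply/ffunP => k; rewrite /pi ffunE (bigD1 d)//= big1 => [|d' dd'].
    by rewrite !ffunE eqxx mulr1 addr0.
  by rewrite ffunE (negbTE dd') mulr0 mul0r.
have -> : flatten (nseq N (map (dil h) (map lin_dir (enum {: 'I_m + 'I_n})))) =
    map pi (map (axis h) (flatten (nseq N (enum {: 'I_m + 'I_n})))).
  rewrite !map_flatten !map_nseq -!map_comp.
  rewrite (@eq_map _ _ (dil h \o lin_dir) (pi \o axis h))// => d /=.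
  by rewrite pi_axis.
rewrite -pi0 avgs_map//.
pose q (d : 'I_m + 'I_n) : R := Num.sqrt (match d with inl _ => m | inr _ => n end)%:R.
have q0 d : 0 < q d by rewrite sqrtr_gt0 ltr0n; case: d.
(* The N signs spend h^2 N = s^2 in every coordinate and leave s * q d / l. As q is the root of the
   dimension, this makes half of l s (sqrt m + sqrt n) come from [al] and [be], and half from the
   logarithms. *)
pose vv : {ffun 'I_m + 'I_n -> R} := [ffun d => s * q d / l + s ^+ 2].
have v0 d : 0 < vv d by rewrite ffunE addr_gt0 ?divr_gt0 ?mulr_gt0 ?exprn_gt0.
pose al := s * Num.sqrt m%:R + l * s ^+ 2; pose be := s * Num.sqrt n%:R + l * s ^+ 2.
pose c := th * ln #|K|%:R + l * (al / 2 + be / 2) + \sum_d ln (vv d) / 2.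
have PhiG w : (Phi beta th \o pi) w <= expR c * gauss vv w.
  rewrite /gauss -expRD /=.
  pose b := al / 2 + be / 2 + \sum_d w d ^+ 2 / (2 * (l * vv d)).
  apply: le_trans (Phi_le_max (b := b) (ltW beta0) (ltW th0) _) _.
    move=> k; rewrite ffunE.
    (* Young's inequality with weight l * vv d. The vectors being unit, the terms containing k sum
       to al / 2 + be / 2 for every k. *)
    apply: (@le_trans _ _ (\sum_d (w d ^+ 2 / (2 * (l * vv d)) + l * vv d / 2 * lin_dir d k ^+ 2))).
      apply: ler_sum => d _; rewrite -subr_ge0.
      have lv : 0 < l * vv d by exact: mulr_gt0.
      have -> : w d ^+ 2 / (2 * (l * vv d)) + l * vv d / 2 * lin_dir d k ^+ 2 - w d * lin_dir d k
        = (w d - l * vv d * lin_dir d k) ^+ 2 / (2 * (l * vv d)).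
        by field; rewrite !gt_eqF.
      by apply: divr_ge0; [exact: sqr_ge0|apply: mulr_ge0 => //; exact: ltW].
    rewrite big_split/= addrC /b lerD2r big_sumType/=.
    rewrite le_eqVlt; apply/orP; left; apply/eqP; congr (_ + _).
      rewrite -[RHS]mulr1 -[X in _ = _ * X](u1 k) mulr_sumr; apply: eq_bigr => i _.
      by rewrite !ffunE /q /al; field; rewrite gt_eqF.
    rewrite -[RHS]mulr1 -[X in _ = _ * X](v1 k) mulr_sumr; apply: eq_bigr => i _.
    by rewrite !ffunE /q /be; field; rewrite gt_eqF.
  rewrite ler_expR -/l /c /b sumrB.
  have -> : \sum_d w d ^+ 2 / (2 * vv d) = l * \sum_d w d ^+ 2 / (2 * (l * vv d)).
    rewrite mulr_sumr; apply: eq_bigr => d _.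
    by field; rewrite !gt_eqF.
  by rewrite le_eqVlt; apply/orP; left; apply/eqP; ring.
apply: le_trans (avgs_le _ PhiG _) _; rewrite avgsZ.
have cnt d : (count_mem d (flatten (nseq N (enum {: 'I_m + 'I_n}))))%:R = N%:R :> R.
  congr (_%:R); rewrite count_flatten map_nseq sumn_nseq.
  by rewrite count_uniq_mem ?enum_uniq// mem_enum mul1n.
have vs d : vv d - h ^+ 2 * (count_mem d (flatten (nseq N (enum {: 'I_m + 'I_n}))))%:R =
    s * q d / l.
  by rewrite cnt hN ffunE addrK.
have vs0 d : 0 < vv d - h ^+ 2 * (count_mem d (flatten (nseq N (enum {: 'I_m + 'I_n}))))%:R.
  by rewrite vs divr_gt0// mulr_gt0.
apply: le_trans (ler_wpM2l (expR_ge0 c) (avgs_gauss 0 vs0)) _.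
set g := (X in gauss X 0); have gE d : g d = s * q d / l by rewrite ffunE vs.
rewrite /gauss -expRD ler_expR /c.
rewrite -!addrA lerD2l -big_split/=.
have Sq : \sum_d (q d)^-1 = Num.sqrt m%:R + Num.sqrt n%:R.
  rewrite big_sumType/= (eq_bigr (fun=> (Num.sqrt m%:R)^-1))//.
  rewrite [X in _ + X](eq_bigr (fun=> (Num.sqrt n%:R)^-1))// !sumr_const !card_ord.
  congr (_ + _); rewrite -[LHS]mulr_natl.
    by rewrite -{1}[m%:R]sqr_sqrtr// expr2 mulfK// gt_eqF// sqrtr_gt0 ltr0n.
  by rewrite -{1}[n%:R]sqr_sqrtr// expr2 mulfK// gt_eqF// sqrtr_gt0 ltr0n.
apply: (@le_trans _ _ (l * (al / 2 + be / 2) + l * s / 2 * \sum_d (q d)^-1)).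
  rewrite lerD2l mulr_sumr; apply: ler_sum => d _.
  have sq0 : 0 < s * q d / l by rewrite divr_gt0// mulr_gt0.
  have -> : vv d = s * q d / l * (1 + l * s / q d).
    by rewrite ffunE; field; rewrite !gt_eqF.
  rewrite gE lnM ?posrE//; last by rewrite addr_gt0// divr_gt0// mulr_gt0.
  rewrite ffunE expr0n mul0r add0r.
  have : ln (1 + l * s / q d) <= l * s / q d.
    rewrite -ler_expR lnK ?posrE ?expR_ge1Dx//.
    by rewrite addr_gt0// divr_gt0// mulr_gt0.
  lra.
by rewrite Sq /al /be le_eqVlt; apply/orP; left; apply/eqP; field.
Qed.

End Chevet.

(** * From centered normal laws to sums of signs *)

Section GaussianAverage.
Variable R : realType.
Local Notation mu := (@lebesgue_measure R).
Implicit Types (f g : R -> R) (a s t x y z : R).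

(* The expectation of [f] under the normal law of mean [x] and standard
   deviation [s]. *)
Definition gint s f x : \bar R := (\int[mu]_z (f z * normal_pdf x s z)%:E)%E.

Lemma normal_pdf_tilt a x s z : s != 0 ->
  expR (a * (z - x)) * normal_pdf x s z =
  expR (a ^+ 2 * s ^+ 2 / 2) * normal_pdf (x + a * s ^+ 2) s z.
Proof.
move=> s0; rewrite !normal_pdfE// mulrCA [RHS]mulrCA; congr (_ * _).
rewrite /normal_fun -!expRD; congr expR.
by rewrite -mulr_natr; field.
Qed.

(** Completing the square: the joint density of two successive Gaussian steps from x through y to z
    is the density of the sum times that of the intermediate point y given both ends. *)
Lemma normal_pdf_chapman s t r x y z : 0 < s -> 0 < t -> 0 < r ->
  r ^+ 2 = s ^+ 2 + t ^+ 2 ->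
  normal_pdf y s z * normal_pdf x t y =
  normal_pdf x r z * normal_pdf ((s ^+ 2 * x + t ^+ 2 * z) / r ^+ 2) (s * t / r) y.
Proof.
move=> s0 t0 r0 rE.
rewrite !normal_pdfE ?gt_eqF ?divr_gt0 ?mulr_gt0// [LHS]mulrACA [RHS]mulrACA.
congr (_ * _).
  rewrite /normal_peak -!invfM -!sqrtrM ?mulrn_wge0 ?mulr_ge0 ?sqr_ge0 ?pi_ge0
    ?(ltW r0) ?(ltW s0)//.
  congr (Num.sqrt _)^-1; rewrite -!(mulr_natr (_ * pi)).
  by field; rewrite gt_eqF.
rewrite /normal_fun -!expRD; congr expR; rewrite -!(mulr_natr (_ ^+ 2)).
have r20 : s ^+ 2 + t ^+ 2 != 0 by rewrite -rE gt_eqF// exprn_gt0.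
rewrite exprMn exprVn exprMn rE.
by field; rewrite r20 !gt_eqF.
Qed.

Lemma measurable_normal_pdf2 s : s != 0 ->
  measurable_fun setT (fun p : R * R => normal_pdf p.1 s p.2).
Proof.
move=> s0; under eq_fun do rewrite normal_pdfE//.
apply: measurable_funM => //; apply: measurableT_comp => //.
apply: measurable_funM => //; apply: measurableT_comp => //.
apply: measurable_funX; exact: measurable_funB.
Qed.

Lemma gint_semigroup f s t r x : 0 < s -> 0 < t -> 0 < r ->
  r ^+ 2 = s ^+ 2 + t ^+ 2 -> measurable_fun setT f -> (forall z, 0 <= f z) ->
  gint r f x = (\int[mu]_y (gint s f y * (normal_pdf x t y)%:E))%E.
Proof.
move=> s0 t0 r0 rE mf f0.
pose F (p : R * R) : \bar R :=
  (f p.2 * normal_pdf p.1 s p.2 * normal_pdf x t p.1)%:E.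
have mF : measurable_fun setT F.
  apply/measurable_EFinP; apply: measurable_funM.
    apply: measurable_funM; first exact: measurableT_comp.
    by apply: measurable_normal_pdf2; rewrite gt_eqF.
  by apply: measurableT_comp => //; exact: measurable_normal_pdf.
have F0 p : (0 <= F p)%E by rewrite lee_fin !mulr_ge0 ?normal_pdf_ge0.
transitivity (\int[mu]_y \int[mu]_z F (y, z))%E; last first.
  apply: eq_integral => y _; rewrite /gint muleC -ge0_integralZl//=.
  - by apply: eq_integral => z _; rewrite /F /= -EFinM mulrC.
  - apply/measurable_EFinP; apply: measurable_funM => //.
    exact: measurable_normal_pdf.
  - by move=> z _; rewrite lee_fin mulr_ge0// normal_pdf_ge0.
  - by rewrite lee_fin normal_pdf_ge0.
rewrite fubini_tonelli//; apply: eq_integral => z _; rewrite /F /=.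
under eq_integral => y _ do rewrite -mulrA (@normal_pdf_chapman s t r)// mulrA EFinM.
rewrite ge0_integralZl//=.
- by rewrite integral_normal_pdf mule1.
- by apply/measurable_EFinP; exact: measurable_normal_pdf.
- by move=> y _; rewrite lee_fin normal_pdf_ge0.
- by rewrite lee_fin mulr_ge0// normal_pdf_ge0.
Qed.

Lemma gint_expR a s x : s != 0 ->
  gint s (fun z => expR (a * (z - x))) x = (expR (a ^+ 2 * s ^+ 2 / 2))%:E.
Proof.
move=> s0; rewrite /gint.
under eq_integral => z _ do rewrite normal_pdf_tilt// EFinM.
rewrite ge0_integralZl//=.
- by rewrite integral_normal_pdf mule1.
- by apply/measurable_EFinP; exact: measurable_normal_pdf.
- by move=> y _; rewrite lee_fin normal_pdf_ge0.
Qed.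

Lemma gint_le s f g x : measurable_fun setT f -> measurable_fun setT g ->
  (forall z, 0 <= f z) -> (forall z, f z <= g z) -> (gint s f x <= gint s g x)%E.
Proof.
move=> mf mg f0 fg; apply: ge0_le_integral => //=.
- by move=> z _; rewrite lee_fin mulr_ge0// normal_pdf_ge0.
- apply/measurable_EFinP; apply: measurable_funM => //; exact: measurable_normal_pdf.
- apply/measurable_EFinP; apply: measurable_funM => //; exact: measurable_normal_pdf.
- by move=> z _; rewrite lee_fin ler_wpM2r ?normal_pdf_ge0.
Qed.

Lemma gintD s f g x : measurable_fun setT f -> measurable_fun setT g ->
  (forall z, 0 <= f z) -> (forall z, 0 <= g z) ->
  gint s (fun z => f z + g z) x = (gint s f x + gint s g x)%E.
Proof.
move=> mf mg f0 g0; rewrite /gint -ge0_integralD//=.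
- by apply: eq_integral => z _; rewrite mulrDl EFinD.
- by move=> z _; rewrite lee_fin mulr_ge0// normal_pdf_ge0.
- apply/measurable_EFinP; apply: measurable_funM => //; exact: measurable_normal_pdf.
- by move=> z _; rewrite lee_fin mulr_ge0// normal_pdf_ge0.
- apply/measurable_EFinP; apply: measurable_funM => //; exact: measurable_normal_pdf.
Qed.

Lemma gintZ s c f x : measurable_fun setT f -> (forall z, 0 <= f z) -> 0 <= c ->
  gint s (fun z => c * f z) x = (c%:E * gint s f x)%E.
Proof.
move=> mf f0 c0; rewrite /gint -ge0_integralZl//=.
- by apply: eq_integral => z _; rewrite -mulrA EFinM.
- apply/measurable_EFinP; apply: measurable_funM => //; exact: measurable_normal_pdf.
- by move=> z _; rewrite lee_fin mulr_ge0// normal_pdf_ge0.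
Qed.

Lemma gint_sum (I : Type) (r : seq I) s (f : I -> R -> R) x :
  (forall i, measurable_fun setT (f i)) -> (forall i z, 0 <= f i z) ->
  gint s (fun z => \sum_(i <- r) f i z) x = (\sum_(i <- r) gint s (f i) x)%E.
Proof.
move=> mf f0; rewrite /gint -ge0_integral_sum//=.
- by apply: eq_integral => z _; rewrite mulr_suml -sumEFin.
- move=> i; apply/measurable_EFinP; apply: measurable_funM; first exact: mf.
  exact: measurable_normal_pdf.
- by move=> i z _; rewrite lee_fin mulr_ge0// normal_pdf_ge0.
Qed.

End GaussianAverage.

(** * Replacing a normal variable by signs *)

Section Transfer.
Variables (R : realType) (K : finType) (k0 : K) (beta th : R).
Hypotheses (beta0 : 0 <= beta) (th0 : 0 <= th) (th1 : th <= 1).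
Implicit Types (L c : {ffun K -> R}).
Let F : {ffun K -> R} -> R := Phi beta th.

Lemma measurable_Phi_line L c : measurable_fun setT (fun z => F (L + dil z c)%R).
Proof.
rewrite /F /Phi; apply: measurableT_comp => //.
apply: measurable_funM => //; apply: measurableT_comp; first exact: measurable_ln.
apply: measurable_sum => k; apply: measurableT_comp => //.
apply: measurable_funM => //; under eq_fun do rewrite !ffunE.
by apply: measurable_funD => //; apply: measurable_funM.
Qed.

Lemma dilD a b c : dil (a + b) c = dil a c + dil b c.
Proof. by apply/ffunP => k; rewrite !ffunE mulrDl. Qed.

Lemma dil0 c : dil 0 c = 0.
Proof. by apply/ffunP => k; rewrite !ffunE mul0r. Qed.

(** The counterpart of [avgs_Phi_le] for a normal shift: the exponentials left by [pmean_le] have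
    explicit Gaussian integrals. *)
Lemma gint_Phi_le (h : R) L c y (p := softmax beta (L + dil y c)) : 0 < h ->
  (gint h (fun z => F (L + dil z c)%R) y <= (F (L + dil y c)%R *
    ((1 - th) * expR ((th * beta * mean p c) ^+ 2 * h ^+ 2 / 2)
     + th * mean p (fun k =>
         expR ((beta * (c k + (th - 1) * mean p c)) ^+ 2 * h ^+ 2 / 2))))%:E)%E.
Proof.
move=> h0; have h_neq0 : h != 0 by rewrite gt_eqF.
have p0 : forall k, 0 <= p k by exact: softmax_ge0.
have p1 : \sum_k p k = 1 by exact: sum_softmax.
set L' := L + dil y c.
pose G a z := expR (a * (z - y)).
have mG a : measurable_fun setT (G a).
  apply: measurableT_comp => //; apply: measurable_funM => //.
  exact: measurable_funB.
have G0 a z : 0 <= G a z by exact: expR_ge0.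
pose a0 := th * beta * mean p c; pose a k := beta * (c k + (th - 1) * mean p c).
pose S z := \sum_k p k * G (a k) z.
have mS : measurable_fun setT S.
  by apply: measurable_sum => k; apply: measurable_funM.
have S0 z : 0 <= S z by apply: sumr_ge0 => k _; rewrite mulr_ge0.
have FL' : 0 <= F L' by exact: expR_ge0.
have th1' : 0 <= 1 - th by rewrite subr_ge0.
apply: (@le_trans _ _ (gint h (fun z => F L' * ((1 - th) * G a0 z + th * S z)) y)).
  apply: gint_le.
  - exact: measurable_Phi_line.
  - by apply: measurable_funM => //; apply: measurable_funD; apply: measurable_funM.
  - by move=> z; exact: expR_ge0.
  move=> z; have -> : L + dil z c = L' + dil (z - y) c.
    by rewrite /L' -addrA -dilD; congr (_ + dil _ _); ring.
  rewrite {1}/F PhiD// -/(F L').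
  rewrite ler_wpM2l//.
  apply: le_trans (pmean_le p0 p1 th0 th1 _ (beta * (z - y) * mean p c)) _.
  rewrite le_eqVlt; apply/orP; left; apply/eqP.
  congr (_ * expR _ + th * _); first by rewrite /a0; ring.
  by apply: eq_bigr => k _; congr (_ * expR _); rewrite ffunE /a; ring.
rewrite gintZ//; last 2 first.
- by apply: measurable_funD; apply: measurable_funM.
- by move=> z; rewrite addr_ge0// mulr_ge0.
rewrite gintD//; last 4 first.
- by apply: measurable_funM.
- by apply: measurable_funM.
- by move=> z; rewrite mulr_ge0.
- by move=> z; rewrite mulr_ge0.
rewrite !gintZ// gint_expR// gint_sum; last 2 first.
- by move=> k; apply: measurable_funM.
- by move=> k z; rewrite mulr_ge0.
rewrite (eq_bigr (fun k => (p k * expR (a k ^+ 2 * h ^+ 2 / 2))%:E)); last first.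
  by move=> k _; rewrite gintZ// gint_expR.
by rewrite sumEFin -!EFinM.
Qed.

(** A normal variable and a sign of the same variance agree to second order, so the upper bound for
    one and the lower bound for the other differ by O(h^3). The constants follow those of
    [slepian_step] with a single shift. *)
Lemma transfer_step : exists C h0 : R, [/\ 0 <= C, 0 < h0 &
  forall h, 0 < h <= h0 -> forall c, (forall k, `|c k| <= 1) -> forall L y,
    (gint h (fun z => F (L + dil z c)%R) y <=
     ((1 + C * h ^+ 3) * avg (dil h c) F (L + dil y c)%R)%:E)%E].
Proof.
have [b0 [t0 t1]] := conj beta0 (conj th0 th1).
pose B := 2 * beta ^+ 2; pose D := 40 * beta ^+ 3.
pose E := 2 * B ^+ 2; pose M := 1 + 2 * B + 4 * beta + 2 * D.
have B0 : 0 <= B by rewrite mulr_ge0// sqr_ge0.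
have D0 : 0 <= D by rewrite mulr_ge0// exprn_ge0.
have E0 : 0 <= E by rewrite mulr_ge0// sqr_ge0.
have M0 : 1 <= M by rewrite /M; lra.
exists (2 * (D + E)), M^-1; split; [lra|by rewrite invr_gt0; lra|].
move=> h /andP[h0 hM] c c1 L y.
have {hM} hM : h * M <= 1 by rewrite -ler_pdivlMr ?mul1r//; lra.
have h1 : h <= 1 by nra.
have hB : B * h ^+ 2 <= 1 / 2 by rewrite expr2 mulrA; rewrite /M in hM; nra.
have hb : beta * h <= 1 / 4 by rewrite /M in hM; nra.
have h3 : 0 <= h ^+ 3 by rewrite exprn_ge0// ltW.
have h3h : h ^+ 3 <= h by rewrite exprS ler_piMr ?(ltW h0)// expr_le1// ltW.
have h43 : h ^+ 4 <= h ^+ 3 by rewrite (exprS _ 3) ler_piMl.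
have hD : D * h ^+ 3 <= 1 / 2 by rewrite /M in hM; nra.
apply: le_trans (gint_Phi_le L c y h0) _; rewrite lee_fin.
set L' := L + dil y c; set p := softmax beta L'.
have p0 : forall k, 0 <= p k by exact: softmax_ge0.
have p1 : \sum_k p k = 1 by exact: sum_softmax.
set m := mean p c; set V := mean p (fun k => c k ^+ 2).
have mV : m ^+ 2 <= V by exact: mean_sqr_le.
have m1 : `|m| <= 1 by exact: mean_bound.
have m2 : m ^+ 2 <= 1 by rewrite -(real_normK (num_real m)) expr_le1.
have m20 := sqr_ge0 m; have h20 := sqr_ge0 h; have b20 := sqr_ge0 beta.
pose q := th * beta ^+ 2 / 2 * (V - (1 - th) * m ^+ 2).
have q0 : 0 <= q by rewrite mulr_ge0 ?divr_ge0 ?mulr_ge0//; nra.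
have PhiL : 0 < F L' by exact: expR_gt0.
have lower : F L' * (1 + q * h ^+ 2 - D * h ^+ 3) <= avg (dil h c) F L'.
  apply: le_trans (@avgs_Phi_ge _ _ k0 _ _ beta0 th0 th1 [:: dil h c] L' h _ _); last 2 first.
  - move=> z; rewrite inE => /eqP -> k; rewrite ffunE normrM (gtr0_norm h0).
    by rewrite ler_piMr ?(ltW h0).
  - have -> : (size [:: dil h c])%:R * h * beta = beta * h by rewrite /= mul1r mulrC.
    by rewrite hb mulr_ge0 ?(ltW h0).
  rewrite ler_pM2l// -/p /=.
  have -> : mean p (fun k => \sum_(z <- [:: dil h c]) z k ^+ 2) = h ^+ 2 * V.
    rewrite /V -meanZ; congr mean; apply/funext => k.
    by rewrite big_seq1 ffunE exprMn.
  have -> : \sum_(z <- [:: dil h c]) mean p z ^+ 2 = h ^+ 2 * m ^+ 2.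
    rewrite big_seq1 -exprMn -meanZ; congr (mean _ _ ^+ 2); apply/funext => k.
    by rewrite ffunE.
  by rewrite le_eqVlt; apply/orP; left; apply/eqP; rewrite /q /D; field.
pose x1 := (th * beta * m) ^+ 2 * h ^+ 2 / 2.
pose x2 k := (beta * (c k + (th - 1) * m)) ^+ 2 * h ^+ 2 / 2.
rewrite -/x1 -/(x2 _).
have x10 : 0 <= x1 by rewrite divr_ge0// mulr_ge0// sqr_ge0.
have x1B : x1 <= B * h ^+ 2.
  rewrite /x1 /B !exprMn; have : th ^+ 2 * m ^+ 2 <= 1.
    by rewrite mulr_ile1 ?sqr_ge0// expr_le1.
  by nra.
have x20 k : 0 <= x2 k by rewrite divr_ge0// mulr_ge0// sqr_ge0.
have x2B k : x2 k <= B * h ^+ 2.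
  rewrite /x2 /B exprMn.
  have : `|c k + (th - 1) * m| <= 2.
    rewrite (le_trans (ler_normD _ _))// (_ : 2 = 1 + 1)// lerD//.
    by rewrite normrM mulr_ile1// ler_norml; lra.
  rewrite ler_norml => /andP[l1 l2].
  have c4 : (c k + (th - 1) * m) ^+ 2 <= 4 by nra.
  have : 0 <= beta ^+ 2 * h ^+ 2 * (4 - (c k + (th - 1) * m) ^+ 2).
    by apply: mulr_ge0; [exact: mulr_ge0|rewrite subr_ge0].
  move: ((c k + _) ^+ 2) => w; lra.
have e1 : expR x1 <= 1 + x1 + 2 * (B * h ^+ 2) ^+ 2.
  apply: le_trans (expR_le_quad _) _; first by rewrite x10 (le_trans x1B).
  by rewrite lerD2l ler_pM2l// lerXn2r// nnegrE (le_trans x10).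
have e2 : mean p (fun k => expR (x2 k)) <= 1 + mean p x2 + 2 * (B * h ^+ 2) ^+ 2.
  rewrite -[X in _ <= X + _ + _](mean_cst p1) -[X in _ <= _ + X](mean_cst p1) -!meanD.
  apply: ler_mean => // k.
  apply: le_trans (expR_le_quad _) _; first by rewrite x20 (le_trans (x2B k)).
  by rewrite lerD2l ler_pM2l// lerXn2r// nnegrE// (le_trans (x20 k)).
have x2E : mean p x2 = beta ^+ 2 * h ^+ 2 / 2 * (V + ((th - 1) ^+ 2 + 2 * (th - 1)) * m ^+ 2).
  have -> : mean p x2 = mean p (fun k => beta ^+ 2 * h ^+ 2 / 2 *
      (c k ^+ 2 + (2 * (th - 1) * m * c k + (th - 1) ^+ 2 * m ^+ 2))).
    by congr mean; apply/funext => k; rewrite /x2; field.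
  by rewrite meanZ meanD meanD meanZ mean_cst// -/V -/m; field.
have e1' : (1 - th) * expR x1 <= (1 - th) * (1 + x1 + 2 * (B * h ^+ 2) ^+ 2).
  by rewrite ler_wpM2l// subr_ge0.
have e2' := ler_wpM2l th0 e2.
apply: (@le_trans _ _ (F L' * (1 + q * h ^+ 2 + E * h ^+ 4))).
  rewrite ler_pM2l//; apply: le_trans (lerD e1' e2') _.
  by rewrite x2E le_eqVlt; apply/orP; left; apply/eqP; rewrite /x1 /q /E; field.
apply: (@le_trans _ _ (F L' *
    ((1 + 2 * (D + E) * h ^+ 3) * (1 + q * h ^+ 2 - D * h ^+ 3)))); last first.
  by rewrite mulrCA ler_wpM2l// addr_ge0// mulr_ge0//; lra.
rewrite ler_pM2l//.
have qh : 0 <= q * h ^+ 2 by exact: mulr_ge0.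
have c3 : 0 <= (D + E) * h ^+ 3 * (2 * (1 + q * h ^+ 2 - D * h ^+ 3) - 1).
  by apply: mulr_ge0; [rewrite mulr_ge0// addr_ge0//|lra].
have c4 : E * h ^+ 4 <= E * h ^+ 3 by rewrite ler_wpM2l.
by move: c3 c4 qh hD; lra.
Qed.

(** A normal variable of variance (N + 1) h^2 is split by the semigroup property into N + 1 normal
    steps of size h, and each one is exchanged for a sign. *)
Lemma transfer_iter : exists C h0 : R, [/\ 0 <= C, 0 < h0 &
  forall h, 0 < h <= h0 -> forall c, (forall k, `|c k| <= 1) -> forall L N,
    (gint (Num.sqrt N.+1%:R * h) (fun z => F (L + dil z c)%R) 0 <=
     ((1 + C * h ^+ 3) ^+ N.+1 * avgs (nseq N.+1 (dil h c)) F L)%:E)%E].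
Proof.
have [C [h0 [C0 h00 H]]] := transfer_step; exists C, h0; split=> // h hh c c1 L N.
have [hp _] := andP hh; have r0 : 0 <= 1 + C * h ^+ 3.
  by rewrite addr_ge0// mulr_ge0// exprn_ge0// ltW.
elim: N L => [|N IH] L.
  by have := H h hh c c1 L 0; rewrite sqrtr1 mul1r expr1 dil0 addr0.
set r := _ * h; set rho := 1 + _ in r0 IH *.
have mF L' : measurable_fun setT (fun z => F (L' + dil z c)) by exact: measurable_Phi_line.
have F0 L' : 0 <= F L' by exact: expR_ge0.
rewrite (@gint_semigroup _ _ h (Num.sqrt N.+1%:R * h) r)//; last 3 first.
- by rewrite mulr_gt0// sqrtr_gt0 ltr0n.
- by rewrite mulr_gt0// sqrtr_gt0 ltr0n.
- by rewrite /r !exprMn !sqr_sqrtr ?ler0n// -natr1; ring.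
set t := Num.sqrt N.+1%:R * h in IH *.
apply: (@le_trans _ _ (gint t (fun y => rho / 2 *
   (F (L + dil h c + dil y c) + F (L - dil h c + dil y c))) 0)).
  apply: ge0_le_integral => //=.
  - move=> y _; apply: mule_ge0; last by rewrite lee_fin normal_pdf_ge0.
    by apply: integral_ge0 => z _; rewrite lee_fin mulr_ge0// normal_pdf_ge0.
  - apply: emeasurable_funM; last first.
      by apply/measurable_EFinP; exact: measurable_normal_pdf.
    pose G (p : R * R) : \bar R := (F (L + dil p.2 c) * normal_pdf p.1 h p.2)%:E.
    (* As a function of its base point, [gint] is a section integral, so Tonelli's theorem gives its
       measurability. *)
    have : measurable_fun setT (fubini_F (@lebesgue_measure R) G).
      apply: measurable_fun_fubini_tonelli_F.
        apply/measurable_EFinP; apply: measurable_funM; first exact: (measurableT_comp (mF L)).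
        by apply: measurable_normal_pdf2; rewrite gt_eqF.
      by move=> p; rewrite /G lee_fin mulr_ge0// normal_pdf_ge0.
    by [].
  - apply/measurable_EFinP; apply: measurable_funM; last exact: measurable_normal_pdf.
    by apply: measurable_funM => //; apply: measurable_funD; exact: mF.
  - move=> y _; rewrite EFinM lee_wpmul2r ?lee_fin ?normal_pdf_ge0//.
    apply: le_trans (H h hh c c1 L y) _; rewrite lee_fin /avg.
    rewrite (addrAC L (dil y c)) (addrAC L (dil y c)) mulrA [leLHS]mulrAC.
    exact: lexx.
rewrite gintZ//; last 3 first.
- by apply: measurable_funD; exact: mF.
- by move=> z; rewrite addr_ge0.
- by rewrite divr_ge0.
rewrite gintD//.
have IH1 := IH (L + dil h c); have IH2 := IH (L - dil h c).
apply: le_trans (lee_wpmul2l _ (leeD IH1 IH2)) _; first by rewrite lee_fin divr_ge0.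
rewrite -EFinD -EFinM lee_fin le_eqVlt; apply/orP; left; apply/eqP.
set A := avgs (nseq N.+1 _) F.
have -> : avgs (nseq N.+2 (dil h c)) F L = avg (dil h c) A L by [].
by rewrite /avg [rho ^+ N.+2]exprS; field.
Qed.

End Transfer.

(** * Discretisation of the noise *)

Lemma measure_bigsetU_le (d : measure_display) (T : measurableType d) (R : realType)
    (mu : {measure set T -> \bar R}) (I : finType) (B : set T) (A : I -> set T) :
  measurable B -> (forall i, measurable (A i)) ->
  (forall x, B x -> exists i, A i x) -> (mu B <= \sum_i mu (A i))%E.
Proof.
move=> mB mA BA; apply: (@le_trans _ _ (mu (\big[setU/set0]_i A i))).
  apply: le_measure; rewrite ?inE//; first exact: bigsetU_measurable.
  by move=> x /BA[i Ai]; rewrite (bigD1 i)//=; left.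
elim: (index_enum I) => [|i r IH]; first by rewrite !big_nil measure0.
rewrite !big_cons; apply: le_trans (measureU2 _ _ _) _ => //.
  exact: bigsetU_measurable.
by rewrite leeD2l.
Qed.

Section Cells.
Variables (R : realType) (M : nat).
Hypothesis M0 : (0 < M)%N.

(** There are 2 M^2 cells of width 1 / M, filling the interval from -M to M; [mark] is the left end
    of a cell. *)
Definition cell (j : 'I_(M * 2 * M)) : set R :=
  (fun z => (z + M%:R) * M%:R) @^-1` `[j%:R, j.+1%:R[.

Definition mark (j : 'I_(M * 2 * M)) : R := j%:R / M%:R - M%:R.

Lemma measurable_cell j : measurable (cell j).
Proof.
have mf : measurable_fun setT (fun z : R => (z + M%:R) * M%:R).
  by apply: measurable_funM => //; exact: measurable_funD.
by rewrite /cell -[X in measurable X]setTI; apply: mf.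
Qed.

Lemma cell_mark j z : cell j z -> `|z - mark j| <= M%:R^-1.
Proof.
have M0' : 0 < M%:R :> R by rewrite ltr0n.
rewrite /cell /= in_itv/= => /andP[h1 h2].
have -> : z - mark j = ((z + M%:R) * M%:R - j%:R) / M%:R.
  by rewrite /mark; field; rewrite gt_eqF.
have Mi : 0 <= M%:R^-1 :> R by rewrite invr_ge0 ltW.
rewrite normrM [X in _ * X]ger0_norm//.
rewrite ler_piMl// ger0_norm ?subr_ge0//.
by rewrite lerBlDl -natr1 in h2 *; exact: ltW.
Qed.

Lemma cell_inj i j z : cell i z -> cell j z -> i = j.
Proof.
rewrite /cell /= !in_itv/= => /andP[h1 h2] /andP[h3 h4]; apply: val_inj; apply/eqP.
by rewrite eqn_leq; apply/andP; split; rewrite -ltnS -(ltr_nat R);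
  [exact: le_lt_trans h1 h4|exact: le_lt_trans h3 h2].
Qed.

Lemma cell_cover z : - M%:R <= z < M%:R -> exists j, cell j z.
Proof.
move=> /andP[z1 z2]; have M0' : 0 < M%:R :> R by rewrite ltr0n.
pose y := (z + M%:R) * M%:R.
have y0 : 0 <= y by rewrite mulr_ge0 ?(ltW M0')//; lra.
have /andP[t1 t2] := Num.Theory.truncn_itv y0.
have yM : (Num.truncn y < M * 2 * M)%N.
  rewrite -(ltr_nat R); apply: le_lt_trans t1 _.
  by rewrite natrM /y ltr_pM2r// natrM; lra.
by exists (Ordinal yM); rewrite /cell /= in_itv/= t1.
Qed.

End Cells.

Section GaussianDomination.
Variables (R : realType) (K : finType) (k0 : K) (beta th : R).
Hypotheses (beta0 : 0 <= beta) (th0 : 0 <= th) (th1 : th <= 1).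
Local Notation F := (@Phi R K beta th).
Implicit Types (L c : {ffun K -> R}).

Lemma Phi_lipschitz L L' e : (forall k, L k <= L' k + e) ->
  F L <= expR (th * beta * e) * F L'.
Proof.
move=> LL; rewrite /F /Phi -expRD ler_expR -mulrA -mulrDr ler_wpM2l//.
rewrite -ler_expR lnK ?posrE ?sum_expR_gt0// expRD lnK ?posrE ?sum_expR_gt0//.
rewrite mulr_sumr; apply: ler_sum => k _; rewrite -expRD ler_expR -mulrDr.
by rewrite ler_wpM2l// addrC.
Qed.

Lemma Phi_ge L k : expR (th * beta * L k) <= F L.
Proof.
rewrite ler_expR -mulrA ler_wpM2l// -ler_expR lnK ?posrE ?sum_expR_gt0//.
by rewrite (bigD1 k)//= lerDl sumr_ge0// => i _; exact: expR_ge0.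
Qed.

Variables (M : nat) (s : R).
Hypotheses (M0 : (0 < M)%N) (s0 : 0 < s).

Definition cell_prob (j : 'I_(M * 2 * M)) : R := fine (normal_prob 0 s (@cell R M j)).

Definition cell_op c (f : {ffun K -> R} -> R) L :=
  \sum_j cell_prob j * f (L + dil (@mark R M j) c).

Lemma cell_prob_ge0 j : 0 <= cell_prob j.
Proof. by rewrite fine_ge0// measure_ge0. Qed.

Lemma normal_prob_gint (A : set R) : measurable A ->
  normal_prob 0 s A = gint s (\1_A) 0.
Proof.
move=> mA; rewrite /normal_prob integral_mkcond /gint; apply: eq_integral => z _.
by rewrite patchE indicE; case: ifP => _; rewrite ?mul1r ?mul0r.
Qed.

(** Moving from a mark to any point of its cell changes each coordinate by at most 1 / M, which
    costs a factor exp (th beta / M) on [F]; discarding the rest is harmless as [F] is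
    nonnegative. *)
Lemma cell_op_le_gint c L : (forall k, `|c k| <= 1) ->
  ((cell_op c F L)%:E <=
   (expR (th * beta / M%:R))%:E * gint s (fun z => F (L + dil z c)%R) 0)%E.
Proof.
move=> c1; have F0 L' : 0 <= F L' by exact: expR_ge0.
have mF : measurable_fun setT (fun z : R => F (L + dil z c)) by exact: measurable_Phi_line.
have mI j : measurable_fun setT (\1_(@cell R M j) : R -> R).
  by apply: measurable_indic; exact: measurable_cell.
have I0 j z : 0 <= \1_(@cell R M j) z :> R by rewrite indicE.
rewrite -gintZ ?expR_ge0// /cell_op -sumEFin.
rewrite (eq_bigr (fun j : 'I_(M * 2 * M) =>
    gint s (fun z => F (L + dil (@mark R M j) c) * \1_(@cell R M j) z) 0)); last first.
  move=> j _; rewrite gintZ// -normal_prob_gint; last exact: measurable_cell.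
  by rewrite EFinM muleC /cell_prob fineK// fin_num_measure//; exact: measurable_cell.
rewrite -gint_sum; last 2 first.
- move=> j; apply: measurable_funM; [exact: measurable_cst|exact: mI].
- by move=> j z; rewrite mulr_ge0.
apply: gint_le.
- by apply: measurable_sum => j; apply: measurable_funM; [exact: measurable_cst|exact: mI].
- by apply: measurable_funM; [exact: measurable_cst|exact: mF].
- by move=> z; apply: sumr_ge0 => j _; rewrite mulr_ge0.
move=> z; have [[j cj]|nc] := pselect (exists j : 'I_(M * 2 * M), @cell R M j z).
  rewrite (bigD1 j)//= big1 => [|i ij].
    rewrite addr0 indicE mem_set// mulr1; apply: Phi_lipschitz => k.
    rewrite !ffunE -addrA lerD2l -lerBlDl -mulrBl.
    apply: le_trans (ler_norm _) _; rewrite normrM distrC.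
    rewrite -[leRHS]mulr1 ler_pM//; exact: cell_mark.
  rewrite indicE memNset ?mulr0// => ci.
  by move/eqP: ij; apply; exact: cell_inj ci cj.
rewrite big1 ?mulr_ge0 ?expR_ge0// => j _.
by rewrite indicE memNset ?mulr0// => cj; apply: nc; exists j.
Qed.

End GaussianDomination.

Lemma measurable_exists_fin (d : measure_display) (T : measurableType d) (I : finType)
    (Q : I -> T -> Prop) : (forall i, measurable [set w | Q i w]) ->
  measurable [set w | exists i, Q i w].
Proof.
move=> mQ; rewrite (_ : mkset _ = \bigcup_(i in setT) [set w | Q i w]).
  by apply: fin_bigcup_measurable => //; exact: finite_finset.
apply/seteqP; split=> w /=.
  by case=> i Qi; exists i.
by case=> i _ Qi; exists i.
Qed.

Lemma measurable_forall_fin (d : measure_display) (T : measurableType d) (I : finType)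
    (Q : I -> T -> Prop) : (forall i, measurable [set w | Q i w]) ->
  measurable [set w | forall i, Q i w].
Proof.
move=> mQ; rewrite (_ : mkset _ = \bigcap_(i in setT) [set w | Q i w]).
  by apply: fin_bigcap_measurable => //; exact: finite_finset.
apply/seteqP; split=> w /= Qw i; last exact: Qw.
by move=> _; exact: Qw.
Qed.

Section CellOps.
Variables (R : realType) (K : finType) (M : nat) (s : R).
Implicit Types (c L : {ffun K -> R}) (f g : {ffun K -> R} -> R).
Local Notation cop := (@cell_op R K M s).

Lemma cell_op_mono c f g : (forall L, f L <= g L) -> forall L, cop c f L <= cop c g L.
Proof.
by move=> fg L; apply: ler_sum => j _; rewrite ler_wpM2l// cell_prob_ge0.
Qed.

Lemma cell_opZ c a f L : cop c (fun y => a * f y) L = a * cop c f L.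
Proof. by rewrite /cell_op mulr_sumr; apply: eq_bigr => j _; rewrite mulrCA. Qed.

Lemma avgs_translate (zs : seq {ffun K -> R}) f v L :
  avgs zs (fun y => f (y + v)) L = avgs zs f (L + v).
Proof.
by elim: zs L => //= z zs IH L; rewrite /avg !IH (addrAC L z) (addrAC L (- z)).
Qed.

Lemma cell_op_avgs c zs f L : cop c (avgs zs f) L = avgs zs (cop c f) L.
Proof.
rewrite /cell_op avgs_sum; apply: eq_bigr => j _.
by rewrite avgsZ avgs_translate.
Qed.

Definition cell_ops (I : Type) (c : I -> {ffun K -> R}) (r : seq I) f :=
  foldr (fun i => cop (c i)) f r.

(** Cell operators commute with sign averages, so the variables are exchanged one by one. *)
Lemma cell_ops_le (I : Type) (c : I -> {ffun K -> R}) (z : I -> seq {ffun K -> R})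
    (rho : R) f (r : seq I) : 0 <= rho ->
  (forall i L, cop (c i) f L <= rho * avgs (z i) f L) ->
  forall L, cell_ops c r f L <= rho ^+ size r * avgs (flatten (map z r)) f L.
Proof.
move=> rho0 H; elim: r => [|i r IH] L /=; first by rewrite expr0 mul1r.
apply: le_trans (cell_op_mono _ IH _) _.
rewrite cell_opZ cell_op_avgs exprSr -mulrA ler_wpM2l ?exprn_ge0//.
apply: le_trans (avgs_le _ (H i) _) _.
by rewrite avgsZ avgs_cat avgsC.
Qed.

End CellOps.

Section GaussianEvent.
Variables (R : realType) (K : finType) (k0 : K) (beta th : R).
Hypotheses (beta0 : 0 <= beta) (th0 : 0 <= th) (th1 : th <= 1).
Local Notation F := (@Phi R K beta th).
Variables (M : nat) (s : R).
Hypotheses (M0 : (0 < M)%N) (s0 : 0 < s).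
Variables (dO : measure_display) (Omega : measurableType dO) (P : probability Omega R).
Variables (I : finType) (X : I -> {RV P >-> R}).
Hypotheses (X_normal : forall i, normally_distributed (X i) 0 s).
Hypothesis (X_indep : mutually_independent X).
Variable (c : I -> {ffun K -> R}).
Hypothesis c1 : forall i k, `|c i k| <= 1.

Local Notation n := (#|I|%:R : R).

Definition exceeds (t : R) : set Omega := [set w | exists k, t <= \sum_i X i w * c i k].

Lemma measurable_exceeds t : measurable (exceeds t).
Proof.
apply: measurable_exists_fin => k.
have mf : measurable_fun setT (fun w => \sum_i X i w * c i k).
  by apply: measurable_sum => i; apply: measurable_funM.
rewrite (_ : mkset _ = (fun w => \sum_i X i w * c i k) @^-1` `[t, +oo[).
  by rewrite -[X in measurable X]setTI; apply: mf.
by apply/seteqP; split=> w /=; rewrite in_itv/= andbT.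
Qed.

Lemma measurable_RV_preimage i (B : set R) : measurable B -> measurable (X i @^-1` B).
Proof. by move=> mB; rewrite -[X in measurable X]setTI; exact: measurable_funP. Qed.

Lemma RV_normal i (B : set R) : measurable B -> P (X i @^-1` B) = normal_prob 0 s B.
Proof. exact: X_normal. Qed.

Let core : set Omega := [set w | forall i, - M%:R <= X i w < M%:R].

Let cells (r : seq I) (g : I -> 'I_(M * 2 * M)) : set Omega :=
  [set w | forall i, i \notin r -> cell (g i) (X i w)].

Let measurable_core : measurable core.
Proof.
apply: measurable_forall_fin => i.
have := measurable_RV_preimage i (measurable_itv `[- (M%:R : R), M%:R[).
by congr measurable; apply/seteqP; split=> w /=; rewrite in_itv.
Qed.

Let measurable_cells r g : measurable (cells r g).
Proof.
apply: measurable_forall_fin => i; have [ir|ir] := boolP (i \in r).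
  by rewrite (_ : mkset _ = setT)//; apply/seteqP; split.
have := measurable_RV_preimage i (measurable_cell (R := R) (M := M) (g i)).
by congr measurable; apply/seteqP; split=> w /= H => //; exact: H.
Qed.

(** Markov's inequality for [F], by induction on the list r of variables whose cell is still free; g
    holds the cells of the others. Each induction step splits one variable along its cells, and the
    product rule is applied only when all cells are fixed. *)
Lemma cells_prob_le t (r : seq I) : uniq r -> forall g,
  (P (exceeds t `&` core `&` cells r g) <=
   (expR (- (th * beta * (t - n / M%:R))) * (\prod_(i | i \notin r) cell_prob s (g i))
     * cell_ops M s c r F (\sum_(i | i \notin r) dil (@mark R M (g i)) (c i)))%:E)%E.
Proof.
have F0 L : 0 <= F L by exact: expR_ge0.
have M0' : 0 < M%:R :> R by rewrite ltr0n.
elim: r => [|i r IH] /= => [_|/andP[ir ur]] g.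
  (* If the event is not empty, one point w of it is enough: each of the n marks is within 1 / M of
     the value at w, so [F] at the marks is at least exp (th beta (t - n / M)). *)
  have [[w [[[k tk] cw] gw]]|nex] := pselect (exists w, (exceeds t `&` core `&` cells [::] g) w).
    apply: (@le_trans _ _ (P (\bigcap_(i in [set i | i \in [set: I]%SET]) (X i @^-1` cell (g i))))).
      apply: le_measure; rewrite ?inE.
      - by apply: measurableI; first exact: measurableI (measurable_exceeds t) _.
      - apply: fin_bigcap_measurable; first exact: finite_finset.
        by move=> i _; apply: measurable_RV_preimage; exact: measurable_cell.
      - by move=> w' [_ gw'] i _; exact: gw'.
    rewrite X_indep; last by move=> i; exact: measurable_cell.
    rewrite (eq_bigr (fun i => (cell_prob s (g i))%:E)); last first.
      move=> i _; rewrite RV_normal; last exact: measurable_cell.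
      by rewrite /cell_prob fineK// fin_num_measure//; exact: measurable_cell.
    rewrite prodEFin lee_fin (eq_bigl xpredT); last by move=> i; rewrite inE.
    rewrite mulrAC ler_peMl//; first by apply: prodr_ge0 => i _; exact: cell_prob_ge0.
    rewrite expRN mulrC ler_pdivlMr ?expR_gt0// mul1r.
    rewrite /cell_ops /=; apply: le_trans (Phi_ge k0 _ th0 _ k).
    rewrite ler_expR ler_wpM2l ?mulr_ge0// lerBlDl.
    apply: le_trans tk _.
    have -> : n / M%:R = \sum_(i : I) M%:R^-1 by rewrite sumr_const mulr_natl.
    rewrite sum_ffunE (eq_bigl xpredT)// -big_split/=.
    apply: ler_sum => i _; rewrite ffunE -lerBlDr -mulrBl.
    apply: le_trans (ler_norm _) _; rewrite normrM -[leRHS]mulr1 ler_pM//.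
    by apply: cell_mark => //; exact: gw.
  rewrite (_ : _ `&` _ = set0); last by apply/seteqP; split=> w // Hw; apply: nex; exists w.
  by rewrite measure0 lee_fin !mulr_ge0 ?expR_ge0 ?F0// prodr_ge0// => i _; exact: cell_prob_ge0.
pose g' (j : 'I_(M * 2 * M)) i' := if i' == i then j else g i'.
apply: (@le_trans _ _ (\sum_j P (exceeds t `&` core `&` cells r (g' j)))%E).
  apply: measure_bigsetU_le.
- by apply: measurableI => //; exact: measurableI (measurable_exceeds t) _.
- by move=> j; apply: measurableI => //; exact: measurableI (measurable_exceeds t) _.
- move=> w [[tw cw] gw]; have [j cj] := cell_cover M0 (cw i).
  exists j; split=> // i' i'r; rewrite /g'; case: eqVneq => [->//|i'i].
  by apply: gw; rewrite inE (negbTE i'i).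
apply: le_trans (lee_sum _ (fun j _ => IH ur (g' j))) _.
rewrite sumEFin lee_fin /cell_op.
have notin i' : (i' \notin i :: r) = (i' \notin r) && (i' != i).
  by rewrite inE negb_or andbC.
rewrite mulr_sumr le_eqVlt; apply/orP; left; apply/eqP; apply: eq_bigr => j _.
have -> : \prod_(i' | i' \notin r) cell_prob s (g' j i') =
    cell_prob s j * \prod_(i' | i' \notin i :: r) cell_prob s (g i').
  rewrite (bigD1 i)//= {1}/g' eqxx (eq_bigl _ _ notin); congr (_ * _).
  by apply: eq_bigr => i' /andP[_ /negbTE ii']; rewrite /g' ii'.
have -> : \sum_(i' | i' \notin r) dil (@mark R M (g' j i')) (c i') =
    \sum_(i' | i' \notin i :: r) dil (@mark R M (g i')) (c i') + dil (@mark R M j) (c i).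
  rewrite (bigD1 i)//= {1}/g' eqxx (eq_bigl _ _ notin) addrC; congr (_ + _).
  by apply: eq_bigr => i' /andP[_ /negbTE ii']; rewrite /g' ii'.
by rewrite -!mulrA; congr (_ * _); rewrite mulrCA.
Qed.

End GaussianEvent.

Definition outside (R : realType) (M : nat) : set R := ~` `[- M%:R, M%:R[.

Lemma measurable_outside (R : realType) (M : nat) : measurable (@outside R M).
Proof. exact: measurableC. Qed.

(** Passes from signs grouped by matrix entry, as the transfer produces them, to rounds over all
    entries, as the comparison consumes them. *)
Lemma perm_flatten_nseq (A : Type) (T : eqType) (f : A -> T) (N : nat) (r : seq A) :
  perm_eq (flatten (map (fun i => nseq N (f i)) r)) (flatten (nseq N (map f r))).
Proof.
apply/seq.permP => a; rewrite !count_flatten map_nseq sumn_nseq -map_comp.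
elim: r => [|i r IH] /=; first by rewrite mul0n.
by rewrite IH count_nseq mulnDl.
Qed.


Section GaussianTail.
Variables (R : realType) (M : nat) (s : R).
Hypotheses (s0 : 0 < s).

(** Markov's inequality for exp z + exp (- z). *)
Lemma normal_prob_tail :
  (normal_prob 0 s (@outside R M) <= (2 * expR (s ^+ 2 / 2 - M%:R))%:E)%E.
Proof.
have mB : measurable (@outside R M) by exact: measurable_outside.
have s_neq0 : s != 0 by rewrite gt_eqF.
pose G (a z : R) := expR (a * (z - 0)).
have mG a : measurable_fun setT (G a).
  apply: measurableT_comp => //; apply: measurable_funM => //.
  exact: measurable_funB.
have G0 a z : 0 <= G a z by exact: expR_ge0.
rewrite normal_prob_gint//.
apply: (@le_trans _ _ (gint s (fun z => expR (- M%:R) * (G 1 z + G (- 1) z)) 0)).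
  apply: gint_le.
  - exact: measurable_indic.
  - by apply: measurable_funM => //; apply: measurable_funD.
  - by move=> z; rewrite indicE.
  move=> z; rewrite indicE /G subr0 mulN1r mul1r mulrDr -!expRD.
  have [|] := boolP (z \in _); last by rewrite addr_ge0 ?expR_ge0.
  rewrite inE /outside /= in_itv/= => /negP; rewrite negb_and -!ltNge -leNgt => /orP[h|h].
    apply: (@le_trans _ _ (expR (- M%:R - z))); last by rewrite lerDr expR_ge0.
    by rewrite -[leLHS]expR0 ler_expR; lra.
  apply: (@le_trans _ _ (expR (- M%:R + z))); last by rewrite lerDl expR_ge0.
  by rewrite -[leLHS]expR0 ler_expR; lra.
rewrite gintZ ?expR_ge0//; last 2 first.
- by apply: measurable_funD.
- by move=> z; rewrite addr_ge0.
rewrite gintD// !gint_expR// sqrrN expr1n mul1r -EFinD -EFinM lee_fin.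
by rewrite expRD le_eqVlt; apply/orP; left; apply/eqP; ring.
Qed.

End GaussianTail.

Section NetBound.
Variables (R : realType) (K : finType) (k0 : K).
Variables (dO : measure_display) (Omega : measurableType dO) (P : probability Omega R).
Variables (s : R) (I : finType) (X : I -> {RV P >-> R}).
Hypotheses (s0 : 0 < s).
Hypotheses (X_normal : forall i, normally_distributed (X i) 0 s).
Hypothesis (X_indep : mutually_independent X).
Variable (c : I -> {ffun K -> R}).
Hypothesis c1 : forall i k, `|c i k| <= 1.
Local Notation n := (#|I|%:R : R).

Lemma exceeds_le (beta th : R) (M : nat) t : 0 <= beta -> 0 <= th -> (0 < M)%N ->
  (P (exceeds X c t) <=
   (expR (- (th * beta * (t - n / M%:R))) * cell_ops M s c (enum I) (Phi beta th) 0
    + n * (2 * expR (s ^+ 2 / 2 - M%:R)))%:E)%E.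
Proof.
move=> beta0 th0 M0.
have J0 : (0 < M * 2 * M)%N by rewrite !muln_gt0 M0.
(* Every variable starts free, so the cells named by g are arbitrary. *)
pose g (i : I) := Ordinal J0.
have := cells_prob_le k0 beta0 th0 M0 X_normal X_indep c1 t (enum_uniq I) g.
rewrite [X in _ * X * _]big_pred0; last by move=> i; rewrite mem_enum.
rewrite [X in cell_ops _ _ _ _ _ X]big_pred0; last by move=> i; rewrite mem_enum.
rewrite mulr1; set A := _ `&` _ `&` _; set b := _ * cell_ops _ _ _ _ _ _ => Ab.
have mB i : measurable (X i @^-1` (@outside R M)).
  by apply: (measurable_RV_preimage X); exact: measurable_outside.
have mA : measurable A.
  apply: measurableI; first apply: measurableI (measurable_exceeds X c t) _.
    apply: measurable_forall_fin => i.
    have := measurable_RV_preimage X i (measurable_itv `[- (M%:R : R), M%:R[).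
    by congr measurable; apply/seteqP; split=> w /=; rewrite in_itv.
  rewrite (_ : mkset _ = setT)//; apply/seteqP; split=> // w _ i.
  by rewrite mem_enum.
pose B := \big[setU/set0]_i (X i @^-1` (@outside R M)).
have mBB : measurable B by apply: bigsetU_measurable.
apply: (@le_trans _ _ (P (A `|` B))).
  apply: le_measure; rewrite ?inE; [exact: measurable_exceeds|exact: measurableU|].
  move=> w tw; have [[i iw]|H] := pselect (exists i, (X i @^-1` (@outside R M)) w).
    by right; rewrite /B (bigD1 i)//=; left.
  left; split; last by move=> i; rewrite mem_enum.
  split=> // i; apply/negPn/negP => Hi; apply: H; exists i => /=.
  by rewrite /outside /= in_itv/=; exact/negP.
apply: le_trans (measureU2 _ mA mBB) _; rewrite EFinD leeD//.
apply: (@le_trans _ _ (\sum_i P (X i @^-1` (@outside R M)))%E).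
  apply: measure_bigsetU_le => // w; rewrite /B.
  elim: (index_enum I) => [|i r IH]; first by rewrite big_nil.
  by rewrite big_cons => -[Hi|/IH//]; exists i.
apply: (@le_trans _ _ (\sum_(i : I) (2 * expR (s ^+ 2 / 2 - M%:R))%:E)%E).
  apply: lee_sum => i _; rewrite (RV_normal X_normal); last exact: measurable_outside.
  exact: normal_prob_tail.
by rewrite sumEFin lee_fin sumr_const [leRHS]mulr_natl.
Qed.

Lemma transferred_ops_le (beta th : R) : 0 <= beta -> 0 <= th -> th <= 1 ->
  exists C h0 : R, [/\ 0 <= C, 0 < h0 & forall N h M, (0 < M)%N ->
    0 < h <= h0 -> h ^+ 2 * N.+1%:R = s ^+ 2 ->
    cell_ops M s c (enum I) (Phi beta th) 0 <=
    expR (n * (th * beta / M%:R + C * h ^+ 3 * N.+1%:R)) *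
    avgs (flatten (nseq N.+1 (map (dil h) (map c (enum I))))) (Phi beta th) 0].
Proof.
move=> beta0 th0 th1.
have [C [h0 [C0 h00 H]]] := transfer_iter k0 beta0 th0 th1.
exists C, h0; split=> // N h M M0 hh hN; have [hp _] := andP hh.
have Ch : 0 <= C * h ^+ 3 by rewrite mulr_ge0// exprn_ge0// ltW.
have sE : Num.sqrt N.+1%:R * h = s.
  apply/eqP; rewrite -(@eqrXn2 _ 2) ?mulr_ge0 ?sqrtr_ge0 ?(ltW hp) ?(ltW s0)//.
  by rewrite exprMn sqr_sqrtr ?ler0n// mulrC hN.
pose rho := expR (th * beta / M%:R + C * h ^+ 3 * N.+1%:R).
apply: (@le_trans _ _ (rho ^+ size (enum I) *
    avgs (flatten (map (fun i => nseq N.+1 (dil h (c i))) (enum I))) (Phi beta th) 0)).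
  apply: cell_ops_le; first exact: expR_ge0.
  move=> i L; rewrite -lee_fin.
  apply: le_trans (cell_op_le_gint k0 beta0 th0 s M0 L (c1 i)) _.
  have := H h hh (c i) (c1 i) L N; rewrite sE => HH.
  apply: le_trans (lee_wpmul2l _ HH) _; first by rewrite lee_fin expR_ge0.
  rewrite -EFinM lee_fin mulrA ler_wpM2r//.
    by apply: avgs_ge0 => L'; exact: expR_ge0.
  rewrite /rho expRD ler_wpM2l ?expR_ge0// expRM_natr.
  by rewrite lerXn2r ?nnegrE ?expR_ge0 ?addr_ge0// expR_ge1Dx.
rewrite -cardE expRM_natl le_eqVlt; apply/orP; left; apply/eqP; congr (_ * _).
congr (_ 0); apply: avgs_perm.
by rewrite -map_comp; exact: perm_flatten_nseq.
Qed.

End NetBound.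

Lemma le_expR_limit (R : realType) (b a : R) :
  (forall e, 0 < e -> e <= 1 / 2 -> b <= expR (a + e) + e) -> b <= expR a.
Proof.
move=> H; apply/ler_addgt0Pr => d d0; have a0 := expR_gt0 a.
pose D := 2 * expR a + 1; have D0 : 0 < D by rewrite /D; lra.
pose e := Num.min (1 / 2) (d / D).
have e0 : 0 < e by rewrite lt_min divr_gt0//= divr_gt0.
have e1 : e <= 1 / 2 by rewrite ge_min lexx.
have eD : e * D <= d by rewrite -ler_pdivlMr// ge_min lexx orbT.
apply: le_trans (H e e0 e1) _; rewrite expRD.
have : expR a * expR e <= expR a * (1 + e + 2 * e ^+ 2).
  by rewrite ler_pM2l// expR_le_quad// ltW.
have : 0 <= expR a * e * (1 - 2 * e).
  by apply: mulr_ge0; [rewrite mulr_ge0// ltW|lra].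
by rewrite /D in eD; nra.
Qed.

Section GaussianNorm.
Variables (R : realType) (m n : nat) (m0 : (0 < m)%N) (n0 : (0 < n)%N).
Variables (dO : measure_display) (Omega : measurableType dO) (P : probability Omega R).
Variables (s : R) (X : 'I_m * 'I_n -> {RV P >-> R}).
Hypotheses (s0 : 0 < s).
Hypotheses (X_normal : forall i, normally_distributed (X i) 0 s).
Hypothesis (X_indep : mutually_independent X).
Variables (K : finType) (u : K -> 'I_m -> R) (v : K -> 'I_n -> R).
Hypotheses (u1 : forall k, \sum_i u k i ^+ 2 = 1) (v1 : forall k, \sum_j v k j ^+ 2 = 1).

Lemma small_step (e : R) : 0 < e -> exists N h, [/\ 0 < h, h <= e & h ^+ 2 * N.+1%:R = s ^+ 2].
Proof.
move=> e0; pose N := Num.truncn ((s / e) ^+ 2).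
have N0 : 0 < N.+1%:R :> R by rewrite ltr0n.
have q0 : 0 < Num.sqrt N.+1%:R :> R by rewrite sqrtr_gt0.
exists N, (s / Num.sqrt N.+1%:R); split; first by rewrite divr_gt0.
  rewrite ler_pdivrMr// mulrC -ler_pdivrMr//.
  rewrite -(@ler_pXn2r _ 2) ?nnegrE ?divr_ge0 ?ltW// sqr_sqrtr ?ler0n//.
  exact: Num.Theory.truncnS_gt.
by rewrite exprMn exprVn sqr_sqrtr ?ler0n// mulfVK// gt_eqF.
Qed.

(** All parameters are chosen for a given error e: [th] for the cost #|K|^th, h for the accumulated
    cubic errors, M for the cells and the tails. The first two and the cells each cost at most e / 4
    in the exponent, and the tails add at most e. *)
Lemma exceeds_bilin_le (l t : R) : 0 < l ->
  (P (exceeds X (bilin_dir u v) t) <=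
   (expR (- (l * t) + l * s * (Num.sqrt m%:R + Num.sqrt n%:R) + (l * s) ^+ 2 / 2))%:E)%E.
Proof.
move=> l0.
have [k0 _|K0] := pickP (fun _ : K => true); last first.
  rewrite (_ : exceeds _ _ _ = set0) ?measure0 ?lee_fin ?expR_ge0//.
  by apply/seteqP; split=> // w [k]; have := K0 k.
set E := exceeds _ _ _; set a := _ + _ + _.
have mE : measurable E by exact: measurable_exceeds.
rewrite -(fineK (fin_num_measure P E mE)) lee_fin.
apply: le_expR_limit => e e0 e1.
have c1 c k : `|bilin_dir u v c k| <= 1.
  by rewrite ffunE normrM mulr_ile1// entry_le1.
set q : R := #|{: 'I_m * 'I_n}|%:R.
have q0 : 0 <= q by exact: ler0n.
pose lc := ln (#|K|%:R : R).
have lc0 : 0 <= lc by rewrite ln_ge0// ler1n; apply/card_gt0P; exists k0.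
(* The summand 1 keeps the denominator positive when there is a single vector and [lc] is 0. *)
pose th := e / (4 * (lc + 1)).
have th0 : 0 < th by rewrite divr_gt0// mulr_gt0//; lra.
have th1 : th <= 1 by rewrite ler_pdivrMr ?mul1r; lra.
have thK : th * lc <= e / 4.
  have -> : th * lc = e / 4 * (lc / (lc + 1)) by rewrite /th; field; lra.
  by rewrite ler_piMr ?divr_ge0 ?ltW// ltr_pdivrMr ?mul1r; lra.
pose beta := l / th; have beta0 : 0 < beta by rewrite divr_gt0.
have thb : th * beta = l by rewrite /beta mulrC divfK// gt_eqF.
have [C1 [h1 [C10 h10 H1]]] := transferred_ops_le k0 s0 c1 (ltW beta0) (ltW th0) th1.
have [C2 [h2 [C20 h20 H2]]] := chevet_discrete k0 u1 v1 beta0 th0 th1.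
(* Multiplied by h, this is the sum of all errors over the s^2 / h^2 rounds: q C1 for the transfer
   of q entries, C2 for the comparison, l^4 / 2 for the term 2 y^2 in the bound on ln (1 + y). *)
pose G := s ^+ 2 * (q * C1 + C2 + l ^+ 4 / 2).
have G0 : 0 <= G by rewrite mulr_ge0 ?sqr_ge0// !addr_ge0 ?mulr_ge0 ?exprn_ge0 ?(ltW l0)// invr_ge0.
pose h3 := Num.min (Num.min h1 h2) (Num.min 1 (e / (4 * (G + 1)))).
have h30 : 0 < h3 by rewrite !lt_min h10 h20 ltr01/= divr_gt0// mulr_gt0//; lra.
have [N [h [h0 hh3 hN]]] := small_step h30.
have [hh1 hh2 hh4 hh5] : [/\ h <= h1, h <= h2, h <= 1 & h <= e / (4 * (G + 1))].
  by move: hh3; rewrite !le_min => /andP[/andP[-> ->] /andP[-> ->]].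
have hG : G * h <= e / 4.
  have := ler_wpM2l G0 hh5; have -> : G * (e / (4 * (G + 1))) = e / 4 * (G / (G + 1)).
    by field; lra.
  move=> /le_trans; apply.
  by rewrite ler_piMr ?divr_ge0 ?ltW// ltr_pdivrMr ?mul1r; lra.
(* One summand for the tails and one for the cell width. The latter is charged twice, in Markov's
   inequality and in the passage from cells to integrals, whence the 8. *)
pose Z := 2 * q * expR (s ^+ 2 / 2) / e + 8 * (l * q) / e + 1.
pose M := (Num.truncn Z).+1.
have z1 : 0 <= 2 * q * expR (s ^+ 2 / 2) / e.
  by rewrite divr_ge0 ?(ltW e0)// mulr_ge0 ?expR_ge0// mulr_ge0.
have z2 : 0 <= 8 * (l * q) / e.
  by rewrite divr_ge0 ?(ltW e0)// !mulr_ge0// ltW.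
have Z0 : 0 < Z by rewrite /Z; lra.
have ZM : Z < M%:R by exact: Num.Theory.truncnS_gt.
have M0 : 0 < M%:R :> R by exact: lt_trans ZM.
have tM1 : q * (2 * expR (s ^+ 2 / 2 - M%:R)) <= e.
  rewrite expRD expRN.
  have : 2 * q * expR (s ^+ 2 / 2) / e <= expR M%:R.
    apply: le_trans (expR_ge1Dx _).
    by move: ZM; rewrite /Z; lra.
  rewrite ler_pdivrMr// => hE.
  have -> : q * (2 * (expR (s ^+ 2 / 2) / expR M%:R)) =
     2 * q * expR (s ^+ 2 / 2) / expR M%:R by ring.
  by rewrite ler_pdivrMr ?expR_gt0// [leRHS]mulrC.
have tM2 : 2 * (l * q / M%:R) <= e / 4.
  have : 8 * (l * q) / e <= M%:R by move: ZM; rewrite /Z; lra.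
  rewrite ler_pdivrMr// => hE; rewrite mulrA ler_pdivrMr//; lra.
rewrite -lee_fin fineK; last exact: fin_num_measure.
apply: le_trans (exceeds_le k0 s0 X_normal X_indep c1 t
  (ltW beta0) (ltW th0) (ltn0Sn _ : (0 < M)%N)) _.
rewrite lee_fin lerD// thb -/q.
have /= ops := H1 N h M (ltn0Sn _); rewrite h0 hh1 /= in ops.
apply: le_trans (ler_wpM2l (expR_ge0 _) (ops isT hN)) _.
rewrite -/q mulrA -expRD.
have := H2 h; rewrite h0 hh2 => /(_ isT N.+1 0).
have := avgs_lin_le k0 m0 n0 u1 v1 beta0 th0 s0 hN.
rewrite thb -/lc.
set B := avgs _ _ _; set A := avgs _ _ _ => hB hAB.
pose y := l ^+ 2 / 2 * h ^+ 2.
have y0 : 0 <= y by rewrite mulr_ge0 ?divr_ge0 ?sqr_ge0.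
(* The gain of the comparison: y * (N + 1) = (l s)^2 / 2, which brings the (l s)^2 of [avgs_lin_le]
   down to one half. *)
have gam : expR ((y - 2 * y ^+ 2) * N.+1%:R) <= (1 + y) ^+ N.+1.
  rewrite expRM_natr lerXn2r ?nnegrE ?expR_ge0 ?addr_ge0//.
  have y1 : 0 < 1 + y by lra.
  by rewrite -[1 + y]lnK ?posrE// ler_expR ln_ge_quad//; lra.
have rho : (1 + C2 * h ^+ 3) ^+ N.+1 <= expR (C2 * h ^+ 3 * N.+1%:R).
  rewrite expRM_natr lerXn2r ?nnegrE ?expR_ge0 ?expR_ge1Dx//.
  by rewrite addr_ge0// mulr_ge0// exprn_ge0// ltW.
have hA : A <= expR (C2 * h ^+ 3 * N.+1%:R - (y - 2 * y ^+ 2) * N.+1%:R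
    + (th * lc + l * s * (Num.sqrt m%:R + Num.sqrt n%:R) + (l * s) ^+ 2)).
  rewrite expRD expRB mulrAC ler_pdivlMr ?expR_gt0//.
  apply: (@le_trans _ _ (A * (1 + y) ^+ N.+1)).
    rewrite ler_wpM2l//.
    by apply: avgs_ge0 => L; exact: expR_ge0.
  rewrite mulrC; apply: le_trans hAB _.
  apply: ler_pM => //; last by apply: avgs_ge0 => L; exact: expR_ge0.
  by rewrite exprn_ge0// addr_ge0// mulr_ge0// exprn_ge0// ltW.
apply: le_trans (ler_wpM2l (expR_ge0 _) hA) _.
rewrite -expRD ler_expR /a.
have hN3 : h ^+ 3 * N.+1%:R = s ^+ 2 * h by rewrite -hN; ring.
have yN : y * N.+1%:R = (l * s) ^+ 2 / 2 by rewrite /y -mulrA hN; field.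
have y2N : y ^+ 2 * N.+1%:R <= s ^+ 2 * (l ^+ 4 / 4) * h.
  have -> : y ^+ 2 * N.+1%:R = s ^+ 2 * (l ^+ 4 / 4) * h ^+ 2.
    by rewrite -hN /y; field.
  apply: ler_wpM2l; last by rewrite expr2 ler_piMl// ltW.
  by rewrite mulr_ge0 ?sqr_ge0// divr_ge0// exprn_ge0// ltW.
have e1' : C2 * h ^+ 3 * N.+1%:R = s ^+ 2 * C2 * h by rewrite -mulrA hN3; ring.
have e2' : q * (l / M%:R + C1 * h ^+ 3 * N.+1%:R) = l * q / M%:R + s ^+ 2 * (q * C1) * h.
  by rewrite mulrDr -(mulrA C1) hN3; ring.
rewrite mulrBl -(mulrA 2) yN e1' e2'.
have -> : - (l * (t - q / M%:R)) = - (l * t) + l * q / M%:R by ring.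
have hG' : s ^+ 2 * (q * C1) * h + s ^+ 2 * C2 * h + s ^+ 2 * (l ^+ 4 / 2) * h <= e / 4.
  by rewrite -!mulrDl -!mulrDr.
lra.
Qed.

End GaussianNorm.

(** * Gaussian operator norm *)

Lemma cvg_fsum (R : realType) (I : Type) (r : seq I) (f : I -> R^nat) (l : I -> R) :
  (forall i, f i x @[x --> \oo] --> l i) ->
  (\sum_(i <- r) f i x) @[x --> \oo] --> \sum_(i <- r) l i.
Proof.
move=> fl; elim: r => [|i r IH].
  by rewrite big_nil; under eq_fun do rewrite big_nil; exact: cvg_cst.
rewrite big_cons; under eq_fun do rewrite big_cons.
by apply: cvgD.
Qed.

Lemma rat_approx (R : realType) (I : Type) (a : I -> R) :
  exists q : nat -> I -> rat, forall i, ratr (q N i) @[N --> \oo] --> a i.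
Proof.
have H (p : nat * I) : exists q : rat, `|a p.2 - ratr q| < p.1.+1%:R^-1.
  have : 0 < p.1.+1%:R^-1 :> R by rewrite invr_gt0 ltr0n.
  move: (_^-1) => d d0.
  have [|q] := @rat_in_itvoo R (a p.2 - d) (a p.2 + d); first lra.
  rewrite in_itv/= => /andP[h1 h2]; exists q; rewrite ltr_norml.
  by apply/andP; split; lra.
have [q qP] := choice H.
exists (fun N i => q (N, i)) => i; apply/cvgrPdist_lt => e e0; near=> N.
apply: lt_trans (qP (N, i)) _ => /=.
by near: N; apply: near_infty_natSinv_lt (PosNum e0).
Unshelve. all: by end_near. Qed.

Section OperatorBound.
Variables (R : realType) (m n : nat).
Implicit Types (a : 'I_m -> R) (b : 'I_n -> R) (E : 'I_m -> 'I_n -> R).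

Definition vnorm (I : finType) (a : I -> R) := Num.sqrt (\sum_i a i ^+ 2).

Definition form E a b := \sum_i \sum_j E i j * (a i * b j).

(* One-sided suffices, since [a] may be replaced by its opposite. *)
Definition opbound E (t : R) := forall a b, form E a b <= t * (vnorm a * vnorm b).

Lemma opbound_rat E t : (forall (a : {ffun 'I_m -> rat}) (b : {ffun 'I_n -> rat}),
    form E (fun i => ratr (a i)) (fun j => ratr (b j)) <=
    t * (vnorm (fun i => ratr (a i) : R) * vnorm (fun j => ratr (b j) : R))) ->
  opbound E t.
Proof.
move=> H a b; have [p pa] := rat_approx a; have [q qb] := rat_approx b.
have cvgsq (I : finType) (x : nat -> I -> rat) (y : I -> R) :
    (forall i, ratr (x N i) @[N --> \oo] --> y i) ->
    vnorm (fun i => ratr (x N i)) @[N --> \oo] --> vnorm y.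
  move=> xy; apply: (cvg_comp _ Num.sqrt); last exact: sqrt_continuous.
  by apply: cvg_fsum => i; apply: cvgM; exact: xy.
apply: (@ler_cvg_to nat \oo _ _ (fun N => form E (fun i => ratr (p N i)) (fun j => ratr (q N j)))
  (fun N => t * (vnorm (fun i => ratr (p N i) : R) * vnorm (fun j => ratr (q N j) : R)))).
- apply: cvg_fsum => i; apply: cvg_fsum => j; apply: cvgM; first exact: cvg_cst.
  by apply: cvgM; [exact: pa|exact: qb].
- apply: cvgM; first exact: cvg_cst.
  by apply: cvgM; exact: cvgsq.
near=> N; have := H [ffun i => p N i] [ffun j => q N j].
rewrite /form /vnorm.
under eq_bigr do (under eq_bigr do rewrite !ffunE).
under [X in _ <= _ * (Num.sqrt X * _)]eq_bigr do rewrite ffunE.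
by under [X in _ <= _ * (_ * Num.sqrt X)]eq_bigr do rewrite ffunE.
Unshelve. all: by end_near. Qed.

(** The zero vector is sent to a basis vector, so that every term of an enumeration of rational
    vectors gives a unit vector, as [exceeds_bilin_le] demands. *)
Definition unitize (I : finType) (i0 : I) (a : I -> R) : I -> R :=
  if \sum_i a i ^+ 2 == 0 then (fun i => (i == i0)%:R) else (fun i => a i / vnorm a).

Lemma vnorm_ge0 (I : finType) (a : I -> R) : 0 <= vnorm a.
Proof. exact: sqrtr_ge0. Qed.

Lemma unitizeP (I : finType) (i0 : I) (a : I -> R) : \sum_i unitize i0 a i ^+ 2 = 1.
Proof.
rewrite /unitize; case: eqP => [_|/eqP a0].
  rewrite (bigD1 i0)//= eqxx expr1n big1 ?addr0// => i /negbTE ->.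
  by rewrite expr0n.
have s0 : 0 <= \sum_i a i ^+ 2 by apply: sumr_ge0 => i _; exact: sqr_ge0.
under eq_bigr do rewrite exprMn exprVn sqr_sqrtr//.
by rewrite -mulr_suml divff.
Qed.

Lemma unitizeE (I : finType) (i0 : I) (a : I -> R) i : a i = vnorm a * unitize i0 a i.
Proof.
rewrite /unitize; case: eqP => [a0|/eqP a0].
  rewrite /vnorm a0 sqrtr0 mul0r.
  have : a i ^+ 2 <= 0.
    by rewrite -a0 (bigD1 i)//= lerDl sumr_ge0// => j _; exact: sqr_ge0.
  by rewrite le_eqVlt ltNge sqr_ge0 orbF sqrf_eq0 => /eqP.
rewrite mulrC divfK// gt_eqF// sqrtr_gt0 lt_neqAle eq_sym a0.
by apply: sumr_ge0 => j _; exact: sqr_ge0.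
Qed.

End OperatorBound.

Section GaussianOperator.
Variables (R : realType) (m n : nat) (m0 : (0 < m)%N) (n0 : (0 < n)%N).
Variables (dO : measure_display) (Omega : measurableType dO) (P : probability Omega R).
Variables (s : R) (X : 'I_m * 'I_n -> {RV P >-> R}).
Hypotheses (s0 : 0 < s).
Hypotheses (X_normal : forall i, normally_distributed (X i) 0 s).
Hypothesis (X_indep : mutually_independent X).

(** Rational directions are enumerated; the events for the first N of them increase with N and share
    one bound, which their union inherits by continuity of the measure. *)
Lemma gaussian_opbound (tau : R) : 0 < tau ->
  exists U : set Omega, [/\ measurable U,
    (P U <= (expR (- (tau ^+ 2 / 2)))%:E)%E &
    forall w, ~ U w -> opbound (fun i j => X (i, j) w)
      (s * (Num.sqrt m%:R + Num.sqrt n%:R + tau))].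
Proof.
move=> tau0; set t := s * _.
pose T : countType := ({ffun 'I_m -> rat} * {ffun 'I_n -> rat})%type.
pose pt (k : nat) : T := odflt ([ffun=> 0], [ffun=> 0]) (@unpickle T k).
pose u (k : nat) : 'I_m -> R := unitize (Ordinal m0) (fun i => ratr ((pt k).1 i)).
pose v (k : nat) : 'I_n -> R := unitize (Ordinal n0) (fun i => ratr ((pt k).2 i)).
pose F (N : nat) := exceeds X (bilin_dir (fun k : 'I_N => u k) (fun k : 'I_N => v k)) t.
have mF N : measurable (F N) by exact: measurable_exceeds.
have FP N : (P (F N) <= (expR (- (tau ^+ 2 / 2)))%:E)%E.
  (* The choice l = tau / s minimises - l s tau + (l s)^2 / 2. *)
  apply: le_trans (@exceeds_bilin_le R m n m0 n0 _ _ P s X s0 X_normal X_indep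
    _ (fun k : 'I_N => u k) (fun k : 'I_N => v k) (fun k => unitizeP _ _)
    (fun k => unitizeP _ _) (tau / s) t (divr_gt0 tau0 s0)) _.
  rewrite lee_fin ler_expR le_eqVlt; apply/orP; left; apply/eqP; rewrite /t.
  by field; rewrite gt_eqF.
have mU : measurable (\bigcup_N F N) by exact: bigcup_measurable.
exists (\bigcup_N F N); split=> //.
  have ndF : {homo F : N N' / (N <= N')%N >-> (N <= N')%O}.
    move=> N N' NN'; apply/subsetPset => w [k tk]; exists (widen_ord NN' k).
    by apply: le_trans tk _; apply: ler_sum => i _; rewrite !ffunE.
  have cF := @nondecreasing_cvg_mu _ _ _ P F mF mU ndF.
  rewrite -(cvg_lim _ cF)//; apply: lime_le; first by apply/cvg_ex; eexists; exact: cF.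
  by near=> N; exact: FP.
move=> w Uw; apply: opbound_rat => a b.
set a' := fun i => ratr (a i); set b' := fun i => ratr (b i).
(* The successor makes the code of (a, b) the last index of the family. *)
have Fw : ~ F (pickle ((a, b) : T)).+1 w by move=> H; apply: Uw; eexists; [exact: I|exact: H].
have uE : u (pickle ((a, b) : T)) = unitize (Ordinal m0) a' by rewrite /u /pt pickleK.
have vE : v (pickle ((a, b) : T)) = unitize (Ordinal n0) b' by rewrite /v /pt pickleK.
have le_t : form (fun i j => X (i, j) w) (unitize (Ordinal m0) a') (unitize (Ordinal n0) b') <= t.
  rewrite leNgt; apply/negP => /ltW ht; apply: Fw; exists ord_max.
  apply: le_trans ht _; rewrite /form pair_bigA/=; apply: ler_sum => -[i j] _ /=.
  by rewrite ffunE /= uE vE.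
have -> : form (fun i j => X (i, j) w) a' b' =
    vnorm a' * vnorm b' *
    form (fun i j => X (i, j) w) (unitize (Ordinal m0) a') (unitize (Ordinal n0) b').
  rewrite /form mulr_sumr; apply: eq_bigr => i _; rewrite mulr_sumr; apply: eq_bigr => j _.
  by rewrite {1}(unitizeE (Ordinal m0) a' i) {1}(unitizeE (Ordinal n0) b' j); ring.
by rewrite mulrC ler_wpM2r// mulr_ge0// vnorm_ge0.
Unshelve. all: by end_near. Qed.

End GaussianOperator.

(** * Singular values *)

Section SingularValues.
Local Open Scope complex_scope.
Local Open Scope sesquilinear_scope.
Variable R : realType.
Local Notation C := R[i].
Local Notation cplx := (map_mx (real_complex R)).

Definition nq (z : C) : R := complex.Re z ^+ 2 + complex.Im z ^+ 2.

Lemma nq_ge0 z : 0 <= nq z. Proof. by rewrite addr_ge0 ?sqr_ge0. Qed.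

Lemma nqE z : (nq z)%:C = z * Num.conj z.
Proof. by rewrite /nq add_Re2_Im2 normCK. Qed.

Definition sqn n (x : 'rV[C]_n) : R := \sum_j nq (x 0 j).

Lemma sqn_ge0 n (x : 'rV[C]_n) : 0 <= sqn x.
Proof. by apply: sumr_ge0 => j _; exact: nq_ge0. Qed.

Lemma sqn_gt0 n (x : 'rV[C]_n) : x != 0 -> 0 < sqn x.
Proof.
move=> x0; rewrite lt_neqAle sqn_ge0 andbT eq_sym; apply: contra x0 => /eqP N0.
apply/eqP/rowP => j; rewrite mxE.
have /eqP : nq (x 0 j) = 0.
  apply/eqP; rewrite eq_le nq_ge0 andbT -N0 /sqn (bigD1 j)//= lerDl.
  by apply: sumr_ge0 => i _; exact: nq_ge0.
rewrite /nq paddr_eq0 ?sqr_ge0// !sqrf_eq0 => /andP[/eqP a0 /eqP b0].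
by apply/eqP; rewrite eq_complex a0 b0 !eqxx.
Qed.

Lemma sqnE n (x : 'rV[C]_n) : (sqn x)%:C = (x *m x^t*) 0 0.
Proof.
rewrite /sqn rmorph_sum/= mxE; apply: eq_bigr => j _.
by rewrite !mxE -nqE.
Qed.

Lemma cplx_adj m n (M : 'M[R]_(m, n)) : (cplx M)^t* = cplx M^T.
Proof.
apply/matrixP => i j; rewrite !mxE; apply/eqP.
by rewrite -[Num.conj _]/(conjc _) conjc_real.
Qed.

(** Diagonalising the Hermitian matrix M M^T makes the squared norm of x M a weighted sum of squared
    coordinates; the later variational arguments use only this. *)
Lemma spectral_coords n1 n2 (M : 'M[R]_(n1, n2)) :
  exists (Q : 'M[C]_n1) (e : 'I_n1 -> R),
  [/\ forall x, sqn (x *m Q) = sqn x, forall i, 0 <= e i,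
      forall x, sqn (x *m cplx M) = \sum_i e i * nq ((x *m Q) 0 i) &
      singular_values M = sort (fun a b => b <= a) [seq Num.sqrt (e i) | i : 'I_n1]].
Proof.
pose A := cplx (M *m M^T); pose U := spectralmx A; pose ev := spectral_diag A.
have AE : A = cplx M *m (cplx M)^t* by rewrite /A map_mxM/= cplx_adj.
have A_normal : A \is normalmx.
  apply/normalmxP; rewrite cplx_adj trmx_mul trmxK.
  by [].
have UA : A = U^t* *m diag_mx ev *m U.
  have /orthomx_spectralP := A_normal.
  by rewrite invmx_unitary ?spectral_unitarymx.
have UU : U *m U^t* = 1%:M by apply/unitarymxP; exact: spectral_unitarymx.
have UU' : U^t* *m U = 1%:M by exact: mulmx1C.
pose Q := U^t*.
have QE x : sqn (x *m Q) = sqn x.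
  apply: (@complexI R); rewrite !sqnE /Q !trmx_mul !map_mxM trmxCK mulmxA.
  by rewrite -(mulmxA x) UU' mulmx1.
have ME x : (sqn (x *m cplx M))%:C = \sum_i ev 0 i * (nq ((x *m Q) 0 i))%:C.
  rewrite sqnE trmx_mul map_mxM mulmxA -(mulmxA x) -AE UA !mulmxA -mulmxA.
  rewrite -[U *m _]/(U *m x^t*).
  have -> : U *m x^t* = (x *m Q)^t* by rewrite /Q trmx_mul map_mxM trmxCK.
  rewrite -/Q; set y := x *m Q; rewrite mxE; apply: eq_bigr => i _.
  rewrite mul_mx_diag nqE; have -> : (y^t*) i 0 = Num.conj (y 0 i).
    by move: (y) => z; rewrite !mxE.
  by rewrite [X in X * _]mxE mulrCA mulrA.
(* Evaluating the identity at an eigenvector shows that its eigenvalue is a squared norm, hence real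
   and nonnegative. *)
have evE i : ev 0 i = (sqn (row i U *m cplx M))%:C.
  rewrite ME (bigD1 i)//= big1 => [|j ji].
    by rewrite addr0 -row_mul /Q UU !mxE eqxx nqE conjC1 !mulr1.
  by rewrite -row_mul /Q UU !mxE eq_sym (negbTE ji) nqE mul0r mulr0.
exists Q, (fun i => complex.Re (ev 0 i)); split=> //.
- by move=> i; rewrite evE; exact: sqn_ge0.
- move=> x; apply: (@complexI R); rewrite ME rmorph_sum; apply: eq_bigr => i _.
  by rewrite rmorphM /= evE.
Qed.

Lemma sorted_ge_nth (s : seq R) : sorted (fun a b => b <= a) s ->
  {in [pred i | (i < size s)%N] &, {homo nth 0 s : i j / (i <= j)%N >-> j <= i}}.
Proof.
apply: sorted_leq_nth; last by move=> a; exact: lexx.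
by move=> a b c ab bc; exact: le_trans bc ab.
Qed.

Lemma count_sorted_lt (s : seq R) (k : nat) : (k < size s)%N ->
  sorted (fun a b => b <= a) s -> (count (fun x => (x < nth 0 s k)%R) s <= size s - k.+1)%N.
Proof.
move=> ks ss; rewrite -{2}(cat_take_drop k.+1 s) count_cat.
rewrite (_ : count _ (take _ _) = 0%N) ?add0n.
  by rewrite (leq_trans (count_size _ _))// size_drop.
apply/eqP; rewrite -leqn0 leqNgt -has_count; apply/hasPn => x /(nthP 0)[j].
rewrite size_takel// => jk <-; rewrite nth_take// -leNgt.
by apply: (sorted_ge_nth ss) => //; rewrite inE (leq_trans jk).
Qed.

Lemma count_sorted_gt (s : seq R) (k : nat) : (k < size s)%N ->
  sorted (fun a b => b <= a) s -> (count (fun x => (nth 0 s k < x)%R) s <= k)%N.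
Proof.
move=> ks ss; rewrite -{2}(cat_take_drop k s) count_cat.
rewrite (_ : count _ (drop _ _) = 0%N) ?addn0.
  by rewrite (leq_trans (count_size _ _))// size_takel// ltnW.
apply/eqP; rewrite -leqn0 leqNgt -has_count; apply/hasPn => x /(nthP 0)[j].
rewrite size_drop => jk <-; rewrite nth_drop -leNgt.
by apply: (sorted_ge_nth ss); rewrite ?inE ?leq_addr// -ltn_subRL.
Qed.

(** Strict inequalities on both sides keep the two counts valid when the k-th value is repeated. *)
Lemma singular_value_counts n1 n2 (M : 'M[R]_(n1, n2)) (e : 'I_n1 -> R) k :
  (0 < k <= n1)%N ->
  singular_values M = sort (fun a b => b <= a) [seq Num.sqrt (e i) | i : 'I_n1] ->
  (#|[set i | (Num.sqrt (e i) < singular_value k M)%R]%SET| <= n1 - k)%N /\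
  (#|[set i | (singular_value k M < Num.sqrt (e i))%R]%SET| < k)%N.
Proof.
move=> /andP[k0 kn] sE; rewrite /singular_value sE; set s := sort _ _.
have szs : size s = n1 by rewrite size_sort size_map size_enum_ord.
have ss : sorted (fun a b => b <= a) s.
  by apply: sort_sorted => a b; exact: le_total.
have ks : (k.-1 < size s)%N by rewrite szs prednK.
have cE (a : pred R) : #|[set i | a (Num.sqrt (e i))]%SET| = count a s.
  rewrite /s; have /seq.permP -> := permEl (perm_sort (fun a b : R => b <= a)
    [seq Num.sqrt (e i) | i : 'I_n1]).
  rewrite count_map -size_filter cardE; congr size.
  by rewrite /enum_mem -filter_predI; apply: eq_filter => i /=; rewrite inE andbT.
rewrite (cE (fun x => x < _)) (cE (fun x => _ < x)); split.
  by have := count_sorted_lt ks ss; rewrite szs prednK.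
by rewrite -(ltn_predK k0) ltnS; exact: count_sorted_gt.
Qed.

Lemma singular_value_oversize n1 n2 (M : 'M[R]_(n1, n2)) k : (n1 < k)%N ->
  singular_value k M = 0.
Proof.
move=> nk; rewrite /singular_value nth_default//.
rewrite size_sort size_map size_enum_ord -ltnS prednK//.
exact: leq_ltn_trans nk.
Qed.

Lemma singular_value_ge0 n1 n2 (M : 'M[R]_(n1, n2)) k : 0 <= singular_value k M.
Proof.
rewrite /singular_value; have [kn|kn] := ltnP k.-1 (size (singular_values M)); last first.
  by rewrite nth_default.
have := mem_nth 0 kn; rewrite mem_sort => /mapP[i _ ->]; exact: sqrtr_ge0.
Qed.

Lemma exists_kernel_vector n p (B : 'M[C]_(n, p)) : (p < n)%N ->
  exists2 x : 'rV[C]_n, x != 0 & x *m B = 0.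
Proof.
move=> pn; have : kermx B != 0.
  by rewrite kermx_eq0 /row_free neq_ltn (leq_ltn_trans (rank_leq_col B)).
move=> /rowV0Pn[x xB x0]; exists x => //; exact/sub_kermxP.
Qed.

Definition coords n (Q : 'M[C]_n) (S : {set 'I_n}) : 'M[C]_(n, #|S|) :=
  colsub (fun j : 'I_#|S| => enum_val j) Q.

Lemma coordsP n (Q : 'M[C]_n) (S : {set 'I_n}) (x : 'rV[C]_n) i :
  x *m coords Q S = 0 -> i \in S -> (x *m Q) 0 i = 0.
Proof.
move=> xS iS; transitivity ((x *m coords Q S) 0 (enum_rank_in iS i)).
  by rewrite !mxE; apply: eq_bigr => j _; rewrite !mxE enum_rankK_in.
by rewrite xS mxE.
Qed.

(* Courant-Fischer, in the form: on the complement of few coordinates of an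
   eigenbasis of [M *m M^T], the norm of [x *m M] is at least [sigma_k]. *)
Lemma singular_value_lower n1 n2 (M : 'M[R]_(n1, n2)) k : (0 < k <= n1)%N ->
  exists p (B : 'M[C]_(n1, p)), (p <= n1 - k)%N /\
  forall x, x *m B = 0 -> singular_value k M ^+ 2 * sqn x <= sqn (x *m cplx M).
Proof.
move=> kn; have [Q [e [QE e0 ME sE]]] := spectral_coords M.
have [c1 _] := singular_value_counts kn sE.
exists _, (coords Q [set i | Num.sqrt (e i) < singular_value k M]%SET); split=> // x xB.
rewrite -QE ME /sqn mulr_sumr; apply: ler_sum => i _.
have [iS|iS] := boolP (i \in [set i | Num.sqrt (e i) < singular_value k M]%SET).
  by rewrite (coordsP xB iS) /nq /= expr0n addr0 !mulr0.
rewrite ler_wpM2r ?nq_ge0//; move: iS; rewrite inE -leNgt => h.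
by rewrite -[leRHS]sqr_sqrtr// lerXn2r ?nnegrE ?sqrtr_ge0 ?singular_value_ge0.
Qed.

(** The dual half of Courant-Fischer: fewer than k conditions remove the coordinates whose singular
    value exceeds the k-th. *)
Lemma singular_value_upper n1 n2 (M : 'M[R]_(n1, n2)) k : (0 < k <= n1)%N ->
  exists p (B : 'M[C]_(n1, p)), (p < k)%N /\
  forall x, x *m B = 0 -> sqn (x *m cplx M) <= singular_value k M ^+ 2 * sqn x.
Proof.
move=> kn; have [Q [e [QE e0 ME sE]]] := spectral_coords M.
have [_ c2] := singular_value_counts kn sE.
exists _, (coords Q [set i | singular_value k M < Num.sqrt (e i)]%SET); split=> // x xB.
rewrite -QE ME /sqn mulr_sumr; apply: ler_sum => i _.
have [iS|iS] := boolP (i \in [set i | singular_value k M < Num.sqrt (e i)]%SET).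
  by rewrite (coordsP xB iS) /nq /= expr0n addr0 !mulr0.
rewrite ler_wpM2r ?nq_ge0//; move: iS; rewrite inE -leNgt => h.
by rewrite -[leLHS]sqr_sqrtr// lerXn2r ?nnegrE ?sqrtr_ge0 ?singular_value_ge0.
Qed.

(** A family of quadratic bounds whose optimum over t is the triangle inequality; it is proved
    coordinate by coordinate. *)
Lemma sqnD_le n (x y : 'rV[C]_n) (t : R) : 0 < t ->
  sqn (x + y) <= (1 + t) * sqn x + (1 + t^-1) * sqn y.
Proof.
move=> t0; rewrite /sqn !mulr_sumr -big_split/=; apply: ler_sum => j _.
have sq (a b : R) : (a + b) ^+ 2 <= (1 + t) * a ^+ 2 + (1 + t^-1) * b ^+ 2.
  rewrite -subr_ge0.
  have -> : (1 + t) * a ^+ 2 + (1 + t^-1) * b ^+ 2 - (a + b) ^+ 2 =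
    (t * a - b) ^+ 2 / t by field; rewrite gt_eqF.
  by rewrite divr_ge0 ?sqr_ge0// ltW.
rewrite mxE; case: (x 0 j) (y 0 j) => [a b] [c d]; rewrite /nq /=.
by have := sq a c; have := sq b d; lra.
Qed.

(** The lower bound for M + E holds under at most n1 - k linear conditions and the upper bound for M
    under at most k - 1, so some nonzero x meets both sets. *)
Lemma weyl n1 n2 (M E : 'M[R]_(n1, n2)) k (eps : R) : (0 < k)%N -> 0 <= eps ->
  (forall x, sqn (x *m cplx E) <= eps ^+ 2 * sqn x) ->
  singular_value k (M + E) <= singular_value k M + eps.
Proof.
move=> k0 eps0 HE; have [kn|nk] := leqP k n1; last first.
  by rewrite !singular_value_oversize// add0r.
have kk : (0 < k <= n1)%N by rewrite k0.
have [p [B [pk HB]]] := singular_value_lower (M + E) kk.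
have [q [D [qk HD]]] := singular_value_upper M kk.
have [|x x0 xBD] := @exists_kernel_vector _ _ (row_mx B D).
  by rewrite -ltn_subRL (leq_trans qk)// leq_subRL// ?(leq_trans pk (leq_subr _ _))//
    addnC -leq_subRL// (leq_trans pk)// subnK.
move: xBD; rewrite mul_mx_row -[0]row_mx0 => /eq_row_mx[xB xD].
have {HB} := HB x xB; have {HD} := HD x xD; have {HE} := HE x; have := sqn_gt0 x0.
rewrite map_mxD mulmxDr; set N := sqn x; set s := singular_value k M.
set s' := singular_value k _ => N0 hE hM hME.
have s0 : 0 <= s by exact: singular_value_ge0.
apply/ler_addgt0Pr => d d0.
(* The slack d makes both quantities positive; with t = e1 / s1 the bound [sqnD_le] becomes exactly
   (s1 + e1)^2. *)
pose s1 := s + d / 2; pose e1 := eps + d / 2.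
have s10 : 0 < s1 by rewrite /s1; lra.
have e10 : 0 < e1 by rewrite /e1; lra.
have -> : s + eps + d = s1 + e1 by rewrite /s1 /e1; field.
have t0 : 0 < e1 / s1 by rewrite divr_gt0.
have := sqnD_le (x *m cplx M) (x *m cplx E) t0; rewrite invfM invrK => hD.
have hM' : sqn (x *m cplx M) <= s1 ^+ 2 * N.
  apply: le_trans hM _; rewrite ler_pM2r// lerXn2r ?nnegrE ?(ltW s10)// /s1; lra.
have hE' : sqn (x *m cplx E) <= e1 ^+ 2 * N.
  apply: le_trans hE _; rewrite ler_pM2r// lerXn2r ?nnegrE ?(ltW e10)// /e1; lra.
have : s' ^+ 2 * N <= (s1 + e1) ^+ 2 * N.
  apply: le_trans hME (le_trans hD _).
  have -> : (s1 + e1) ^+ 2 * N = (1 + e1 / s1) * (s1 ^+ 2 * N) + (1 + e1^-1 * s1) * (e1 ^+ 2 * N).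
    by field; rewrite !gt_eqF.
  by rewrite lerD// ler_wpM2l// addr_ge0// mulr_ge0 ?invr_ge0 ?ltW.
rewrite ler_pM2r// ler_pXn2r ?nnegrE ?singular_value_ge0//.
by rewrite addr_ge0 ?ltW.
Qed.

(** The r conditions x A = 0 and the at most n1 - k conditions of the lower bound have a common
    nonzero solution, at which the product vanishes. *)
Lemma singular_value_factor n1 n2 r (A : 'M[R]_(n1, r)) (B : 'M[R]_(r, n2)) k :
  (r < k)%N -> singular_value k (A *m B) = 0.
Proof.
move=> rk; have k0 : (0 < k)%N by exact: leq_ltn_trans rk.
have [kn|nk] := leqP k n1; last by rewrite singular_value_oversize.
have kk : (0 < k <= n1)%N by rewrite k0.
have [p [D [pk HD]]] := singular_value_lower (A *m B) kk.
have [|x x0 xBD] := @exists_kernel_vector _ _ (row_mx D (cplx A)).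
  by rewrite -ltn_subRL (leq_trans rk)// leq_subRL// ?(leq_trans pk (leq_subr _ _))//
    addnC -leq_subRL// (leq_trans pk)// subnK.
move: xBD; rewrite mul_mx_row -[0]row_mx0 => /eq_row_mx[xD xA].
have := HD x xD; rewrite map_mxM mulmxA xA mul0mx.
have -> : sqn (0 : 'rV[C]_n2) = 0.
  by rewrite /sqn big1// => j _; rewrite mxE /nq /= expr0n addr0.
rewrite pmulr_lle0 ?sqn_gt0// => h; apply/eqP; rewrite -sqrf_eq0 eq_le h.
exact: sqr_ge0.
Qed.

Lemma singular_value_gram n1 n2 n3 (A : 'M[R]_(n1, n2)) (B : 'M[R]_(n1, n3)) k :
  A *m A^T = B *m B^T -> singular_value k A = singular_value k B.
Proof. by rewrite /singular_value /singular_values => ->. Qed.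

(** The form is tested on c and c E for c real; the real and imaginary parts of x are treated
    separately. *)
Lemma opbound_sqn n1 n2 (E : 'M[R]_(n1, n2)) t : 0 <= t -> opbound E t ->
  forall x, sqn (x *m cplx E) <= t ^+ 2 * sqn x.
Proof.
move=> t0 Et x.
pose a j := complex.Re (x 0 j); pose b j := complex.Im (x 0 j).
pose mul (a : 'I_n1 -> R) j := \sum_i a i * E i j.
have real_bound (c : 'I_n1 -> R) : \sum_j mul c j ^+ 2 <= t ^+ 2 * \sum_i c i ^+ 2.
  have S0 (I : finType) (f : I -> R) : 0 <= \sum_i f i ^+ 2.
    by apply: sumr_ge0 => i _; exact: sqr_ge0.
  have := Et c (mul c); have -> : form E c (mul c) = \sum_j mul c j ^+ 2.
    rewrite /form exchange_big; apply: eq_bigr => j _.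
    by rewrite expr2 {2}/mul mulr_suml; apply: eq_bigr => i _; ring.
  have -> : \sum_j mul c j ^+ 2 = vnorm (mul c) ^+ 2 by rewrite sqr_sqrtr.
  have -> : \sum_i c i ^+ 2 = vnorm c ^+ 2 by rewrite sqr_sqrtr.
  have := vnorm_ge0 (mul c); have := vnorm_ge0 c.
  move: (vnorm c) (vnorm (mul c)) => a1 b1 a10 b10 h.
  have [->|v0] := eqVneq b1 0; first by rewrite expr0n /= mulr_ge0// sqr_ge0.
  have vp : 0 < b1 by rewrite lt_neqAle eq_sym v0.
  rewrite -exprMn lerXn2r ?nnegrE ?mulr_ge0//.
  by move: h; rewrite mulrA expr2 ler_pM2r.
have reE j : complex.Re ((x *m cplx E) 0 j) = mul a j.
  rewrite mxE raddf_sum; apply: eq_bigr => i _; rewrite /a mxE.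
  by case: (x 0 i) => u v /=; rewrite mulr0 subr0.
have imE j : complex.Im ((x *m cplx E) 0 j) = mul b j.
  rewrite mxE raddf_sum; apply: eq_bigr => i _; rewrite /b mxE.
  by case: (x 0 i) => u v /=; rewrite mulr0 add0r.
rewrite /sqn /nq; under eq_bigr do rewrite reE imE.
by rewrite !big_split/= mulrDr lerD// real_bound.
Qed.

End SingularValues.

(** * Matricizations of a tensor train *)

Section Slices.
Variables (R : realType) (d : nat) (n : 'I_d.+1 -> nat).
Implicit Types (i : 'I_d.+1) (y : entry_index n) (T : tensor R n).
Local Notation upd := (@dfwith 'I_d.+1 (fun i => 'I_(n i))).

Lemma dfwithC (f : forall i, 'I_(n i)) i j (a : 'I_(n i)) (b : 'I_(n j)) : i != j ->
  upd (upd f i a) j b = upd (upd f j b) i a.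
Proof.
move=> ij; apply/functional_extensionality_dep => k.
have [ki|ki] := eqVneq i k; first subst k.
  by rewrite dfwithin dfwithout 1?eq_sym// dfwithin.
have [kj|kj] := eqVneq j k; first subst k.
  by rewrite dfwithin dfwithout// dfwithin.
by rewrite !dfwithout.
Qed.

Lemma slice_swap i1 i2 i3 y T x1 x2 x3 : i1 != i2 ->
  slice i1 i2 i3 y T x1 x2 x3 = slice i2 i1 i3 y T x2 x1 x3.
Proof. by move=> i12; rewrite /slice (dfwithC _ _ _ i12). Qed.

Lemma slice_rot i1 i2 i3 y T x1 x2 x3 : i1 != i3 -> i2 != i3 ->
  slice i1 i2 i3 y T x1 x2 x3 = slice i3 i1 i2 y T x3 x1 x2.
Proof.
by move=> i13 i23; rewrite /slice (dfwithC _ _ _ i23) (dfwithC _ _ _ i13).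
Qed.

Definition spliced i1 i2 i3 y x1 x2 x3 : entry_index n :=
  finfun (upd (upd (upd y i1 x1) i2 x2) i3 x3).

Arguments spliced : clear implicits.

Lemma spliced_row i1 i2 i3 y x1 x2 x3 x2' x3' j : j != i2 -> j != i3 ->
  spliced i1 i2 i3 y x1 x2 x3 j = spliced i1 i2 i3 y x1 x2' x3' j.
Proof.
rewrite (eq_sym j i2) (eq_sym j i3) => j2 j3.
by rewrite !ffunE !(dfwithout _ _ j3) !(dfwithout _ _ j2).
Qed.

Lemma spliced_col i1 i2 i3 y x1 x2 x3 x1' j : j != i1 ->
  spliced i1 i2 i3 y x1 x2 x3 j = spliced i1 i2 i3 y x1' x2 x3 j.
Proof.
rewrite eq_sym => j1; rewrite !ffunE.
have [e|j3] := eqVneq i3 j; first by subst j; rewrite !dfwithin.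
have [e|j2] := eqVneq i2 j; first by subst j; rewrite !(dfwithout _ _ j3) !dfwithin.
by rewrite !(dfwithout _ _ j3) !(dfwithout _ _ j2) !(dfwithout _ _ j1).
Qed.

(** Distinct entries of a matricization thus read distinct observations, whose noises are
    independent. *)
Lemma spliced_inj i1 i2 i3 y x1 x2 x3 x1' x2' x3' : i1 != i2 -> i1 != i3 -> i2 != i3 ->
  spliced i1 i2 i3 y x1 x2 x3 = spliced i1 i2 i3 y x1' x2' x3' ->
  [/\ x1 = x1', x2 = x2' & x3 = x3'].
Proof.
rewrite (eq_sym i1 i2) (eq_sym i1 i3) (eq_sym i2 i3) => i21 i31 i32 E; split.
- have /(congr1 (fun f : entry_index n => f i1)) := E.
  by rewrite !ffunE !(dfwithout _ _ i31) !(dfwithout _ _ i21) !dfwithin.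
- have /(congr1 (fun f : entry_index n => f i2)) := E.
  by rewrite !ffunE !(dfwithout _ _ i32) !dfwithin.
have /(congr1 (fun f : entry_index n => f i3)) := E.
by rewrite !ffunE !dfwithin.
Qed.

End Slices.

Arguments spliced {d n} i1 i2 i3 y x1 x2 x3.

Lemma matricize_factor (R : realType) (n1 n2 n3 r : nat) (A : 'I_n1 -> 'I_n2 -> 'I_n3 -> R)
    (f : 'I_n1 -> 'I_r -> R) (g : 'I_n2 -> 'I_n3 -> 'I_r -> R) :
  (forall x1 x2 x3, A x1 x2 x3 = \sum_c f x1 c * g x2 x3 c) ->
  matricize A = (\matrix_(x, c) f x c) *m (\matrix_c mxvec (\matrix_(b, e) g b e c)).
Proof.
move=> AE; apply/matrixP => x j; case/mxvec_indexP: j => b e.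
rewrite !mxE mxvecE mxE AE; apply: eq_bigr => c _.
by rewrite !mxE mxvecE mxE.
Qed.

Lemma matricize_gram (R : realType) (n1 n2 n3 : nat) (A : 'I_n1 -> 'I_n2 -> 'I_n3 -> R) x x' :
  (matricize A *m (matricize A)^T) x x' = \sum_b \sum_e A x b e * A x' b e.
Proof.
rewrite mxE pair_bigA/= (reindex _ (curry_mxvec_bij _ _))/=.
apply: eq_bigr => -[b e] _ /=.
by rewrite !mxE !mxvecE !mxE.
Qed.

(** Reordering columns preserves the Gram matrix. This links the column order of the hypothesis on
    the middle index to that of the algorithm. *)
Lemma matricize_swap (R : realType) (n1 n2 n3 : nat) (A : 'I_n1 -> 'I_n2 -> 'I_n3 -> R) k :
  singular_value k (matricize A) = singular_value k (matricize (fun x b e => A x e b)).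
Proof.
apply: singular_value_gram; apply/matrixP => x x'.
by rewrite !matricize_gram exchange_big.
Qed.

Section CorrectOrder.
Variables (d : nat) (tau : 'S_d.+1).
Implicit Types i j : 'I_d.+1.
Let p i : nat := (tau^-1)%g i.

Definition extreme i j1 j2 : bool :=
  (p i < p j1)%N && (p i < p j2)%N || (p j1 < p i)%N && (p j2 < p i)%N.

Lemma correct_order_cases i1 i2 i3 : i1 != i2 -> i1 != i3 -> i2 != i3 ->
  [|| correct_order tau i2 i1 i3, correct_order tau i1 i2 i3 | correct_order tau i2 i3 i1].
Proof.
have pI i j : i != j -> p i <> p j.
  by move=> ij /val_inj/perm_inj/eqP; apply/negP.
move=> /pI h1 /pI h2 /pI h3; rewrite /correct_order -!/(p _).
move: (p i1) (p i2) (p i3) h1 h2 h3; clear; lia.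
Qed.

Lemma correct_order_extreme i1 i2 i3 : correct_order tau i1 i2 i3 ->
  [/\ extreme i1 i2 i3, extreme i1 i3 i2, extreme i3 i1 i2 & extreme i3 i2 i1].
Proof.
rewrite /correct_order /extreme -!/(p _).
by move: (p i1) (p i2) (p i3); clear=> a b c abc; split; move: abc; lia.
Qed.

End CorrectOrder.

Section TensorTrainRank.
Variables (R : realType) (d : nat) (n r : 'I_d.+1 -> nat) (tau : 'S_d.+1).
Variable u : tt_param R n r tau.
Implicit Types (x y : entry_index n).

Definition agree (a b : nat) x y :=
  forall j, (a <= j < b)%N -> x (tau (inZp j)) = y (tau (inZp j)).

Lemma tt_prod_local k x y : agree 0 k x y -> tt_prod u x k = tt_prod u y k.
Proof.
elim: k => //= k IH xy; rewrite IH => [|j jk]; last first.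
  by apply: xy; rewrite (ltnW (n := k.+1)) //= ltnS ltnW.
by congr (_ *m _); rewrite /tt_factor xy//= ltnSn.
Qed.

Lemma tt_prod_split p q : exists Q : entry_index n -> 'M[R]_(r (inZp p), r (inZp (p + q))),
  (forall x, tt_prod u x (p + q) = tt_prod u x p *m Q x) /\
  (forall x y, agree p (p + q) x y -> Q x = Q y).
Proof.
elim: q => [|q [Q [QE QL]]].
  rewrite addn0; exists (fun=> 1%:M); split=> // x; by rewrite mulmx1.
rewrite addnS; exists (fun x => Q x *m tt_factor u x (p + q)); split=> [x|x y xy] /=.
  by rewrite QE mulmxA.
rewrite (QL x y) => [|j /andP[pj jq]]; last by apply: xy; rewrite pj ltnW.
by congr (_ *m _); rewrite /tt_factor xy// leq_addr ltnSn.
Qed.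

Lemma tt_tensor_split (r1 : r ord0 = 1%N) p : (p <= d.+1)%N ->
  exists (L Q : entry_index n -> 'I_(r (inZp p)) -> R),
  [/\ forall x, tt_tensor r1 u x = \sum_c L x c * Q x c,
      forall x y, agree 0 p x y -> L x = L y &
      forall x y, agree p d.+1 x y -> Q x = Q y].
Proof.
move=> pd; have [Q [QE QL]] := tt_prod_split p (d.+1 - p).
move: Q QE QL; rewrite subnKC// => Q QE QL.
exists (fun x c => tt_prod u x p (cast_ord (esym (r_inZp0 r1)) 0) c).
exists (fun x c => Q x c (cast_ord (esym (r_inZpd r1)) 0)).
split=> [x|x y xy|x y xy].
- by rewrite /tt_tensor castmxE QE mxE.
- by apply/funext => c; rewrite (tt_prod_local xy).
- by apply/funext => c; rewrite (QL x y).
Qed.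

Let pos (i : 'I_d.+1) : nat := (tau^-1)%g i.

Let pos_tau j : (j < d.+1)%N -> pos (tau (inZp j)) = j.
Proof. by move=> jd; rewrite /pos permK /= modn_small. Qed.

(** If i1 comes first the train is cut just after it, if last just before it. Either way the cut
    position p satisfies 0 < p <= d, one side of the cut sees i1 and the other sees i2 and i3, and
    the matricization factors through dimension r p < k. *)
Lemma extreme_singular_value (r1 : r ord0 = 1%N) k i1 i2 i3 y :
  (forall j : 'I_d.+1, (0 < j)%N -> (r j < k)%N) ->
  extreme tau i1 i2 i3 ->
  singular_value k (matricize (slice i1 i2 i3 y (tt_tensor r1 u))) = 0.
Proof.
move=> rk ext; have posd i : (pos i <= d)%N by rewrite -ltnS /pos.
have rank_lt p : (0 < p <= d)%N -> (r (inZp p) < k)%N.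
  by move=> /andP[p0 pd]; apply: rk; rewrite /= modn_small// ltnS.
move: (ext : ((pos i1 < pos i2) && (pos i1 < pos i3) ||
  (pos i2 < pos i1) && (pos i3 < pos i1))%N); case/orP => /andP[p2 p3].
  have pd : (pos i1 < d)%N by rewrite (leq_trans p2).
  have [L [Q [TE LL QL]]] := tt_tensor_split r1 (p := (pos i1).+1) (ltnW pd).
  rewrite (@matricize_factor _ _ _ _ _ _
     (fun x1 : 'I_(n i1) => L (spliced i1 i2 i3 y x1 (y i2) (y i3)))
     (fun (x2 : 'I_(n i2)) (x3 : 'I_(n i3)) => Q (spliced i1 i2 i3 y (y i1) x2 x3))).
    by apply: singular_value_factor; exact: rank_lt.
  move=> x1 x2 x3; rewrite /slice -/(spliced _ _ _ _ _ _ _) TE.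
  rewrite (LL _ (spliced i1 i2 i3 y x1 (y i2) (y i3))); last first.
    move=> j /= j1; have jd : (j < d.+1)%N by rewrite (leq_trans j1)// ltnW.
    apply: spliced_row; apply/eqP => /(congr1 pos); rewrite pos_tau// => jE.
      by move: j1; rewrite jE ltnS leqNgt p2.
    by move: j1; rewrite jE ltnS leqNgt p3.
  rewrite (QL _ (spliced i1 i2 i3 y (y i1) x2 x3))// => j /andP[j1 jd].
  apply: spliced_col; apply/eqP => /(congr1 pos); rewrite pos_tau// => jE.
  by move: j1; rewrite jE ltnn.
have p0 : (0 < pos i1)%N by rewrite (leq_ltn_trans _ p2).
have [L [Q [TE LL QL]]] := tt_tensor_split r1 (p := pos i1) (leqW (posd i1)).
rewrite (@matricize_factor _ _ _ _ _ _
   (fun x1 : 'I_(n i1) => Q (spliced i1 i2 i3 y x1 (y i2) (y i3)))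
   (fun (x2 : 'I_(n i2)) (x3 : 'I_(n i3)) => L (spliced i1 i2 i3 y (y i1) x2 x3))).
  by apply: singular_value_factor; apply: rank_lt; rewrite p0 posd.
move=> x1 x2 x3; rewrite /slice -/(spliced _ _ _ _ _ _ _) TE.
rewrite (QL _ (spliced i1 i2 i3 y x1 (y i2) (y i3))); last first.
  move=> j /andP[j1 jd].
  apply: spliced_row; apply/eqP => /(congr1 pos); rewrite pos_tau// => jE.
    by move: j1; rewrite jE leqNgt p2.
  by move: j1; rewrite jE leqNgt p3.
rewrite (LL _ (spliced i1 i2 i3 y (y i1) x2 x3)).
  by apply: eq_bigr => c _; rewrite mulrC.
move=> j /= j1; have jd : (j < d.+1)%N by rewrite (leq_trans j1)// leqW.
apply: spliced_col; apply/eqP => /(congr1 pos); rewrite pos_tau// => jE.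
by move: j1; rewrite jE ltnn.
Qed.

End TensorTrainRank.

(** * Measurability of singular values *)

Lemma sqr_le_vnorm (R : realType) (I : finType) (a : I -> R) i : `|a i| <= vnorm a.
Proof.
rewrite -sqrtr_sqr; apply: ler_wsqrtr.
by rewrite (bigD1 i)//= lerDl sumr_ge0// => j _; exact: sqr_ge0.
Qed.

Lemma opbound_sum_norm (R : realType) (m n : nat) (E : 'I_m -> 'I_n -> R) :
  opbound E (\sum_i \sum_j `|E i j|).
Proof.
move=> a b; rewrite /form mulr_suml; apply: ler_sum => i _.
rewrite mulr_suml; apply: ler_sum => j _.
apply: le_trans (ler_norm _) _; rewrite !normrM ler_wpM2l//.
by apply: ler_pM; rewrite ?normr_ge0// sqr_le_vnorm.
Qed.

Section MeasurableSingularValue.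
Variables (R : realType) (n1 n2 : nat) (k : nat) (k0 : (0 < k)%N).
Implicit Types A B : 'M[R]_(n1, n2).

Definition dist1 A B : R := \sum_i \sum_j `|A i j - B i j|.

Lemma dist1C A B : dist1 A B = dist1 B A.
Proof. by apply: eq_bigr => i _; apply: eq_bigr => j _; exact: distrC. Qed.

Lemma singular_value_lipschitz A B :
  singular_value k A <= singular_value k B + dist1 A B.
Proof.
have e0 : 0 <= dist1 A B by apply: sumr_ge0 => i _; exact: sumr_ge0.
have -> : A = B + (A - B) by rewrite addrC subrK.
rewrite [X in dist1 X]addrC subrK.
apply: weyl => //; apply: opbound_sqn => //.
rewrite (_ : dist1 A B = \sum_i \sum_j `|(A - B) i j|); first exact: opbound_sum_norm.
by apply: eq_bigr => i _; apply: eq_bigr => j _; rewrite !mxE.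
Qed.

Variables (dO : measure_display) (Omega : measurableType dO).
Variables (M : Omega -> 'M[R]_(n1, n2)).
Hypothesis mM : forall i j, measurable_fun setT (fun w => M w i j).

(** By the Lipschitz bound, the value at M w is below a exactly when some rational matrix q has its
    own value plus the distance from M w to q below a: a countable union of measurable events. *)
Lemma measurable_singular_value : measurable_fun setT (fun w => singular_value k (M w)).
Proof.
move=> _; apply: (measurability _ (RGenInftyO.measurableE R)) => //.
move=> _ [_ [a ->] <-]; rewrite setTI.
pose T : countType := {ffun 'I_n1 * 'I_n2 -> rat}.
pose pt (N : nat) : T := odflt [ffun=> 0] (@unpickle T N).
pose mx (q : T) : 'M[R]_(n1, n2) := \matrix_(i, j) ratr (q (i, j)).
pose U (q : T) := [set w | singular_value k (mx q) + dist1 (M w) (mx q) < a].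
have mU q : measurable (U q).
  have mf : measurable_fun setT (fun w => singular_value k (mx q) + dist1 (M w) (mx q)).
    apply: measurable_funD; first exact: measurable_cst.
    apply: measurable_sum => i; apply: measurable_sum => j.
    by apply: measurableT_comp => //; apply: measurable_funB.
  rewrite (_ : U q = (fun w => singular_value k (mx q) + dist1 (M w) (mx q)) @^-1` `]-oo, a[).
    by rewrite -[X in measurable X]setTI; apply: mf.
  by apply/seteqP; split=> w /=; rewrite in_itv.
rewrite (_ : _ @^-1` _ = \bigcup_N U (pt N)); first exact: bigcupT_measurable.
apply/seteqP; split=> w /=; rewrite in_itv/=; last first.
  by case=> N _; apply: le_lt_trans; exact: singular_value_lipschitz.
move=> Ma.
have [q qM] := rat_approx (fun ij : 'I_n1 * 'I_n2 => M w ij.1 ij.2).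
pose qN N : T := [ffun ij => q N ij].
have cd : dist1 (M w) (mx (qN N)) @[N --> \oo] --> (0 : R).
  rewrite [X in _ --> X](_ : 0 = \sum_(i < n1) \sum_(j < n2) `|M w i j - M w i j|); last first.
    by rewrite big1// => i _; rewrite big1// => j _; rewrite subrr normr0.
  apply: cvg_fsum => i; apply: cvg_fsum => j; apply: cvg_norm; apply: cvgB; first exact: cvg_cst.
  under eq_fun do rewrite mxE ffunE.
  exact: (qM (i, j)).
have e0 : 0 < (a - singular_value k (M w)) / 2 by lra.
have [N _ /(_ N (leqnn N))] := cvgr_lt _ cd _ e0.
rewrite /= => dN; exists (pickle (qN N)) => //; rewrite /U/= /pt pickleK/=.
have := singular_value_lipschitz (mx (qN N)) (M w); rewrite dist1C.
by move: dN; move: (dist1 _ _) (singular_value _ _) (singular_value _ _) => *; lra.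
Qed.

End MeasurableSingularValue.

(** * The three-index algorithm *)

Lemma mutually_independent_comp (R : realType) (dO : measure_display)
    (Omega : measurableType dO) (P : probability Omega R) (I J : finType)
    (X : I -> {RV P >-> R}) (f : J -> I) :
  injective f -> mutually_independent X -> mutually_independent (X \o f).
Proof.
move=> fI HX K B mB.
(* Indices outside the image of f get the whole line, on which there is no constraint. *)
pose B' i := if [pick j | f j == i] is Some j then B j else setT.
have B'E j : B' (f j) = B j.
  rewrite /B'; case: pickP => [j' /eqP /fI -> //|/(_ j)]; by rewrite eqxx.
have mB' i : measurable (B' i) by rewrite /B'; case: pickP.
have := HX (f @: K)%SET B' mB'.
rewrite big_imset/=; last by move=> a b _ _; exact: fI.
under eq_bigr do rewrite B'E.
move=> <-; congr (P _); apply/seteqP; split=> w /= H.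
  by move=> _ /= /imsetP[j jK ->]; rewrite B'E; exact: H.
by move=> j /= jK; have := H (f j) (imset_f f jK); rewrite /= B'E.
Qed.

Lemma matricizeD (R : realType) (n1 n2 n3 : nat) (A B : 'I_n1 -> 'I_n2 -> 'I_n3 -> R) :
  matricize (fun x b e => A x b e + B x b e) = matricize A + matricize B.
Proof.
by apply/matrixP => x j; case/mxvec_indexP: j => b e; rewrite !mxE !mxvecE !mxE.
Qed.

Lemma le_opbound (R : realType) (m n : nat) (E : 'I_m -> 'I_n -> R) (s t : R) :
  s <= t -> opbound E s -> opbound E t.
Proof.
move=> st Es a b; apply: le_trans (Es a b) _.
by rewrite ler_wpM2r// mulr_ge0// vnorm_ge0.
Qed.

Lemma singular_value_dist (R : realType) (n1 n2 : nat) (M E : 'M[R]_(n1, n2)) k (t : R) :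
  (0 < k)%N -> 0 <= t -> opbound E t ->
  `|singular_value k (M + E) - singular_value k M| <= t.
Proof.
move=> k0 t0 Et; have NE := opbound_sqn t0 Et.
have h1 := weyl M k0 t0 NE.
have h2 : singular_value k (M + E + - E) <= singular_value k (M + E) + t.
  apply: weyl => // x; rewrite map_mxN mulmxN.
  rewrite (_ : sqn (- _) = sqn (x *m map_mx (real_complex R) E))//.
  by apply: eq_bigr => j _; rewrite mxE /nq !raddfN/= !sqrrN.
by move: h2; rewrite addrK ler_norml => h2; apply/andP; split; lra.
Qed.

Section NoiseMatrix.
Variables (R : realType) (dO : measure_display) (Omega : measurableType dO).
Variables (P : probability Omega R) (O : finType) (noise : O -> {RV P >-> R}) (s : R).
Hypothesis s0 : 0 < s.
Hypothesis noise_normal : forall o, normally_distributed (noise o) 0 s.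
Hypothesis noise_indep : mutually_independent noise.

(** The matricization is n1 by n2 n3, so sqrt n1 + sqrt (n2 n3) <= sqrt N + N. *)
Lemma noise_opbound (n1 n2 n3 N : nat) (f : 'I_n1 -> 'I_n2 -> 'I_n3 -> O) (t : R) :
  (0 < n1)%N -> (0 < n2)%N -> (0 < n3)%N -> (n1 <= N)%N -> (n2 <= N)%N -> (n3 <= N)%N ->
  (forall x b e x' b' e', f x b e = f x' b' e' -> [/\ x = x', b = b' & e = e']) ->
  0 < t ->
  exists U : set Omega, [/\ measurable U, (P U <= (expR (- (t ^+ 2 / 2)))%:E)%E &
    forall w, ~ U w -> opbound (matricize (fun x b e => noise (f x b e) w))
      (s * (Num.sqrt N%:R + N%:R + t))].
Proof.
move=> n10 n20 n30 n1N n2N n3N fI t0.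
have [p pK' Kp'] := curry_mxvec_bij n2 n3.
have Kp j : mxvec_index (p j).1 (p j).2 = j.
  by have := Kp' j isT; case: (p j).
have pK b e : p (mxvec_index b e) = (b, e) := pK' (b, e) isT.
pose g (ij : 'I_n1 * 'I_(n2 * n3)) := f ij.1 (p ij.2).1 (p ij.2).2.
have gI : injective g.
  move=> [i j] [i' j'] /fI /= [-> h1 h2]; congr (_, _).
  by rewrite -(Kp j) h1 h2 Kp.
have n23 : (0 < n2 * n3)%N by rewrite muln_gt0 n20.
have [U [mU PU UE]] := gaussian_opbound n10 n23 s0
  (fun o => noise_normal (g o)) (mutually_independent_comp gI noise_indep) t0.
exists U; split=> // w /UE; rewrite (_ : (fun i j => _) =
    (matricize (fun x b e => noise (f x b e) w) : _ -> _ -> _)); last first.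
  apply/funext => x; apply/funext => j; case/mxvec_indexP: j => b e.
  by rewrite mxE mxvecE mxE /= /g /= pK.
apply: le_opbound; rewrite ler_pM2l// lerD2r lerD//.
  by rewrite ler_wsqrtr// ler_nat.
rewrite -[leRHS]ger0_norm// -sqrtr_sqr ler_wsqrtr// -natrX ler_nat -mulnn.
exact: leq_mul.
Qed.

End NoiseMatrix.

(** The deterministic part: after the perturbation the value of the middle index is at least sigma -
    eps > eps, while the two others are at most eps. The comparison is strict, so there is no
    tie. *)
Lemma three_index_correct (R : realType) (d : nat) (n : 'I_d.+1 -> nat) (tau : 'S_d.+1)
    (i1 i2 i3 : 'I_d.+1) (R0 m : nat) (T : tensor R n)
    (oracle : entry_index n -> 'I_m -> R) (q : 'I_3 -> entry_index n -> 'I_m)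
    (y : entry_index n) (sigma eps : R) :
  i1 != i2 -> i1 != i3 -> i2 != i3 -> 2 * eps < sigma ->
  (forall j1 j2 j3, correct_order tau j1 j2 j3 ->
    sigma <= singular_value (R0 ^ 2)
      (matricize (fun x2 x1 x3 => slice j1 j2 j3 y T x1 x2 x3))) ->
  (forall j1 j2 j3, extreme tau j1 j2 j3 ->
    singular_value (R0 ^ 2) (matricize (slice j1 j2 j3 y T)) = 0) ->
  let A s := slice i1 i2 i3 y (fun x => oracle x (q s x)) in
  let B := slice i1 i2 i3 y T in
  let near n1 n2 n3 (M M' : 'I_n1 -> 'I_n2 -> 'I_n3 -> R) :=
    `|singular_value (R0 ^ 2) (matricize M) -
      singular_value (R0 ^ 2) (matricize M')| <= eps in
  near _ _ _ (fun x1 x2 x3 => A (inord 0) x1 x2 x3) (fun x1 x2 x3 => B x1 x2 x3) ->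
  near _ _ _ (fun x2 x3 x1 => A (inord 1) x1 x2 x3) (fun x2 x3 x1 => B x1 x2 x3) ->
  near _ _ _ (fun x3 x1 x2 => A (inord 2) x1 x2 x3) (fun x3 x1 x2 => B x1 x2 x3) ->
  correct_output tau (three_index i1 i2 i3 R0 oracle q y).
Proof.
move=> i12 i13 i23 es mid ext A B near; rewrite /near {near}.
rewrite /three_index -/(A _).
have B2 : (fun x2 x3 x1 => B x1 x2 x3) = slice i2 i3 i1 y T.
  apply/funext => x2; apply/funext => x3; apply/funext => x1.
  by rewrite /B slice_rot// slice_rot// eq_sym.
have B3 : (fun x3 x1 x2 => B x1 x2 x3) = slice i3 i1 i2 y T.
  apply/funext => x3; apply/funext => x1; apply/funext => x2.
  by rewrite /B slice_rot.
move: (singular_value _ (matricize (fun x1 x2 x3 => A _ _ _ _))) => a.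
move: (singular_value _ (matricize (fun x1 x2 x3 => A _ _ _ _))) => b.
move: (singular_value _ (matricize (fun x1 x2 x3 => A _ _ _ _))) => c.
rewrite B2 B3 => aB bB cB.
have B1 : (fun x1 x2 x3 => B x1 x2 x3) = slice i1 i2 i3 y T by [].
rewrite gt_max gt_max gt_max; rewrite B1 in aB.
move: aB bB cB; rewrite !ler_distl => /andP[a1 a2] /andP[b1 b2] /andP[c1 c2].
case/or3P: (correct_order_cases tau i12 i13 i23) => o;
  have [e1 e2 e3 e4] := correct_order_extreme o.
- have a0 := mid _ _ _ o.
  have E : (fun x1 x2 x3 => slice i2 i1 i3 y T x2 x1 x3) = slice i1 i2 i3 y T.
    apply/funext => x1; apply/funext => x2; apply/funext => x3.
    by rewrite slice_swap// eq_sym.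
  rewrite E in a0.
  have b0 : singular_value (R0 ^ 2) (matricize (slice i2 i3 i1 y T)) = 0 by exact: ext.
  have c0 : singular_value (R0 ^ 2) (matricize (slice i3 i1 i2 y T)) = 0 by exact: ext.
  have -> : b < a by move: a0 a1 a2 b0 b1 b2; do 2!move: (singular_value _ _) => ?; lra.
  have -> // : c < a by move: a0 a1 a2 c0 c1 c2; do 2!move: (singular_value _ _) => ?; lra.
- have b0 := mid _ _ _ o.
  rewrite matricize_swap B2 in b0.
  have a0 : singular_value (R0 ^ 2) (matricize (slice i1 i2 i3 y T)) = 0 by exact: ext.
  have c0 : singular_value (R0 ^ 2) (matricize (slice i3 i1 i2 y T)) = 0 by exact: ext.
  have ab : a < b by move: a0 a1 a2 b0 b1 b2; do 2!move: (singular_value _ _) => ?; lra.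
  have cb : c < b by move: c0 c1 c2 b0 b1 b2; do 2!move: (singular_value _ _) => ?; lra.
  by rewrite (lt_gtF ab)/= ab cb.
- have c0 := mid _ _ _ o.
  have E : (fun x3 x1 x2 => slice i2 i3 i1 y T x2 x3 x1) = slice i3 i1 i2 y T.
    apply/funext => x3; apply/funext => x1; apply/funext => x2.
    by rewrite [RHS]slice_rot 1?eq_sym// eq_sym.
  rewrite matricize_swap E in c0.
  have a0 : singular_value (R0 ^ 2) (matricize (slice i1 i2 i3 y T)) = 0 by exact: ext.
  have b0 : singular_value (R0 ^ 2) (matricize (slice i2 i3 i1 y T)) = 0 by exact: ext.
  have ac : a < c by move: a0 a1 a2 c0 c1 c2; do 2!move: (singular_value _ _) => ?; lra.
  have bc : b < c by move: c0 c1 c2 b0 b1 b2; do 2!move: (singular_value _ _) => ?; lra.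
  by rewrite (lt_gtF ac) (lt_gtF bc) !andbF/= ac bc.
Qed.

Lemma measurable_matricize_singular_value (R : realType) (dO : measure_display)
    (Omega : measurableType dO) (n1 n2 n3 k : nat)
    (A : Omega -> 'I_n1 -> 'I_n2 -> 'I_n3 -> R) : (0 < k)%N ->
  (forall x b e, measurable_fun setT (fun w => A w x b e)) ->
  measurable_fun setT (fun w => singular_value k (matricize (A w))).
Proof.
move=> k0 mA; apply: measurable_singular_value => // x j.
case/mxvec_indexP: j => b e.
rewrite (_ : (fun w => _) = fun w => A w x b e)//.
by apply/funext => w; rewrite mxE mxvecE mxE.
Qed.

Lemma measurable_incorrect (R : realType) (dO : measure_display)
    (Omega : measurableType dO) (d : nat) (n : 'I_d.+1 -> nat) (tau : 'S_d.+1)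
    (i1 i2 i3 : 'I_d.+1) (R0 m : nat) (oracle : Omega -> entry_index n -> 'I_m -> R)
    (q : 'I_3 -> entry_index n -> 'I_m) (y : entry_index n) :
  (0 < R0)%N -> (forall x k, measurable_fun setT (fun w => oracle w x k)) ->
  measurable [set w | ~~ correct_output tau (three_index i1 i2 i3 R0 (oracle w) q y)].
Proof.
move=> R00 mo; have R20 : (0 < R0 ^ 2)%N by rewrite expn_gt0 R00.
rewrite /three_index.
set a := fun w : Omega => singular_value (R0 ^ 2) (matricize (fun x1 x2 x3 =>
  slice i1 i2 i3 y (fun x => oracle w x (q (inord 0) x)) x1 x2 x3)).
set b := fun w : Omega => singular_value (R0 ^ 2) (matricize (fun x2 x3 x1 =>
  slice i1 i2 i3 y (fun x => oracle w x (q (inord 1) x)) x1 x2 x3)).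
set c := fun w : Omega => singular_value (R0 ^ 2) (matricize (fun x3 x1 x2 =>
  slice i1 i2 i3 y (fun x => oracle w x (q (inord 2) x)) x1 x2 x3)).
have ma : measurable_fun setT a by apply: measurable_matricize_singular_value => // *; exact: mo.
have mb : measurable_fun setT b by apply: measurable_matricize_singular_value => // *; exact: mo.
have mc : measurable_fun setT c by apply: measurable_matricize_singular_value => // *; exact: mo.
pose t (f g h : Omega -> R) := (fun w => Num.max (f w) (g w) < h w).
have mt f g h : measurable_fun setT f -> measurable_fun setT g -> measurable_fun setT h ->
    measurable_fun setT (t f g h).
  by move=> mf mg mh; apply: measurable_fun_ltr => //; exact: measurable_maxr.
pose F w := if t b c a w then correct_order tau i2 i1 i3 else
  if t a c b w then correct_order tau i1 i2 i3 else
  if t a b c w then correct_order tau i2 i3 i1 else false.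
have mF : measurable_fun setT F.
  apply: measurable_fun_ifT; [exact: mt|exact: measurable_cst|].
  apply: measurable_fun_ifT; [exact: mt|exact: measurable_cst|].
  by apply: measurable_fun_ifT; [exact: mt|exact: measurable_cst|exact: measurable_cst].
rewrite (_ : mkset _ = F @^-1` [set false]).
  by rewrite -[X in measurable X]setTI; apply: mF.
apply/seteqP; split=> w /=; rewrite -/(a w) -/(b w) -/(c w) /F /t;
  case: (Num.max (b w) (c w) < a w); case: (Num.max (a w) (c w) < b w);
  case: (Num.max (a w) (b w) < c w) => //= H; by [exact: negbTE|rewrite H].
Qed.

Theorem theorem4p16
  (R : realType) (d : nat) (n r : 'I_d.+1 -> nat)
  (n_gt0 : forall i, (0 < n i)%N) (r_gt0 : forall j, (0 < r j)%N)
  (r1 : r ord0 = 1%N)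
  (tau : 'S_d.+1) (R0 : nat) (R0_gt0 : (0 < R0)%N)
  (n_ends : (R0 <= minn (n (tau ord0)) (n (tau ord_max)))%N)
  (n_mid : forall j : 'I_d.+1, (0 < j < d)%N -> (R0 ^ 2 <= n (tau j))%N)
  (r_lt : forall j : 'I_d.+1, (0 < j)%N -> (r j < R0 ^ 2)%N)
  (r_ge : forall j : 'I_d.+1, (0 < j)%N -> (R0 <= r j)%N)
  (u : tt_param R n r tau)
  (sigma : R) (sigma_gt0 : 0 < sigma)
  (u_sigma : forall i1 i2 i3 : 'I_d.+1, correct_order tau i1 i2 i3 ->
    forall y : entry_index n,
      let A := slice i1 i2 i3 y (tt_tensor r1 u) in
      sigma <=
        singular_value (R0 ^ 2) (matricize (fun x2 x1 x3 => A x1 x2 x3)))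
  (sigma_e : R) (sigma_e_gt0 : 0 < sigma_e)
  (dO : measure_display) (Omega : measurableType dO) (P : probability Omega R)
  (m : nat) (noise : entry_index n * 'I_m -> {RV P >-> R})
  (noise_normal : forall o, normally_distributed (noise o) 0 sigma_e)
  (noise_indep : mutually_independent noise) :
  let n_max : R := (\max_(i < d.+1) n i)%:R in
  let observed (w : Omega) (x : entry_index n) (k : 'I_m) : R :=
    tt_tensor r1 u x + noise (x, k) w in
  forall T : R, T < sigma / sigma_e ->
  forall i1 i2 i3 : 'I_d.+1, i1 != i2 -> i1 != i3 -> i2 != i3 ->
  forall (y : entry_index n) (q : 'I_3 -> entry_index n -> 'I_m),
  (P [set w | ~~ correct_output tau
                   (three_index i1 i2 i3 R0 (observed w) q y)]
   <= (6 * expR (- (1 / 8) *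
         Num.max (T - 2 * n_max - 2 * Num.sqrt n_max) 0 ^+ 2))%:E)%E.
Proof.
move=> n_max observed T TS i1 i2 i3 i12 i13 i23 y q.
set N := (\max_(i < d.+1) n i)%N.
have nN i : (n i <= N)%N by exact: leq_bigmax.
set F := [set w | _].
have mF : measurable F.
  apply: measurable_incorrect => // x k.
  by apply: measurable_funD; [exact: measurable_cst|exact: measurable_funP].
set t := T / 2 - Num.sqrt n_max - n_max.
(* For t <= 0 the maximum in the statement is 0 and the bound is 6, which exceeds any
   probability. *)
have [t0|t0] := lerP t 0.
  rewrite max_r; last by rewrite /t in t0; lra.
  rewrite expr0n/= mulr0 expR0 mulr1.
  by apply: le_trans (probability_le1 P mF) _; rewrite lee_fin; lra.
have tE : - (1 / 8 * Num.max (T - 2 * n_max - 2 * Num.sqrt n_max) 0 ^+ 2) = - (t ^+ 2 / 2).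
  rewrite max_l; last by rewrite /t in t0; lra.
  by rewrite /t; field.
rewrite mulNr tE.
(* The observation read by each matrix entry. Within a matrix these are distinct, hence independent;
   between matrices they may coincide, which the union bound permits. *)
pose f1 x1 x2 x3 := let x := spliced i1 i2 i3 y x1 x2 x3 in (x, q (inord 0) x).
pose f2 x2 x3 x1 := let x := spliced i1 i2 i3 y x1 x2 x3 in (x, q (inord 1) x).
pose f3 x3 x1 x2 := let x := spliced i1 i2 i3 y x1 x2 x3 in (x, q (inord 2) x).
have f1I x b e x' b' e' : f1 x b e = f1 x' b' e' -> [/\ x = x', b = b' & e = e'].
  by move=> /(congr1 fst)/spliced_inj-[].
have [U1 [mU1 PU1 U1P]] := noise_opbound sigma_e_gt0 noise_normal noise_indep
  (n_gt0 i1) (n_gt0 i2) (n_gt0 i3) (nN i1) (nN i2) (nN i3) f1I t0.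
have f2I x b e x' b' e' : f2 x b e = f2 x' b' e' -> [/\ x = x', b = b' & e = e'].
  by move=> /(congr1 fst)/spliced_inj-[].
have [U2 [mU2 PU2 U2P]] := noise_opbound sigma_e_gt0 noise_normal noise_indep
  (n_gt0 i2) (n_gt0 i3) (n_gt0 i1) (nN i2) (nN i3) (nN i1) f2I t0.
have f3I x b e x' b' e' : f3 x b e = f3 x' b' e' -> [/\ x = x', b = b' & e = e'].
  by move=> /(congr1 fst)/spliced_inj-[].
have [U3 [mU3 PU3 U3P]] := noise_opbound sigma_e_gt0 noise_normal noise_indep
  (n_gt0 i3) (n_gt0 i1) (n_gt0 i2) (nN i3) (nN i1) (nN i2) f3I t0.
have R20 : (0 < R0 ^ 2)%N by rewrite expn_gt0 R0_gt0.
have T0 : 0 < T.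
  have n0 : 0 <= n_max by exact: ler0n.
  by have := sqrtr_ge0 n_max; rewrite /t in t0; lra.
(* The choice of t makes the norm bound equal to half of sigma_e T, and sigma_e T < sigma is the gap
   condition of [three_index_correct]. *)
have tT : sigma_e * (Num.sqrt N%:R + N%:R + t) = sigma_e * T / 2.
  by rewrite /t /n_max -/N; field.
have FU : F `<=` U1 `|` U2 `|` U3.
  move=> w; rewrite /F /=; apply: contraNP => /not_orP[/not_orP[/U1P o1 /U2P o2] /U3P o3].
  move: o1 o2 o3; rewrite !tT => o1 o2 o3.
  have e0 : 0 <= sigma_e * T / 2 by rewrite divr_ge0// mulr_ge0 ?ltW.
  apply: (@three_index_correct R d n tau i1 i2 i3 R0 m (tt_tensor r1 u) (observed w) q y sigma
    (sigma_e * T / 2)) => //.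
  - by move: TS; rewrite ltr_pdivlMr// => TS; lra.
  - by move=> j1 j2 j3 o; exact: u_sigma.
  - by move=> j1 j2 j3 e; exact: extreme_singular_value.
  - rewrite (matricizeD (slice i1 i2 i3 y (tt_tensor r1 u)) (fun x b e => noise (f1 x b e) w)).
    exact: singular_value_dist.
  - rewrite (matricizeD (fun x2 x3 x1 => slice i1 i2 i3 y (tt_tensor r1 u) x1 x2 x3)
      (fun x b e => noise (f2 x b e) w)).
    exact: singular_value_dist.
  - rewrite (matricizeD (fun x3 x1 x2 => slice i1 i2 i3 y (tt_tensor r1 u) x1 x2 x3)
      (fun x b e => noise (f3 x b e) w)).
    exact: singular_value_dist.
apply: (@le_trans _ _ (P (U1 `|` U2 `|` U3))).
  by apply: le_measure; rewrite ?inE//; do !apply: measurableU.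
apply: le_trans (measureU2 _ _ _) _ => //; first exact: measurableU.
apply: le_trans (leeD (measureU2 _ _ _) PU3) _ => //.
apply: le_trans (leeD (leeD PU1 PU2) (lexx _)) _.
rewrite -!EFinD lee_fin; have := expR_gt0 (- (t ^+ 2 / 2)).
move: (expR _) => e; lra.
Qed.
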